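(* Let $A$ be a unital regular semi-simple commutative Banach algebra. Assume there is a constant $C>0$ such that whenever $V$ is an open subset of $\partial A$, $p\in\mathbb{N}$, and $f_1, \ldots, f_p \in A$ satisfy $\mathrm{supp}(\check{(f_1 f_2\cdots f_p)}) \subset V$, then $\|f_1 \cdots f_p\|_A \leq C \sum_{j=1}^p \|f_j\|_A \,\big\| \prod_{k \neq j}\check{f_k}\big\|_{C(\mathrm{cl}\,V)}$ ($C$ independent of $V$, $p$, $f_1,\ldots,f_p$). Assume additionally that whenever $f,g \in A$ and $\mathrm{supp}(\check{f}) \cap \mathrm{supp}(\check{g}) = \emptyset$, then $\|f+g\|_A = \|f-g\|_A$. Let $U$ be an automorphism of $A$ with induced homeomorphism $\varphi$ such that the set of all $\varphi$-periodic points is of first category in $\partial A$ and $\sigma(U) = \mathbb{T}$. Let $w \in A^{-1}$ and $T = wU$. Then $\sigma(T) = \sigma(\check{T})$.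
   Context: $A$ is a unital commutative semi-simple Banach algebra with maximal ideal space $\mathfrak{M}_A$ and Shilov boundary $\partial A$; regular means the Gelfand transforms separate points from closed sets in $\mathfrak{M}_A$. For $f\in A$, $\check f$ is the restriction of the Gelfand transform $\hat f$ to $\partial A$, and $\mathrm{supp}$ denotes the closed support in $\partial A$; $\check A$ is the closure of $\{\check f: f\in A\}$ in $C(\partial A)$ with sup norm; $\|\cdot\|_{C(\mathrm{cl}V)}$ is the sup norm over the closure of $V$. The automorphism $U$ induces a homeomorphism $\varphi$ of $\mathfrak{M}_A$ by $\widehat{Uf}(m)=\hat f(\varphi(m))$, with $\varphi(\partial A)=\partial A$. $T=wU$ means $Tf=w\cdot Uf$; $\check T$ is the operator on $\check A$ given by $(\check Tg)(t)=\check w(t)g(\varphi(t))$. A point is $\varphi$-periodic if $\varphi^n(t)=t$ for some $n\in\mathbb{N}$. $\mathbb{T}$ is the unit circle. *)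

(* Defs.v *)
From HB Require Import structures.
From mathcomp Require Import all_boot all_order all_algebra.
From mathcomp Require Import complex.
From mathcomp Require Import boolp classical_sets reals.
Set Implicit Arguments. Unset Strict Implicit. Unset Printing Implicit Defensive.
Import Order.TTheory GRing.Theory Num.Theory.
Local Open Scope ring_scope.
Local Open Scope classical_set_scope.

Section BanachAlgebraDefs.
Variable R : realType.
Variable A : comUnitAlgType R[i].

Definition cabs (z : R[i]) : R := Num.sqrt (complex.Re z ^+ 2 + complex.Im z ^+ 2).

Definition is_banach_alg_norm (nA : A -> R) : Prop :=
  [/\ (forall x y, nA (x + y) <= nA x + nA y),
      (forall (a : R[i]) x, nA (a *: x) = cabs a * nA x),
      (forall x, nA x = 0 -> x = 0),
      (forall x y, nA (x * y) <= nA x * nA y) &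
      (forall u : nat -> A,
        (forall e : R, 0 < e -> exists N, forall m n, (N <= m)%N -> (N <= n)%N ->
             nA (u m - u n) < e) ->
        exists l, forall e : R, 0 < e -> exists N, forall n, (N <= n)%N -> nA (u n - l) < e)].

(* candidate points of the maximal ideal space: functionals A -> C *)
Definition chi := A -> R[i].

Definition is_char (m : chi) : Prop :=
  [/\ (forall (a : R[i]) x y, m (a *: x + y) = a * m x + m y),
      (forall x y, m (x * y) = m x * m y) & m 1 = 1].

Definition MA : set chi := [set m | is_char m].

(* relative openness in X for the Gelfand (weak-star) topology *)
Definition wopen (X S : set chi) : Prop :=
  S `<=` X /\
  forall c, S c -> exists (fs : seq A) (e : R), 0 < e /\
     forall p, X p -> (forall f, f \in fs -> cabs (p f - c f) < e) -> S p.

Definition wclosure (X S : set chi) : set chi :=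
  [set c | X c /\ forall (fs : seq A) (e : R), 0 < e ->
     exists p, S p /\ X p /\ forall f, f \in fs -> cabs (p f - c f) < e].

Definition wclosed (X S : set chi) : Prop := S `<=` X /\ wopen X (X `\` S).

Definition is_boundary (B : set chi) : Prop :=
  B `<=` MA /\ forall f, exists b, B b /\ forall m, MA m -> cabs (m f) <= cabs (b f).

Definition shilov : set chi :=
  [set m | MA m /\ forall B, is_boundary B -> wclosed MA B -> B m].

Definition semisimple : Prop := forall f : A, (forall m, MA m -> m f = 0) -> f = 0.

Definition regular : Prop :=
  forall F, wclosed MA F -> forall m, MA m -> ~ F m ->
    exists f : A, m f = 1 /\ forall t, F t -> t f = 0.

Definition supp (f : A) : set chi :=
  wclosure shilov [set t | shilov t /\ t f <> 0].

Definition nowhere_dense (X E : set chi) : Prop :=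
  forall S, wopen X S -> S `<=` wclosure X E -> S = set0.

Definition first_category (X E : set chi) : Prop :=
  E `<=` X /\ exists N : nat -> set chi,
    (forall n, N n `<=` X /\ nowhere_dense X (N n)) /\ E `<=` \bigcup_n N n.

Definition is_automorphism (U : A -> A) : Prop :=
  [/\ (forall (a : R[i]) x y, U (a *: x + y) = a *: U x + U y),
      (forall x y, U (x * y) = U x * U y), U 1 = 1 & bijective U].

(* induced map on M_A: \hat{Uf}(m) = \hat f(phi m) *)
Definition phi (U : A -> A) (m : chi) : chi := m \o U.

Definition periodic_points (U : A -> A) : set chi :=
  [set t | shilov t /\ exists n, (0 < n)%N /\ iter n (phi U) t = t].

Definition op_spectrum (nA : A -> R) (T : A -> A) : set R[i] :=
  [set l | ~ exists S : A -> A,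
     [/\ (exists K : R, forall x, nA (S x) <= K * nA x),
         (forall x, S (T x - l *: x) = x) &
         (forall x, T (S x) - l *: S x = x)]].

Definition unit_circle : set R[i] := [set l | cabs l = 1].

(* \check A: closure of {\check f} in C(shilov) with the sup norm;
   elements are represented by functions on chi, only values on the
   Shilov boundary matter *)
Definition supnorm (g : chi -> R[i]) : R := sup [set cabs (g t) | t in shilov].

Definition checkA : set (chi -> R[i]) :=
  [set g | forall e : R, 0 < e -> exists f : A, forall t, shilov t -> cabs (g t - t f) <= e].

Definition checkT (w : A) (U : A -> A) (g : chi -> R[i]) : chi -> R[i] :=
  fun t => t w * g (phi U t).

(* spectrum of \check T as an operator on the Banach space \check A
   (equality of elements of \check A = equality on the Shilov boundary) *)
Definition checkT_spectrum (w : A) (U : A -> A) : set R[i] :=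
  [set l | ~ exists S : (chi -> R[i]) -> (chi -> R[i]),
     [/\ (forall g, checkA g -> checkA (S g)),
         (exists K : R, forall g, checkA g -> supnorm (S g) <= K * supnorm g),
         (forall g, checkA g -> forall t, shilov t ->
              checkT w U (S g) t - l * S g t = g t) &
         (forall g, checkA g -> forall t, shilov t ->
              S (fun s => checkT w U g s - l * g s) t = g t)]].

End BanachAlgebraDefs.

(* Main.v *)
(* By regularity the Shilov boundary is the whole maximal ideal space. Rescaling [w], only
   the spectral value 1 of [T = w U] matters. Put [a_k(t) = |(T^k 1)(t)|] for integer [k].

   If some point has [a_k >= 1/2] for all [k], then near it there are aperiodic points; for
   a bump [u] at such a point the supports of the [T^k u] are disjoint, and
   [sum_k r^|k| T^k u] with [r] close to 1 is an approximate eigenvector of [T], for the sup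
   norm as well as for the norm of [A]: the disjointness hypothesis separates the part
   [k <= 0] from the part [k > 0], and the product estimate, with the subexponential growth
   of the powers of [U], controls the two boundary terms. So if 1 is outside one of the two
   spectra there is no such point. By compactness every [a_k(t)] then decays exponentially
   as [k] tends to [+oo] or to [-oo], uniformly in [t], and [1 - a T] is bounded below in the
   sup norm, uniformly in [|a| = 1]. Thus a dense range of [1 - T] makes the check operator
   minus 1 invertible.

   Conversely, if [1 - T] has dense range in the sup norm, so has [1 - a T] for all
   [|a| = 1], and averaging gives approximate solutions of [v - T^n v = 1], [n = 2^k],
   bounded in the sup norm uniformly in [n]. They are close to 1 on the points decaying
   forward and to 0 on those decaying backward, so these two sets are disjoint. An
   idempotent [e] of [A] separates them, and [e T^m + (1 - e) T^-m] is a contraction of [A]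
   for large [m] by the product estimate, which makes [1 - T] invertible on [A]. *)
Require Import Defs.
From HB Require Import structures.
From mathcomp Require Import all_boot all_order all_algebra.
From mathcomp Require Import complex.
From mathcomp Require Import boolp classical_sets reals filter.
From mathcomp Require Import ring lra zify.
Set Implicit Arguments. Unset Strict Implicit. Unset Printing Implicit Defensive.
Import Order.TTheory GRing.Theory Num.Theory.
Local Open Scope ring_scope.
Local Open Scope classical_set_scope.

(** The norm of [A] dominates the sup norm but need not be controlled by it; the product estimate is
    the bridge. It acts like a Leibniz rule: each factor in turn pays its norm in [A], the others
    only the sup of their product. For [w U(w) ... U^(n-1)(w) g] this bounds the norm in [A] by the
    sup of the weight near the support of [g], up to a loss [K s^n] with [s > 1] arbitrary. Such
    losses are harmless against a damping [r < 1] or a decay [th < 1], and this is how [sigma(U)]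
    enters: it makes [U] and its inverse grow subexponentially.

    Contour integrals are replaced by averages. Since [1 - b^2 L^2 = (1 - b L)(1 + b L)], an inverse
    of [1 - b^2 L^2] is the mean of the inverses of [1 - b L] and [1 + b L], so bounds uniform on
    the circle pass from [T] to all [T^(2^k)] without loss.

    The inverse of the check operator maps [A] only into its sup-norm closure. What descends to [A]
    is a lower bound in the sup norm and a dense range, not surjectivity; hence the approximate
    solutions and approximate idempotents, made exact at the end. *)

(** * The modulus on the complex numbers and roots on the unit circle *)

Section ComplexModulus.
Variable R : realType.
Implicit Types (z x y : R[i]).

Lemma cabs_norm z : cabs z = complex.Re `|z|.
Proof. by rewrite normc_def. Qed.

Lemma cabsC z : (cabs z)%:C%C = `|z|.
Proof. by rewrite normc_def. Qed.

Lemma cabs_ge0 z : 0 <= cabs z.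
Proof. exact: sqrtr_ge0. Qed.

Lemma cabs0 : cabs (0 : R[i]) = 0.
Proof. by rewrite cabs_norm normr0. Qed.

Lemma cabs1 : cabs (1 : R[i]) = 1.
Proof. by rewrite cabs_norm normr1. Qed.

Lemma cabsM x y : cabs (x * y) = cabs x * cabs y.
Proof. by apply: complexI; rewrite rmorphM /= !cabsC normrM. Qed.

Lemma cabsN x : cabs (- x) = cabs x.
Proof. by rewrite cabs_norm normrN -cabs_norm. Qed.

Lemma cabsB x y : cabs (x - y) = cabs (y - x).
Proof. by rewrite -cabsN opprB. Qed.

Lemma cabsD x y : cabs (x + y) <= cabs x + cabs y.
Proof. by rewrite -lecR rmorphD /= !cabsC ler_normD. Qed.

Lemma cabs_subD x y : cabs (x - y) <= cabs x + cabs y.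
Proof. by rewrite -(cabsN y) cabsD. Qed.

Lemma cabs_eq0 x : (cabs x == 0) = (x == 0).
Proof. by rewrite -(inj_eq (@complexI R)) cabsC normr_eq0. Qed.

Lemma cabs_gt0 x : (0 < cabs x) = (x != 0).
Proof. by rewrite lt_def cabs_ge0 andbT cabs_eq0. Qed.

Lemma cabsV x : cabs x^-1 = (cabs x)^-1.
Proof. by apply: complexI; rewrite fmorphV /= !cabsC normfV. Qed.

Lemma cabsX x n : cabs (x ^+ n) = cabs x ^+ n.
Proof. by elim: n => [|n IH]; rewrite ?cabs1// !exprS cabsM IH. Qed.

Lemma cabs_real (r : R) : 0 <= r -> cabs r%:C%C = r.
Proof. by move=> r0; apply: complexI; rewrite cabsC ger0_norm// ler0c. Qed.

Lemma cabs_ge_Re z : `|complex.Re z| <= cabs z.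
Proof. by rewrite -lecR cabsC normc_ge_Re. Qed.

Lemma cabs_ge_Im z : `|complex.Im z| <= cabs z.
Proof.
case: z => a b; rewrite /cabs /= -sqrtr_sqr ler_sqrt.
  by rewrite lerDr sqr_ge0.
by rewrite addr_ge0 ?sqr_ge0.
Qed.

Lemma cabs_le_ReIm z : cabs z <= `|complex.Re z| + `|complex.Im z|.
Proof.
rewrite {1}(complexE z); apply: (le_trans (cabsD _ _)).
have h (r : R) : cabs r%:C%C = `|r|.
  by apply: complexI; rewrite cabsC /cabs normc_def /= expr0n addr0 sqrtr_sqr.
have i1 : cabs ('i%C : R[i]) = 1.
  by rewrite /cabs /= expr0n expr1n add0r sqrtr1.
by rewrite cabsM i1 mul1r !h.
Qed.

Lemma unit_circle_sqrt (a : R[i]) : cabs a = 1 ->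
  exists b, [/\ b ^+ 2 = a, cabs b = 1 & 0 <= complex.Re b].
Proof.
move=> a1; have b2 := sqr_sqrtc a; set b := sqrtc a in b2.
have b1 : cabs b = 1.
  by apply/eqP; rewrite -(@pexpr_eq1 _ _ 2) ?cabs_ge0// -cabsX b2 a1.
have [h|h] := leP 0 (complex.Re b); first by exists b.
exists (- b); rewrite sqrrN cabsN; split=> //.
by move: h; case: (b) => x y /=; lra.
Qed.

(* Repeated square roots with nonnegative real part contract the distance to 1. *)
Lemma unit_circle_root_near1 (a : R[i]) (d : R) : cabs a = 1 -> 0 < d ->
  exists b n, [/\ b ^+ n = a, cabs b = 1 & cabs (b - 1) < d].
Proof.
move=> a1 d0.
(* A root [c] of [b] satisfies [|b - 1| = |c - 1| |c + 1|] with [|c + 1|^2 >= 2], so each root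
   divides the distance by at least 5/4. The slower rate [2 / (1 + k/4)] survives this, as
   [(5/4)(1 + k/4) >= 1 + (k+1)/4]. *)
suff H k : exists b n, [/\ b ^+ n = a, cabs b = 1 & cabs (b - 1) <= 2 / (1 + k%:R / 4)].
  pose k := Num.truncn (8 / d).
  have [b [n [ba b1 bd]]] := H k.+1; exists b, n; split=> //.
  apply: (le_lt_trans bd).
  have kd : 8 / d < k.+1%:R by apply: truncnS_gt.
  have k0 : 0 < 1 + k.+1%:R / 4 :> R by rewrite addr_gt0// divr_gt0.
  rewrite ltr_pdivrMr//; move: kd; rewrite ltr_pdivrMr// => kd; nra.
elim: k => [|k [b [n [ba b1 bd]]]].
  exists a, 1%N; split=> //; rewrite mul0r addr0 divr1.
  by apply: (le_trans (cabs_subD _ _)); rewrite a1 cabs1.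
have [c [cb c1 cR]] := unit_circle_sqrt b1.
exists c, (2 * n)%N; split=> //; first by rewrite exprM cb.
have fac : cabs (b - 1) = cabs (c - 1) * cabs (c + 1).
  by rewrite -cabsM -cb; congr cabs; ring.
have c2 : 5 / 4 <= cabs (c + 1).
  have : 2 <= cabs (c + 1) ^+ 2.
    have c1' : complex.Re c ^+ 2 + complex.Im c ^+ 2 = 1.
      by rewrite -[LHS]sqr_sqrtr ?addr_ge0 ?sqr_ge0// -/(cabs c) c1 expr1n.
    rewrite sqr_sqrtr ?addr_ge0 ?sqr_ge0//.
    by move: c1' cR; case: (c) => x y /=; rewrite addr0; nra.
  move=> h; have := cabs_ge0 (c + 1); nra.
have := cabs_ge0 (c - 1).
have k0 : 0 <= k%:R :> R by [].
move: bd; rewrite fac ler_pdivlMr; last lra.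
move=> h1 h2; rewrite ler_pdivlMr; last by rewrite -natr1; lra.
rewrite -natr1; set D := cabs (c - 1) in h1 h2 *; set k' := k%:R in k0 h1 *.
have h3 : D * (5 / 4) * (1 + k' / 4) <= D * cabs (c + 1) * (1 + k' / 4).
  by rewrite ler_wpM2r ?ler_wpM2l//; lra.
have : 0 <= D * k' by rewrite mulr_ge0.
nra.
Qed.

End ComplexModulus.

(** * Limits along an ultrafilter on the natural numbers *)

Section UltraLimit.
Variable R : realType.

Variable G : set_system nat.
Hypothesis GU : UltraFilter G.

Let GF : Filter G := @filter_filter _ _ (@ultra_proper _ _ GU).

Definition ucvg (z : nat -> R[i]) (l : R[i]) : Prop :=
  forall e : R, 0 < e -> G [set n | cabs (z n - l) < e].

Lemma ultra_ex (P : set nat) : G P -> exists n, P n.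
Proof.
by move=> GP; have := @filter_ex _ _ (@ultra_proper _ _ GU) P GP.
Qed.

Lemma ultra_all (P : set nat) : (forall n, P n) -> G P.
Proof. by move=> h; apply: (@filterS _ _ GF setT) => //; apply: filterT. Qed.

(** The limit is the supremum of the levels [a] with [a <= x n] for [G]-almost all [n]; the upper
    bound uses that [G] contains each set or its complement. *)
Lemma real_ucvg (x : nat -> R) (B : R) : (forall n, `|x n| <= B) ->
  exists l, forall e, 0 < e -> G [set n | `|x n - l| < e].
Proof.
move=> xB.
pose S := [set a : R | G [set n | a <= x n]].
have S0 : S (- B).
  by apply: ultra_all => n /=; have := xB n; rewrite ler_norml => /andP[].
have SB : ubound S B.
  move=> a /ultra_ex[n /= an]; apply: (le_trans an).
  by have := xB n; rewrite ler_norml => /andP[].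
have hS : has_sup S by split; [exists (- B)|exists B].
exists (sup S) => e e0.
have [a Sa aS] := sup_adherent e0 hS.
have G2 : G (~` [set n | sup S + e / 2 <= x n]).
  have [h|//] := in_ultra_setVsetC [set n | sup S + e / 2 <= x n] GU.
  by have := ub_le_sup (proj2 hS) h; lra.
apply: filterS (filterI Sa G2) => n /= [an /negP].
by rewrite -ltNge => nx; rewrite ltr_norml; apply/andP; split; lra.
Qed.

Lemma ucvg_bounded (z : nat -> R[i]) (B : R) : (forall n, cabs (z n) <= B) ->
  exists l, ucvg z l.
Proof.
move=> zB.
have [a ha] := @real_ucvg (fun n => complex.Re (z n)) B
  (fun n => le_trans (cabs_ge_Re (z n)) (zB n)).
have [b hb] := @real_ucvg (fun n => complex.Im (z n)) B
  (fun n => le_trans (cabs_ge_Im (z n)) (zB n)).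
exists (a +i* b)%C => e e0.
have e2 : 0 < e / 2 by rewrite divr_gt0.
apply: filterS (filterI (ha _ e2) (hb _ e2)) => n /= [h1 h2].
apply: (le_lt_trans (cabs_le_ReIm _)).
by move: h1 h2; case: (z n) => x y /=; lra.
Qed.

Lemma ucvg_cabs_le (z : nat -> R[i]) l (c : R[i]) B : ucvg z l ->
  G [set n | cabs (z n - c) <= B] -> cabs (l - c) <= B.
Proof.
move=> zl GB; rewrite leNgt; apply/negP => lB.
have e0 : 0 < cabs (l - c) - B by rewrite subr_gt0.
have [n /= [h1 h2]] := ultra_ex (filterI (zl _ e0) GB).
have : cabs (l - c) <= cabs (z n - l) + cabs (z n - c).
  by rewrite (cabsB (z n) l) -(subrKA (z n)) cabsD.
lra.
Qed.

Lemma ucvg_cabs_ge (z : nat -> R[i]) l B : ucvg z l ->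
  G [set n | B <= cabs (z n)] -> B <= cabs l.
Proof.
move=> zl GB; rewrite leNgt; apply/negP => lB.
have e0 : 0 < B - cabs l by rewrite subr_gt0.
have [n /= [h1 h2]] := ultra_ex (filterI (zl _ e0) GB).
have : cabs (z n) <= cabs (z n - l) + cabs l by rewrite -{1}(subrK l (z n)) cabsD.
lra.
Qed.

Lemma ucvg_unique (z : nat -> R[i]) l l' : ucvg z l -> ucvg z l' -> l = l'.
Proof.
move=> h h'; apply/eqP; rewrite -subr_eq0 -cabs_eq0 eq_le cabs_ge0 andbT.
rewrite leNgt; apply/negP => p.
have p2 : 0 < cabs (l - l') / 2 by rewrite divr_gt0.
have : cabs (l - l') <= cabs (l - l') / 2.
  by apply: (ucvg_cabs_le h); apply: filterS (h' _ p2) => n /=; apply: ltW.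
lra.
Qed.

Lemma ucvg_cst (l : R[i]) : ucvg (fun=> l) l.
Proof. by move=> e e0; apply: ultra_all => n /=; rewrite subrr cabs0. Qed.

Lemma ucvg_lin (a : R[i]) (x y : nat -> R[i]) l m : ucvg x l -> ucvg y m ->
  ucvg (fun n => a * x n + y n) (a * l + m).
Proof.
move=> xl ym e e0.
have a0 := cabs_ge0 a.
have d0 : 0 < e / (2 * (1 + cabs a)) by rewrite divr_gt0//; lra.
have e2 : 0 < e / 2 by rewrite divr_gt0.
apply: filterS (filterI (xl _ d0) (ym _ e2)) => n /= [h1 h2].
have -> : a * x n + y n - (a * l + m) = a * (x n - l) + (y n - m) by ring.
apply: (le_lt_trans (cabsD _ _)); rewrite cabsM.
move: h1; rewrite ltr_pdivlMr; last lra.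
have := cabs_ge0 (x n - l); nra.
Qed.

Lemma ucvg_mul (x y : nat -> R[i]) l m : ucvg x l -> ucvg y m ->
  ucvg (fun n => x n * y n) (l * m).
Proof.
move=> xl ym e e0.
have l0 := cabs_ge0 l; have m0 := cabs_ge0 m.
have d0 : 0 < e / (2 * (1 + cabs m)) by rewrite divr_gt0//; lra.
have d1 : 0 < e / (2 * (1 + cabs l)) by rewrite divr_gt0//; lra.
apply: filterS (filterI (filterI (xl _ d0) (xl _ ltr01)) (ym _ d1)) => n /= [[h1 h3] h2].
have -> : x n * y n - l * m = m * (x n - l) + x n * (y n - m) by ring.
apply: (le_lt_trans (cabsD _ _)); rewrite !cabsM.
have h4 : cabs (x n) <= 1 + cabs l.
  have := cabsD (x n - l) l; rewrite subrK; lra.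
move: h1 h2; rewrite !ltr_pdivlMr; try lra.
have := cabs_ge0 (x n - l); have := cabs_ge0 (y n - m); have := cabs_ge0 (x n).
nra.
Qed.

End UltraLimit.

Lemma nat_free_ultrafilter : exists G : set_system nat,
  UltraFilter G /\ forall N, G [set n | (N <= n)%N].
Proof.
have [G [GU Gs]] := @ultraFilterLemma nat eventually _.
by exists G; split=> // N; apply: Gs; exists N.
Qed.

Lemma expr_eventually_small (R : realType) (q e : R) : 0 <= q -> q < 1 -> 0 < e ->
  exists N, forall n, (N <= n)%N -> q ^+ n < e.
Proof.
move=> q0 q1 e0.
have [->|qn0] := eqVneq q 0.
  by exists 1%N => -[//|n] _; rewrite expr0n.
have qp : 0 < q by rewrite lt_def qn0.
pose h := q^-1 - 1.
have h0 : 0 < h by rewrite subr_gt0 invf_gt1.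
have bern n : 1 + n%:R * h <= q^-1 ^+ n.
  elim: n => [|n IH]; first by rewrite mul0r addr0.
  rewrite exprS; have -> : q^-1 = 1 + h by rewrite /h addrC subrK.
  have hn : 0 <= n%:R * h by rewrite mulr_ge0// ltW.
  have h1 : (1 + h) * (1 + n%:R * h) <= (1 + h) * (1 + h) ^+ n.
    rewrite ler_wpM2l//; first by lra.
    by have -> : 1 + h = q^-1 by rewrite /h addrC subrK.
  rewrite -natr1; nra.
exists (Num.truncn (e^-1 / h)).+1 => n nN.
have ne : e^-1 / h < n%:R.
  by apply: (lt_le_trans (truncnS_gt _)); rewrite ler_nat.
rewrite -[q]invrK exprVn -[e]invrK ltf_pV2 ?posrE ?invr_gt0 ?exprn_gt0 ?invr_gt0//.
by move: ne; rewrite ltr_pdivrMr// => ne; have := bern n; lra.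
Qed.

(** * Neumann series, bounded inverses, averaged resolvents *)

Section BanachAlgebra.
Variables (R : realType) (A : comUnitAlgType R[i]) (nA : A -> R).
Hypothesis hnA : is_banach_alg_norm nA.

Lemma nAD x y : nA (x + y) <= nA x + nA y.
Proof. by case: hnA. Qed.

Lemma nAZ (a : R[i]) x : nA (a *: x) = cabs a * nA x.
Proof. by case: hnA. Qed.

Lemma nA_eq0 x : nA x = 0 -> x = 0.
Proof. by case: hnA => _ _ h _ _; apply: h. Qed.

Lemma nAM x y : nA (x * y) <= nA x * nA y.
Proof. by case: hnA. Qed.

Lemma nA0 : nA 0 = 0.
Proof. by rewrite -(scale0r (0 : A)) nAZ cabs0 mul0r. Qed.

Lemma nAN x : nA (- x) = nA x.
Proof. by rewrite -scaleN1r nAZ cabsN cabs1 mul1r. Qed.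

Lemma nA_ge0 x : 0 <= nA x.
Proof. by have := nAD x (- x); rewrite subrr nA0 nAN; lra. Qed.

Lemma nA_subD x y : nA (x - y) <= nA x + nA y.
Proof. by rewrite -(nAN y) nAD. Qed.

Lemma nAB x y : nA (x - y) = nA (y - x).
Proof. by rewrite -nAN opprB. Qed.

Lemma nA_dist x y z : nA (x - z) <= nA (x - y) + nA (y - z).
Proof. by rewrite -(subrKA y x (- z)) nAD. Qed.

Lemma nA_gt0 x : x != 0 -> 0 < nA x.
Proof.
by move=> x0; rewrite lt_def nA_ge0 andbT; apply: contra_neq x0 => /nA_eq0.
Qed.

Lemma series_cvg (a : nat -> A) (K q : R) : 0 <= q -> q < 1 ->
  (forall k, nA (a k) <= K * q ^+ k) ->
  exists l, forall n, nA (l - \sum_(k < n) a k) <= K * q ^+ n / (1 - q).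
Proof.
move=> q0 q1 ha; set s := fun n => \sum_(k < n) a k.
have K0 : 0 <= K by have := ha 0%N; rewrite expr0 mulr1; apply: le_trans (nA_ge0 _).
have q1' : 0 < 1 - q by lra.
have qn0 n : 0 <= q ^+ n by rewrite exprn_ge0.
have tail n m : nA (s (n + m)%N - s n) <= K * q ^+ n / (1 - q).
  (* Keeping the exact finite geometric sum lets the induction on [m] close. *)
  suff h : nA (s (n + m)%N - s n) <= K * (q ^+ n - q ^+ (n + m)) / (1 - q).
    apply: (le_trans h); rewrite ler_pM2r ?invr_gt0// ler_wpM2l//.
    by rewrite gerBl.
  elim: m => [|m IH]; first by rewrite addn0 !subrr nA0 mulr0 mul0r.
  rewrite addnS {1}/s big_ord_recr /= -/(s _) addrAC.
  apply: (le_trans (nAD _ _)); apply: (le_trans (lerD IH (ha _))).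
  rewrite -lerBrDl -mulrBl -mulrBr exprS opprB addrC addrA subrK.
  rewrite ler_pdivlMr// -mulrA ler_wpM2l//; lra.
have [l hl] : exists l, forall e : R, 0 < e -> exists N, forall n, (N <= n)%N -> nA (s n - l) < e.
  have [_ _ _ _ hc] := hnA; apply: hc => e e0.
  have [] := @expr_eventually_small R q (e * (1 - q) / (2 * (K + 1))) => //.
    by rewrite divr_gt0 ?mulr_gt0//; lra.
  move=> N hN; exists N => m n Nm Nn.
  have hm := tail N (m - N)%N; have hn := tail N (n - N)%N.
  rewrite !subnKC// in hm hn.
  apply: (le_lt_trans (nA_dist _ (s N) _)); rewrite (nAB (s N)).
  have : K * q ^+ N / (1 - q) < e / 2.
    rewrite ltr_pdivrMr//; have := hN N (leqnn N); rewrite ltr_pdivlMr; last lra.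
    have := qn0 N; nra.
  by move: hm hn; lra.
exists l => n; apply/ler_addgt0Pr => e e0.
have [N hN] := hl e e0.
apply: (le_trans (nA_dist _ (s (n + N)%N) _)); rewrite addrC (nAB l).
by rewrite lerD ?tail// ltW// hN// leq_addl.
Qed.

Definition linop (T : A -> A) := forall (a : R[i]) x y, T (a *: x + y) = a *: T x + T y.

Lemma linopD T : linop T -> forall x y, T (x + y) = T x + T y.
Proof. by move=> hT x y; have := hT 1 x y; rewrite !scale1r. Qed.

Lemma linop0 T : linop T -> T 0 = 0.
Proof.
by move=> hT; have := linopD hT 0 0; rewrite addr0 => /eqP; rewrite -subr_eq subrr => /eqP.
Qed.

Lemma linopZ T : linop T -> forall (a : R[i]) x, T (a *: x) = a *: T x.
Proof. by move=> hT a x; have := hT a x 0; rewrite (linop0 hT) !addr0. Qed.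

Lemma linopN T : linop T -> forall x, T (- x) = - T x.
Proof. by move=> hT x; rewrite -scaleN1r linopZ// scaleN1r. Qed.

Lemma linopB T : linop T -> forall x y, T (x - y) = T x - T y.
Proof. by move=> hT x y; rewrite linopD// linopN. Qed.

Lemma linop_iter T n : linop T -> linop (iter n T).
Proof. by move=> hT; elim: n => [|n IH] a x y //=; rewrite IH hT. Qed.

Lemma linop_scale T (c : R[i]) : linop T -> linop (fun x => c *: T x).
Proof. by move=> hT a x y; rewrite hT scalerDr !scalerA mulrC. Qed.

Lemma neumann (E : A -> A) (q : R) : linop E -> 0 <= q -> q < 1 ->
  (forall x, nA (E x) <= q * nA x) ->
  forall y, exists x, x - E x = y /\ nA x <= nA y / (1 - q).
Proof.
move=> hE q0 q1 bE y.
have ak k : nA (iter k E y) <= nA y * q ^+ k.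
  elim: k => [|k IH]; first by rewrite mulr1.
  by rewrite iterS exprS mulrCA; apply: (le_trans (bE _)); rewrite ler_wpM2l.
have [l hl] := series_cvg q0 q1 ak.
exists l; split; last by have := hl 0%N; rewrite big_ord0 subr0 mulr1.
have tele n : \sum_(k < n) iter k E y - E (\sum_(k < n) iter k E y) = y - iter n E y.
  elim: n => [|n IH]; first by rewrite big_ord0 linop0// subr0 subrr.
  rewrite big_ord_recr /= linopD// opprD addrACA IH.
  by rewrite addrA subrK.
apply/eqP; rewrite -subr_eq0; apply/eqP/nA_eq0/eqP; rewrite eq_le nA_ge0 andbT.
apply/ler_addgt0Pr => e e0; rewrite add0r.
have y0 := nA_ge0 y.
have [] := @expr_eventually_small R q (e * (1 - q) / (4 * (nA y + 1))) => //.
  by rewrite divr_gt0 ?mulr_gt0//; lra.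
move=> N /(_ N (leqnn N)) hN.
set s := \sum_(k < N) iter k E y.
have -> : l - E l - y = (l - s) - E (l - s) - iter N E y.
  rewrite linopB//; apply/eqP; rewrite -subr_eq0; apply/eqP.
  have := tele N; rewrite -/s => /eqP; rewrite subr_eq => /eqP {1}->.
  ring.
apply: (le_trans (nA_subD _ _)); apply: (le_trans (lerD (nA_subD _ _) (ak N))).
have h1 := hl N; rewrite -/s in h1.
have h2 : nA (E (l - s)) <= nA (l - s).
  by apply: (le_trans (bE _)); rewrite ler_piMl ?nA_ge0// ltW.
have h3 : nA y * q ^+ N <= nA y * q ^+ N / (1 - q).
  by rewrite ler_peMr ?mulr_ge0 ?exprn_ge0// invf_ge1; lra.
have h4 : nA y * q ^+ N / (1 - q) <= e / 4.
  rewrite ler_pdivrMr; last lra.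
  have qN : 0 <= q ^+ N by rewrite exprn_ge0.
  move: hN; rewrite ltr_pdivlMr; last lra.
  nra.
lra.
Qed.

(* Baire category: the sets [f <= n] cover A. *)
Lemma baire_dense_ball (f : A -> R) : exists (n : nat) (x0 : A) (r : R), 0 < r /\
  forall x, nA (x - x0) < r -> forall e : R, 0 < e -> exists y, nA (x - y) < e /\ f y <= n%:R.
Proof.
apply: contrapT => H.
(* If the claim fails, every ball contains a closed ball of at most half the radius on which
   [f > n]; nesting these for [n = 0, 1, ...] yields a point where [f] exceeds every integer. *)
have step (p : nat * (A * R)) : exists p' : A * R, 0 < p.2.2 ->
    [/\ 0 < p'.2, p'.2 <= p.2.2 / 2, nA (p'.1 - p.2.1) + p'.2 <= p.2.2 &
    forall y, nA (p'.1 - y) <= p'.2 -> p.1%:R < f y].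
  case: p => n [x0 r] /=.
  have [r0|] := ltP 0 r; last by exists (x0, r).
  apply: contrapT => H1; apply: H; exists n, x0, r; split=> // x xr e e0.
  apply: contrapT => H2; apply: H1.
  set d := nA (x - x0) in xr.
  have d0 : 0 <= d by apply: nA_ge0.
  pose r1 := Num.min (e / 2) ((r - d) / 2).
  have r1e : r1 <= e / 2 by rewrite /r1 ge_min lexx.
  have r1r : r1 <= (r - d) / 2 by rewrite /r1 ge_min lexx orbT.
  have r10 : 0 < r1 by rewrite /r1 lt_min; apply/andP; split; lra.
  exists (x, r1) => _ /=; split=> //; try (rewrite -/d; lra).
  move=> y hy; rewrite ltNge; apply/negP => fy; apply: H2; exists y; split=> //; lra.
have [g hg] := choice step.
pose s := fix s k := if k is k'.+1 then g (k', s k') else (0 : A, 1 : R).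
have sp k : 0 < (s k).2 by elim: k => [|k IH] /=; [exact: ltr01|case: (hg (k, s k) IH)].
have hs k := hg (k, s k) (sp k).
have s2 k : (s k).2 <= 2^-1 ^+ k.
  elim: k => [|k IH]; first by rewrite expr0.
  by have [_ h _ _] := hs k; rewrite exprS; apply: (le_trans h); rewrite /=; lra.
have nest k m : nA ((s (k + m)%N).1 - (s k).1) + (s (k + m)%N).2 <= (s k).2.
  elim: m => [|m IH]; first by rewrite addn0 subrr nA0 add0r.
  rewrite addnS; have [_ _ h _] := hs (k + m)%N.
  have := nA_dist (s (k + m).+1).1 (s (k + m)%N).1 (s k).1.
  move: h => /=; lra.
pose a k := (s k.+1).1 - (s k).1.
have [l hl] : exists l, forall n, nA (l - \sum_(k < n) a k) <= 1 * 2^-1 ^+ n / (1 - 2^-1).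
  apply: series_cvg; try lra.
  move=> k; rewrite mul1r; apply: le_trans (s2 k).
  have := nest k 1%N; rewrite addn1 -/(a k); have := sp k.+1; lra.
have sa n : \sum_(k < n) a k = (s n).1.
  elim: n => [|n IH]; first by rewrite big_ord0.
  by rewrite big_ord_recr /= IH /a addrC subrK.
have inball k : nA ((s k).1 - l) <= (s k).2.
  apply/ler_addgt0Pr => e e0.
  have [] := @expr_eventually_small R 2^-1 (e / 2); try lra.
  move=> N /(_ (k + N)%N (leq_addl _ _)) hN.
  have := hl (k + N)%N; rewrite sa nAB.
  have -> : 1 - 2^-1 = 2^-1 :> R by lra.
  rewrite invrK; set q := 2^-1 ^+ _ in hN * => hkN.
  have := nA_dist (s k).1 (s (k + N)%N).1 l; rewrite (nAB (s k).1 (s (k + N)%N).1).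
  by have := nest k N; have := sp (k + N)%N; lra.
pose n := Num.truncn (f l).
have [_ _ _ /(_ l (inball n.+2))] := hs n.+1.
have := truncnS_gt (f l); rewrite -/n => h1 h2.
by have := lt_trans h1 h2; rewrite ltxx.
Qed.

(** By Baire the points [y] with [nA (U y) <= n] are dense in some ball. Differences of two such
    points approximate any vector up to half its norm, and iterating the correction gives a
    convergent series for [U x]. *)
Lemma bounded_inverse (U V : A -> A) (K : R) : linop U -> linop V ->
  cancel U V -> cancel V U -> (forall x, nA (V x) <= K * nA x) ->
  exists K', forall x, nA (U x) <= K' * nA x.
Proof.
move=> hU hV UV VU bV.
have [n [x0 [r [r0 dense]]]] := baire_dense_ball (fun x => nA (U x)).
pose L := 4 * n%:R / r.
have L0 : 0 <= L by rewrite divr_ge0 ?mulr_ge0// ltW.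
have approx x : exists y, nA (x - y) <= 2^-1 * nA x /\ nA (U y) <= L * nA x.
  have [->|xn0] := eqVneq x 0.
    by exists 0; rewrite subrr nA0 linop0// nA0; split; lra.
  have x0' := nA_gt0 xn0.
  (* Scaled by [c], the vector [x] has norm [r / 2], so [x0] and [x0 + c x] both lie in the ball.
     Two errors [r / 8] make up half of [c nA x], and [2 n / c] is [L nA x]. *)
  pose c : R := r / (2 * nA x).
  have c0 : 0 < c by rewrite divr_gt0// mulr_gt0.
  have cx : c * nA x = r / 2 by rewrite /c; field; rewrite gt_eqF.
  have e0 : 0 < r / 8 by lra.
  have [y1 [h1 b1]] : exists y, nA (x0 + c%:C%C *: x - y) < r / 8 /\ nA (U y) <= n%:R.
    apply: dense => //; rewrite addrC addKr nAZ (cabs_real (ltW c0)) cx; lra.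
  have [y2 [h2 b2]] : exists y, nA (x0 - y) < r / 8 /\ nA (U y) <= n%:R.
    by apply: dense => //; rewrite subrr nA0.
  have cC : c%:C%C != 0 :> R[i] by rewrite -cabs_gt0 (cabs_real (ltW c0)).
  exists (c%:C%C^-1 *: (y1 - y2)); split.
    have -> : x - c%:C%C^-1 *: (y1 - y2) =
        c%:C%C^-1 *: ((x0 + c%:C%C *: x - y1) - (x0 - y2)).
      have {1}-> : x = c%:C%C^-1 *: (c%:C%C *: x) by rewrite scalerA mulVf// scale1r.
      by rewrite -scalerBr; congr (_ *: _); ring.
    rewrite nAZ cabsV (cabs_real (ltW c0)) ler_pdivrMl//.
    by have := nA_subD (x0 + c%:C%C *: x - y1) (x0 - y2); move: cx; lra.
  rewrite linopZ// nAZ cabsV (cabs_real (ltW c0)) ler_pdivrMl// linopB//.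
  apply: (le_trans (nA_subD _ _)).
  have -> : c * (L * nA x) = 2 * n%:R.
    by rewrite mulrCA cx /L; field; rewrite gt_eqF.
  lra.
have [h hh] := choice approx.
have half : (1 - 2^-1)^-1 = 2 :> R.
  have -> : 1 - 2^-1 = 2^-1 :> R by lra.
  by rewrite invrK.
exists (L * 2) => x.
pose xs k := iter k (fun z => z - h z) x.
have xk k : nA (xs k) <= nA x * 2^-1 ^+ k.
  elim: k => [|k IH]; first by rewrite mulr1.
  rewrite /xs iterS -/(xs k); have [h1 _] := hh (xs k).
  by apply: (le_trans h1); rewrite exprS mulrCA ler_wpM2l// invr_ge0.
have [z hz0] : exists z, forall n, nA (z - \sum_(k < n) U (h (xs k))) <=
    (L * nA x) * 2^-1 ^+ n / (1 - 2^-1).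
  apply: (@series_cvg (fun k => U (h (xs k)))); try lra.
  move=> k; have [_ h2] := hh (xs k); apply: (le_trans h2).
  by rewrite -(mulrA L) ler_wpM2l.
have hz m : nA (z - \sum_(k < m) U (h (xs k))) <= (L * nA x) * 2^-1 ^+ m * 2.
  by rewrite -[X in _ * X]half hz0.
have Vs m : V (\sum_(k < m) U (h (xs k))) = x - xs m.
  elim: m => [|m IH]; first by rewrite big_ord0 linop0// /xs subrr.
  have -> : xs m.+1 = xs m - h (xs m) by [].
  by rewrite big_ord_recr linopD// UV IH opprD opprK addrA.
(* The limit is taken on the side of [V], the map known to be bounded. *)
have Vz : V z = x.
  apply/eqP; rewrite -subr_eq0; apply/eqP/nA_eq0/eqP; rewrite eq_le nA_ge0 andbT.
  apply/ler_addgt0Pr => e e0; rewrite add0r.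
  pose D := `|K| * (L * nA x) * 2 + nA x.
  have D0 : 0 <= D.
    rewrite addr_ge0 ?nA_ge0// mulr_ge0// mulr_ge0//.
    by apply: mulr_ge0; rewrite ?nA_ge0.
  have [] := @expr_eventually_small R 2^-1 (e / (D + 1)); try lra.
    by rewrite divr_gt0//; lra.
  move=> N /(_ N (leqnn _)); rewrite ltr_pdivlMr; last lra.
  move=> hN.
  set q := 2^-1 ^+ N in hN.
  have q0 : 0 < q by rewrite exprn_gt0// invr_gt0.
  have -> : V z - x = V (z - \sum_(k < N) U (h (xs k))) - xs N.
    by rewrite linopB// Vs; ring.
  apply: (le_trans (nA_subD _ _)); apply: (le_trans (lerD (bV _) (xk N))).
  have h1 : K * nA (z - \sum_(k < N) U (h (xs k))) <=
      `|K| * ((L * nA x) * q * 2).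
    apply: (le_trans (ler_wpM2r (nA_ge0 _) (ler_norm K))).
    by rewrite ler_wpM2l.
  apply: (le_trans (lerD h1 (lexx _))).
  apply: (@le_trans _ _ (q * (D + 1))); last by rewrite ltW.
  rewrite -/q /D; nra.
have := hz 0%N; rewrite big_ord0 subr0 expr0 mulr1 => h1.
by rewrite -{1}Vz VU mulrAC.
Qed.

(** For [yp = ym] the right side is just [yp]. The two are kept apart because approximate solutions,
    whose right sides differ slightly, are averaged as well. *)
Lemma average_pm (L : A -> A) (b : R[i]) (p m : A) : linop L ->
  let z := 2^-1 *: (p + m) in let yp := p - b *: L p in let ym := m + b *: L m in
  z - (b ^+ 2) *: L (L z) = 2^-1 *: (yp + ym + b *: L (yp - ym)).
Proof.
move=> hL z yp ym; rewrite /z /yp /ym !(linopZ hL) scalerA mulrC -scalerA -scalerBr.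
congr (_ *: _); rewrite !(linopD hL, linopN hL, linopZ hL).
by rewrite !(scalerDr, scalerN) !scalerA -expr2; ring.
Qed.

Lemma iter_2exp (L : A -> A) k x : iter (2 ^ k.+1) L x = iter (2 ^ k) L (iter (2 ^ k) L x).
Proof. by rewrite expnS mul2n -addnn iterD. Qed.

Lemma half_add (x : A) : 2^-1 *: (x + x) = x.
Proof.
rewrite scalerDr -scalerDl; have -> : 2^-1 + 2^-1 = 1 :> R[i] by field.
exact: scale1r.
Qed.

Lemma half_le (p m : A) (B : R) : nA p <= B -> nA m <= B -> nA (2^-1 *: (p + m)) <= B.
Proof.
move=> pB mB; rewrite nAZ cabsV.
have -> : cabs (2 : R[i]) = 2.
  by have := @cabs_real R 2; rewrite rmorph_nat; apply.
by have := nAD p m; lra.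
Qed.

(** Solutions for exponent [2^(k+1)] are means of solutions for [2^k] at [b] and [- b]; a mean keeps
    the bound [q], so nothing is lost as [k] grows. *)
Lemma resolvents_close_2exp (L0 L1 : A -> A) (q : R) : linop L0 -> linop L1 ->
  (forall a y, cabs a = 1 -> exists x0 x1,
     [/\ x0 - a *: L0 x0 = y, x1 - a *: L1 x1 = y & nA (x0 - x1) <= q * nA y]) ->
  forall k a y, cabs a = 1 -> exists x0 x1,
     [/\ x0 - a *: iter (2 ^ k) L0 x0 = y, x1 - a *: iter (2 ^ k) L1 x1 = y &
         nA (x0 - x1) <= q * nA y].
Proof.
move=> hL0 hL1 h; elim=> [//|k IH] a y a1.
have [b [<- b1 _]] := unit_circle_sqrt a1.
have [p0 [p1 [hp0 hp1 hp]]] := IH b y b1.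
have [m0 [m1 [hm0 hm1 hm]]] := IH (- b) y (etrans (cabsN _) b1).
rewrite scaleNr opprK in hm0; rewrite scaleNr opprK in hm1.
exists (2^-1 *: (p0 + m0)), (2^-1 *: (p1 + m1)).
have fin L : linop L -> linop (iter (2 ^ k) L) by apply: linop_iter.
split.
- rewrite iter_2exp (average_pm b p0 m0 (fin _ hL0)) hp0 hm0 subrr linop0 ?scaler0 ?addr0 ?half_add//.
  exact: fin.
- rewrite iter_2exp (average_pm b p1 m1 (fin _ hL1)) hp1 hm1 subrr linop0 ?scaler0 ?addr0 ?half_add//.
  exact: fin.
- rewrite -scalerBr opprD addrACA; exact: half_le.
Qed.

(** If [x = b^2 M^2 x], then [x + b M x] is fixed by [b M] and vanishes, so [x] is fixed by
    [- b M]. *)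
Lemma eigen_free_2exp (L : A -> A) : linop L ->
  (forall a x, cabs a = 1 -> x - a *: L x = 0 -> x = 0) ->
  forall k a x, cabs a = 1 -> x - a *: iter (2 ^ k) L x = 0 -> x = 0.
Proof.
move=> hL h; elim=> [//|k IH] a x a1.
have [b [<- b1 _]] := unit_circle_sqrt a1.
rewrite iter_2exp; set M := iter (2 ^ k) L => hx.
have hM : linop M by apply: linop_iter.
have : x + b *: M x - b *: M (x + b *: M x) = 0.
  by rewrite (linopD hM) (linopZ hM) scalerDr scalerA -expr2 opprD addrA addrK.
move/(IH b _ b1) => h2; apply: (IH (- b)); first by rewrite cabsN.
by rewrite scaleNr opprK.
Qed.

(** Compactness of the circle: constants blowing up along some [a_k] contradict the constant at an
    ultralimit of the [a_k], which also serves nearby values. *)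
Lemma circle_uniform_lower_bound (T : A -> A) (K0 : R) : linop T -> 0 <= K0 ->
  (forall x, nA (T x) <= K0 * nA x) ->
  (forall a, cabs a = 1 -> exists M, forall x, nA x <= M * nA (x - a *: T x)) ->
  exists M, 1 <= M /\ forall a, cabs a = 1 -> forall x, nA x <= M * nA (x - a *: T x).
Proof.
move=> hT K00 bT h; apply: contrapT => H.
have bad (k : nat) : exists p : R[i] * A, cabs p.1 = 1 /\
    k.+1%:R * nA (p.2 - p.1 *: T p.2) < nA p.2.
  apply: contrapT => H1; apply: H; exists k.+1%:R; split; first by rewrite ler1n.
  move=> a a1 x; rewrite leNgt; apply/negP => hx; apply: H1.
  by exists (a, x).
have [p hp] := choice bad.
have [G [GU Goo]] := nat_free_ultrafilter.
have GF : Filter G := @filter_filter _ _ (@ultra_proper _ _ GU).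
have [a ha] : exists a, ucvg G (fun k => (p k).1) a.
  by apply: (ucvg_bounded GU (B := 1)) => n; have [-> _] := hp n.
have a1 : cabs a = 1.
  apply/eqP; rewrite eq_le; apply/andP; split.
    rewrite -[a]subr0; apply: (ucvg_cabs_le GU ha); apply: (ultra_all GU) => n /=.
    by rewrite subr0; have [-> _] := hp n.
  apply: (ucvg_cabs_ge GU ha); apply: (ultra_all GU) => n /=.
  by have [-> _] := hp n.
have [M hM] := h a a1.
pose M' := `|M| + 1.
have M'0 : 0 < M' by rewrite /M'; have := normr_ge0 M; lra.
have hM' x : nA x <= M' * nA (x - a *: T x).
  apply: (le_trans (hM x)); rewrite ler_wpM2r ?nA_ge0//.
  by rewrite /M'; have := ler_norm M; lra.
(* At this distance, replacing [b] by [a] costs at most [nA x / 2] after multiplication by [M'], and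
   can be absorbed. *)
have d0 : 0 < 1 / (2 * M' * (K0 + 1)) by rewrite divr_gt0// !mulr_gt0//; lra.
pose k0 := (Num.truncn (2 * M')).+1.
have [k /= [hk kk]] := ultra_ex GU (filterI (ha _ d0) (Goo k0)).
have [_ hx] := hp k; set x := (p k).2 in hx; set b := (p k).1 in hx hk.
have k2 : 2 * M' < k.+1%:R.
  apply: (lt_le_trans (truncnS_gt _)); rewrite ler_nat -/k0; exact: leqW.
have h1 : nA (x - a *: T x) <= nA (x - b *: T x) + cabs (b - a) * (K0 * nA x).
  have -> : x - a *: T x = (x - b *: T x) + (b - a) *: T x by rewrite scalerBl; ring.
  apply: (le_trans (nAD _ _)); rewrite lerD2l nAZ ler_wpM2l ?cabs_ge0//.
have x0 := nA_ge0 x; have y0 := nA_ge0 (x - b *: T x).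
have h2 := hM' x.
move: hk; rewrite ltr_pdivlMr; last by rewrite !mulr_gt0//; lra.
set c := cabs (b - a) in h1 * => hc.
have c0 : 0 <= c by apply: cabs_ge0.
have h3 : M' * (c * (K0 * nA x)) <= nA x / 2.
  have : c * (2 * M' * K0) <= 1 by nra.
  nra.
have h4 : 2 * M' * nA (x - b *: T x) <= k.+1%:R * nA (x - b *: T x).
  by rewrite ler_wpM2r// ltW.
nra.
Qed.

End BanachAlgebra.

(** * Subexponential growth from resolvents outside the closed unit disc *)

Section SpectralRadius.
Variables (R : realType) (A : comUnitAlgType R[i]) (nA : A -> R).
Hypothesis hnA : is_banach_alg_norm nA.

Lemma iter_scale (T : A -> A) (c : R[i]) n x : linop T ->
  iter n (fun x => c *: T x) x = c ^+ n *: iter n T x.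
Proof.
move=> hT; elim: n => [|n IH]; first by rewrite expr0 scale1r.
by rewrite !iterS IH (linopZ hT) scalerA exprS.
Qed.

Lemma iter_bound (T : A -> A) (K : R) n x : 0 <= K ->
  (forall x, nA (T x) <= K * nA x) -> nA (iter n T x) <= K ^+ n * nA x.
Proof.
move=> K0 bT; elim: n => [|n IH]; first by rewrite mul1r.
by rewrite iterS exprS -mulrA; apply: (le_trans (bT _)); rewrite ler_wpM2l.
Qed.

(* The radii [1/c] for which [c^n T^n] stays bounded form an up-set; at its infimum the
   resolvents of [(c T)^(2^k)], being averages of resolvents of [c T], depend on [c]
   uniformly in [k], so boundedness propagates past the infimum. *)
Lemma spectral_growth (T : A -> A) (K0 : R) : linop T ->
  (forall x, nA (T x) <= K0 * nA x) ->
  (forall l, 1 < cabs l -> (exists M, forall x, nA x <= M * nA (T x - l *: x)) /\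
     forall y, exists x, T x - l *: x = y) ->
  forall s, 1 < s -> exists K, 0 <= K /\ forall n x, nA (iter n T x) <= K * s ^+ n * nA x.
Proof.
move=> hT bT0 hres s s1.
pose K := `|K0| + 1.
have K1 : 1 <= K by rewrite lerDr.
have K_ge0 : 0 <= K by apply: le_trans K1.
have bT x : nA (T x) <= K * nA x.
  apply: (le_trans (bT0 x)); rewrite ler_wpM2r ?(nA_ge0 hnA)//.
  by rewrite /K; have := ler_norm K0; lra.
have hQ z : cabs z < 1 -> (exists M, forall x, nA x <= M * nA (x - z *: T x)) /\
    forall y, exists x, x - z *: T x = y.
  move=> z1; have [->|z0] := eqVneq z 0.
    split=> [|y]; first by exists 1 => x; rewrite scale0r subr0 mul1r.
    by exists y; rewrite scale0r subr0.
  have lz : 1 < cabs z^-1 by rewrite cabsV invf_gt1// cabs_gt0.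
  have eqn x : x - z *: T x = (- z) *: (T x - z^-1 *: x).
    by rewrite scalerBr scalerA mulNr divff// !scaleNr scale1r opprK addrC.
  have [[M hM] sur] := hres _ lz; split=> [|y].
    exists (M / cabs z) => x; rewrite eqn (nAZ hnA) cabsN mulrA divfK ?hM//.
    by rewrite cabs_eq0.
  have [x hx] := sur ((- z)^-1 *: y); exists x; rewrite eqn hx scalerA divff ?scale1r//.
  by rewrite oppr_eq0.
pose L (c : R) x := c%:C%C *: T x.
have hL c : linop (L c) by apply: linop_scale.
have unif c : 0 <= c -> c < 1 -> exists M, 1 <= M /\
    forall a, cabs a = 1 -> forall x, nA x <= M * nA (x - a *: L c x).
  move=> c0 c1; apply: (circle_uniform_lower_bound hnA (hL c) K_ge0).
    move=> x; rewrite /L (nAZ hnA) cabs_real//; apply: le_trans (bT x).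
    by rewrite ler_piMl ?(nA_ge0 hnA)// ltW.
  move=> a a1; have [|[M hM] _] := hQ (a * c%:C%C).
    by rewrite cabsM a1 mul1r cabs_real.
  by exists M => x; rewrite /L scalerA.
have nAx x := nA_ge0 hnA x.
pose S := [set c : R | [/\ 0 <= c, c < 1 &
  exists B, forall n x, c ^+ n * nA (iter n T x) <= B * nA x]].
have s0 : 0 < s by lra.
have sV1 : s^-1 < 1 by rewrite invf_lt1.
have sV0 : 0 < s^-1 by rewrite invr_gt0.
suff [_ _ [B hB]] : S s^-1.
  exists `|B|; split=> // n x.
  have sn : 0 < s ^+ n by rewrite exprn_gt0.
  have := hB n x; rewrite exprVn ler_pdivrMl// => h; apply: (le_trans h).
  rewrite mulrC -[leRHS]mulrA (mulrC (s ^+ n)) mulrA ler_wpM2r ?(ltW sn)//.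
  by rewrite ler_wpM2r// ler_norm.
apply: contrapT => nS.
have S0 : S 0.
  split=> //; exists 1 => -[|n] x; first by rewrite !mul1r.
  by rewrite expr0n mul0r mul1r.
have Sub : ubound S s^-1.
  move=> c [c0 c1 [B hB]]; rewrite leNgt; apply/negP => sc; apply: nS.
  split=> //; [exact: ltW|exists B => n x]; apply: le_trans (hB n x).
  rewrite ler_wpM2r//; apply: lerXn2r; rewrite ?nnegrE; lra.
have hS : has_sup S by split; [exists 0|exists s^-1].
set cs := sup S.
have cs0 : 0 <= cs by apply: ub_le_sup => //; exists s^-1.
have cs1 : cs < 1 by apply: le_lt_trans sV1; apply: sup_le_ub => //; exists 0.
have [M [M1 hM]] := unif cs cs0 cs1.
have MK : 1 <= 32 * M ^+ 2 * K by nra.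
(* The first bound keeps [cs + d] below 1. The second makes the solutions for [c0] and [c1] differ
   by at most [2M . 2d . K . 2M <= 1/4] times the datum, [2M] bounding each resolvent within
   distance [d] of [cs]. *)
pose d := Num.min ((1 - cs) / 2) (1 / (32 * M ^+ 2 * K)).
have d1 : d <= (1 - cs) / 2 by rewrite /d ge_min lexx.
have d2 : 32 * M ^+ 2 * K * d <= 1.
  by rewrite mulrC -ler_pdivlMr ?/d ?ge_min ?lexx ?orbT//; lra.
have d0 : 0 < d by rewrite /d lt_min; apply/andP; split; [lra|rewrite divr_gt0//; lra].
have d20 : 0 < d / 2 by lra.
have [c' [c'0 c'1 [B hB]] hc'] := sup_adherent d20 hS.
have c'cs : c' <= cs by apply: ub_le_sup; [exists s^-1|split=> //; exists B].
(* [c0] is a member [c'] of [S] shrunk by a fixed factor, so the powers of [c0 T] tend to 0; [c1]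
   lies beyond the supremum. *)
pose c0 := c' * (1 - d / 2); pose c1 := cs + d.
have c0p : 0 <= c0 by rewrite mulr_ge0//; lra.
have c0d : cs - d <= c0 <= cs by apply/andP; rewrite /c0; move: hc'; rewrite -/cs; split; nra.
have bb c : 0 <= c -> cs - d <= c <= cs + d ->
    forall a x, cabs a = 1 -> nA x <= 2 * M * nA (x - a *: L c x).
  move=> cp /andP[cd1 cd2] a x a1; have h1 := hM a a1 x.
  have h2 : nA (x - a *: L cs x) <= nA (x - a *: L c x) + d * (K * nA x).
    have -> : x - a *: L cs x = (x - a *: L c x) + (a * (c - cs)%:C%C) *: T x.
      rewrite /L !scalerA rmorphB /= mulrBr scalerBl; ring.
    apply: (le_trans (nAD hnA _ _)); rewrite lerD2l (nAZ hnA) cabsM a1 mul1r.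
    have cc : cabs (c - cs)%:C%C <= d.
      have [h|h] := leP 0 (c - cs); first by rewrite cabs_real//; lra.
      by rewrite -cabsN -rmorphN /= cabs_real; lra.
    by apply: ler_pM => //; exact: cabs_ge0.
  have h3 : M * (d * (K * nA x)) <= nA x / 2.
    have : M * d * K <= 1 / 2.
      apply: le_trans (_ : M ^+ 2 * d * K <= _); last by lra.
      by rewrite !ler_wpM2r//; move: d0 M1; clear; [lra|nra].
    by have := nAx x; nra.
  have h4 : M * nA (x - a *: L cs x) <=
      M * (nA (x - a *: L c x) + d * (K * nA x)).
    by rewrite ler_wpM2l//; lra.
  lra.
have c1p : 0 <= c1 by rewrite /c1; lra.
have c1lt1 : c1 < 1 by rewrite /c1; lra.
have c0lt1 : c0 < 1 by case/andP: c0d => _ ?; lra.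
have c0b : cs - d <= c0 <= cs + d by case/andP: c0d => -> ? /=; lra.
have c1b : cs - d <= c1 <= cs + d by rewrite /c1; apply/andP; split; lra.
have sol c a y : 0 <= c -> c < 1 -> cabs a = 1 -> exists x, x - a *: L c x = y.
  move=> cp clt a1; have [|_ /(_ y) [x hx]] := hQ (a * c%:C%C).
    by rewrite cabsM a1 mul1r cabs_real.
  by exists x; rewrite /L scalerA.
have close a y : cabs a = 1 -> exists x0 x1,
    [/\ x0 - a *: L c0 x0 = y, x1 - a *: L c1 x1 = y & nA (x0 - x1) <= 4^-1 * nA y].
  move=> a1.
  have [x0 e0] := sol c0 a y c0p c0lt1 a1; have [x1 e1] := sol c1 a y c1p c1lt1 a1.
  exists x0, x1; split=> //.
  have h1 := bb c0 c0p c0b a (x0 - x1) a1; have h2 := bb c1 c1p c1b a x1 a1.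
  have e2 : (x0 - x1) - a *: L c0 (x0 - x1) = (a * (c0 - c1)%:C%C) *: T x1.
    rewrite (linopB (hL c0)) scalerBr.
    have -> : x0 - x1 - (a *: L c0 x0 - a *: L c0 x1) =
        (x0 - a *: L c0 x0) - (x1 - a *: L c1 x1) + (a *: L c0 x1 - a *: L c1 x1) by ring.
    by rewrite e0 e1 subrr add0r /L !scalerA rmorphB /= mulrBr scalerBl.
  rewrite e1 in h2; rewrite e2 (nAZ hnA) cabsM a1 mul1r in h1.
  have cc : cabs (c0 - c1)%:C%C <= 2 * d.
    rewrite -cabsN -rmorphN /= cabs_real; case/andP: c0d; rewrite /c1;
    by move: d0; clear; lra.
  have h3 : cabs (c0 - c1)%:C%C * nA (T x1) <= 2 * d * (K * (2 * M * nA y)).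
    apply: ler_pM => //; first exact: cabs_ge0.
    by apply: (le_trans (bT _)); rewrite ler_wpM2l.
  have h4 : 2 * M * (cabs (c0 - c1)%:C%C * nA (T x1)) <=
      2 * M * (2 * d * (K * (2 * M * nA y))) by rewrite ler_wpM2l//; lra.
  have := nAx y; nra.
have [N hN] : exists N, forall n, (N <= n)%N -> (1 - d / 2) ^+ n < 1 / (4 * (`|B| + 1)).
  apply: expr_eventually_small; last by rewrite divr_gt0// mulr_gt0// ltr_wpDl.
    by move: d1 cs0; clear; lra.
  by move: d0; clear; lra.
pose n := (2 ^ N)%N.
have hn : (1 - d / 2) ^+ n < 1 / (4 * (`|B| + 1)) by apply: hN; rewrite ltnW// ltn_expl.
have B0 := normr_ge0 B.
have qn0 : 0 <= (1 - d / 2) ^+ n by rewrite exprn_ge0//; lra.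
rewrite ltr_pdivlMr in hn; last lra.
have small0 x : nA (iter n (L c0) x) <= 4^-1 * nA x.
  rewrite iter_scale// (nAZ hnA) cabsX cabs_real// /c0 exprMn mulrAC.
  have h1 : c' ^+ n * nA (iter n T x) <= `|B| * nA x.
    by apply: (le_trans (hB n x)); rewrite ler_wpM2r// ler_norm.
  have := nAx x; nra.
(* For [y = x - (c1 T)^n x] the solution at [c1] is [x], and the solution [x0] at [c0] has
   [x0 - y = (c0 T)^n x0] small. As [x0] is close to [x], this bounds [x - y = (c1 T)^n x]. *)
have bound1 x : nA (iter n (L c1) x) <= 2 * nA x.
  pose y := x - iter n (L c1) x.
  have [x0 [x1 [e0 e1 h]]] := resolvents_close_2exp hnA (hL c0) (hL c1) close N y (cabs1 R).
  rewrite !scale1r -/n in e0 e1.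
  have x1x : x1 = x.
    apply/eqP; rewrite -subr_eq0; apply/eqP.
    apply: (eigen_free_2exp (hL c1) _ (k := N) (cabs1 R)).
      move=> a z a1 hz; apply: (nA_eq0 hnA); apply/eqP; rewrite eq_le nAx andbT.
      by have := bb c1 c1p c1b a z a1; rewrite hz (nA0 hnA) mulr0.
    rewrite scale1r (linopB (linop_iter _ (hL c1))) -/n.
    have -> : x1 - x - (iter n (L c1) x1 - iter n (L c1) x) = x1 - iter n (L c1) x1 - y.
      by rewrite /y; ring.
    by rewrite e1 subrr.
  rewrite x1x in h.
  have h1 := small0 x0.
  have e3 : x0 - y = iter n (L c0) x0 by rewrite -e0 subKr.
  have e4 : x - y = iter n (L c1) x by rewrite subKr.
  rewrite -e3 in h1; rewrite -e4.
  have h2 := nA_dist hnA x x0 y; rewrite (nAB hnA x x0) in h2.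
  have h3 : nA x0 <= nA (x0 - y) + nA y by rewrite -{1}(subrK y x0) (nAD hnA).
  have h4 : nA y <= nA x + nA (x - y) by rewrite -{1}(subKr x y) (nA_subD hnA).
  by move: (nAx x) h h1 h2 h3 h4; clear; lra.
(* The shrinking factor to the power [n] absorbs the 2 of [bound1]. So [(c2 T)^n] does not increase
   norms, which puts [c2] in [S], although [c2 >= cs + d / 2]. *)
pose c2 := c1 * (1 - d / 2).
have c2p : 0 <= c2 by rewrite mulr_ge0//; lra.
have c2lt : c2 <= 1 by rewrite /c2; nra.
have bound2 x : c2 ^+ n * nA (iter n T x) <= nA x.
  have := bound1 x; rewrite iter_scale// (nAZ hnA) cabsX cabs_real// => h1.
  rewrite /c2 exprMn mulrAC; apply: (le_trans (ler_wpM2r qn0 h1)).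
  by move: (nAx x) hn qn0 B0; clear; nra.
have : c2 <= cs.
  apply: ub_le_sup; first by exists s^-1.
  split=> //; first by rewrite /c2; nra.
  exists (K ^+ n) => m x; rewrite (divn_eq m n).
  have Kr r : (r < n)%N -> c2 ^+ r * nA (iter r T x) <= K ^+ n * nA x.
    move=> rn; apply: le_trans (_ : nA (iter r T x) <= _).
      by rewrite ler_piMl// exprn_ile1.
    apply: (le_trans (iter_bound _ _ K_ge0 bT)).
    by rewrite ler_wpM2r// ler_weXn2l// ltnW.
  elim: (m %/ n)%N => [|q IH]; first by rewrite mul0n add0n Kr// ltn_mod expn_gt0.
  rewrite mulSn -addnA; apply: le_trans IH.
  rewrite exprD iterD (mulrC (c2 ^+ n)) -mulrA ler_wpM2l ?exprn_ge0//.
have : cs + d / 2 <= c2 by rewrite /c2 /c1; nra.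
lra.
Qed.

End SpectralRadius.

(** * Characters, the Gelfand topology and supports *)

Section Characters.
Variables (R : realType) (A : comUnitAlgType R[i]).
Implicit Types (m t : @chi R A) (f g : A).

Lemma char_lin m : MA m -> forall (a : R[i]) x y, m (a *: x + y) = a * m x + m y.
Proof. by case. Qed.

Lemma charM m : MA m -> forall x y, m (x * y) = m x * m y.
Proof. by case. Qed.

Lemma char1 m : MA m -> m 1 = 1.
Proof. by case. Qed.

Lemma charD m : MA m -> forall x y, m (x + y) = m x + m y.
Proof. by move=> h x y; have := char_lin h 1 x y; rewrite scale1r mul1r. Qed.

Lemma char0 m : MA m -> m 0 = 0.
Proof.
by move=> h; have /eqP := charD h 0 0; rewrite addr0 -subr_eq subrr => /eqP.
Qed.

Lemma charZ m : MA m -> forall (a : R[i]) x, m (a *: x) = a * m x.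
Proof. by move=> h a x; have := char_lin h a x 0; rewrite (char0 h) !addr0. Qed.

Lemma charN m : MA m -> forall x, m (- x) = - m x.
Proof. by move=> h x; rewrite -scaleN1r (charZ h) mulN1r. Qed.

Lemma charB m : MA m -> forall x y, m (x - y) = m x - m y.
Proof. by move=> h x y; rewrite (charD h) (charN h). Qed.

Lemma char_sum m : MA m -> forall n (F : 'I_n -> A),
  m (\sum_(k < n) F k) = \sum_(k < n) m (F k).
Proof. by move=> h n F; apply: (big_morph m (charD h) (char0 h)). Qed.

Lemma char_prod m : MA m -> forall n (P : pred 'I_n) (F : 'I_n -> A),
  m (\prod_(k < n | P k) F k) = \prod_(k < n | P k) m (F k).
Proof. by move=> h n P F; apply: (big_morph m (charM h) (char1 h)). Qed.

Lemma char_unit m : MA m -> forall x, x \is a GRing.unit -> m x * m x^-1 = 1.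
Proof. by move=> h x ux; rewrite -(charM h) divrr// (char1 h). Qed.

Lemma char_comp m (U : A -> A) : MA m -> linop U -> {morph U : x y / x * y} ->
  U 1 = 1 -> MA (m \o U).
Proof.
move=> h lU mU U1; split=> [a x y|x y|] /=.
- by rewrite lU (char_lin h).
- by rewrite mU (charM h).
- by rewrite U1 (char1 h).
Qed.

(** Weak-star compactness of the maximal ideal space in sequential form: the laws of a character
    pass to pointwise ultralimits. *)
Lemma char_ulim (B : A -> R) (t : nat -> @chi R A) (G : set_system nat) : UltraFilter G ->
  (forall n, MA (t n)) -> (forall n f, cabs (t n f) <= B f) ->
  exists m, MA m /\ forall f, ucvg G (fun n => t n f) (m f).
Proof.
move=> GU ht tB.
have [m hm] := choice (fun f => ucvg_bounded GU (fun n => tB n f)).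
exists m; split=> //; split=> [a x y|x y|].
- apply: (ucvg_unique GU (hm _)).
  rewrite [X in ucvg _ X _](_ : _ = fun n => a * t n x + t n y).
    exact: ucvg_lin.
  by apply: funext => n; rewrite (char_lin (ht n)).
- apply: (ucvg_unique GU (hm _)).
  rewrite [X in ucvg _ X _](_ : _ = fun n => t n x * t n y).
    exact: ucvg_mul.
  by apply: funext => n; rewrite (charM (ht n)).
- apply: (ucvg_unique GU (hm _)).
  rewrite [X in ucvg _ X _](_ : _ = fun n => 1).
    exact: ucvg_cst.
  by apply: funext => n; rewrite (char1 (ht n)).
Qed.

Lemma seq_pos_lower_bound (fs : seq A) (g : A -> R) : (forall f, f \in fs -> 0 < g f) ->
  exists d, 0 < d /\ forall f, f \in fs -> d <= g f.
Proof.
elim: fs => [|f fs IH] h; first by exists 1.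
have [|d [d0 hd]] := IH; first by move=> x xs; apply: h; rewrite inE xs orbT.
exists (Num.min d (g f)); split.
  by rewrite lt_min d0 h// mem_head.
move=> x; rewrite inE => /orP[/eqP->|xs]; first by rewrite ge_min lexx orbT.
by rewrite ge_min hd.
Qed.

Lemma wopen_nbhd m (fs : seq A) (e : R) : 0 < e ->
  wopen (@MA R A) [set p | MA p /\ forall f, f \in fs -> cabs (p f - m f) < e].
Proof.
move=> e0; split=> [p []//|c [hc ce]].
have [|d [d0 hd]] := @seq_pos_lower_bound fs (fun f => e - cabs (c f - m f)).
  by move=> f fs'; rewrite subr_gt0 ce.
exists fs, d; split=> // p hp pc; split=> // f fs'.
have := hd f fs'; have := pc f fs'; have := cabsD (p f - c f) (c f - m f).
rewrite addrA subrK; lra.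
Qed.

Lemma wopen_gt (fs : seq A) (b : R) :
  wopen (@MA R A) [set p | MA p /\ forall f, f \in fs -> b < cabs (p f)].
Proof.
split=> [p []//|c [hc ce]].
have [|d [d0 hd]] := @seq_pos_lower_bound fs (fun f => cabs (c f) - b).
  by move=> f fs'; rewrite subr_gt0 ce.
exists fs, d; split=> // p hp pc; split=> // f fs'.
have := hd f fs'; have := pc f fs'; have := cabsD (c f - p f) (p f).
rewrite subrK cabsB; lra.
Qed.

Lemma wopen_lt f (b : R) : wopen (@MA R A) [set p | MA p /\ cabs (p f) < b].
Proof.
split=> [p []//|c [hc ce]].
exists [:: f], (b - cabs (c f)); split; first by rewrite subr_gt0.
move=> p hp /(_ f (mem_head _ _)) pc; split=> //.
have := cabsD (p f - c f) (c f); rewrite subrK; lra.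
Qed.

Lemma wclosure_lt f (b : R) t :
  wclosure (@MA R A) [set p | MA p /\ cabs (p f) < b] t -> MA t /\ cabs (t f) <= b.
Proof.
move=> [ht h]; split=> //; apply/ler_addgt0Pr => e e0.
have [p [[hp pb] [_ /(_ f (mem_head _ _)) pt]]] := h [:: f] e e0.
have := cabsD (p f) (t f - p f); rewrite addrC subrK cabsB; lra.
Qed.

Lemma wclosedP (E : set (@chi R A)) : E `<=` (@MA R A) ->
  (forall c, MA c -> ~ E c -> exists (fs : seq A) (e : R), 0 < e /\
     forall p, MA p -> (forall f, f \in fs -> cabs (p f - c f) < e) -> ~ E p) ->
  wclosed (@MA R A) E.
Proof.
move=> EM h; split=> //; split=> [p []//|c [hc nc]].
have [fs [e [e0 H]]] := h c hc nc; exists fs, e; split=> // p hp pc; split=> //.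
exact: H.
Qed.

Lemma wclosed_nbhd (E : set (@chi R A)) c : wclosed (@MA R A) E -> MA c -> ~ E c ->
  exists (fs : seq A) (e : R), 0 < e /\
     forall p, MA p -> (forall f, f \in fs -> cabs (p f - c f) < e) -> ~ E p.
Proof.
move=> [EM [_ h]] hc nc; have [fs [e [e0 H]]] := h c (conj hc nc).
by exists fs, e; split=> // p hp pc; have [] := H p hp pc.
Qed.

Lemma wclosed_ball m (fs : seq A) (e : R) :
  wclosed (@MA R A) [set p | MA p /\ forall f, f \in fs -> cabs (p f - m f) <= e].
Proof.
apply: wclosedP => [p []//|c hc nc].
have [f [fs' fe]] : exists f, f \in fs /\ e < cabs (c f - m f).
  apply: contrapT => H; apply: nc; split=> // f fs'; rewrite leNgt.
  by apply/negP => h; apply: H; exists f.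
exists [:: f], (cabs (c f - m f) - e); split; first by rewrite subr_gt0.
move=> p hp /(_ f (mem_head _ _)) pc [_ /(_ f fs') h].
have := cabsD (c f - p f) (p f - m f); rewrite addrA subrK cabsB; lra.
Qed.

Lemma wclosedU (E F : set (@chi R A)) : wclosed (@MA R A) E -> wclosed (@MA R A) F ->
  wclosed (@MA R A) (E `|` F).
Proof.
move=> cE cF; apply: wclosedP => [p [/(proj1 cE)|/(proj1 cF)]//|c hc nc].
have [|fs [e [e0 H]]] := wclosed_nbhd cE hc; first by move=> h; apply: nc; left.
have [|gs [d [d0 K]]] := wclosed_nbhd cF hc; first by move=> h; apply: nc; right.
exists (fs ++ gs), (Num.min e d); split; first by rewrite lt_min e0.
move=> p hp pc [].
  by apply: H => // f fs'; have := pc f; rewrite mem_cat fs' lt_min => /(_ isT)/andP[].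
by apply: K => // f fs'; have := pc f; rewrite mem_cat fs' orbT lt_min => /(_ isT)/andP[].
Qed.

Lemma wclosed_exists (n : nat) (E : nat -> set (@chi R A)) :
  (forall k, wclosed (@MA R A) (E k)) ->
  wclosed (@MA R A) [set t | exists k, (k < n)%N /\ E k t].
Proof.
move=> cE; elim: n => [|n IH].
  by apply: wclosedP => [p [k []]//|c hc _]; exists [::], 1; split=> // p _ _ [k []].
rewrite [X in wclosed _ X](_ : _ = [set t | exists k, (k < n)%N /\ E k t] `|` E n).
  exact: wclosedU.
apply/seteqP; split=> t.
  move=> [k []]; rewrite ltnS leq_eqVlt => /orP[/eqP->|kn]; first by right.
  by move=> Ek; left; exists k.
by move=> [[k [kn Ek]]|En]; [exists k; split=> //; apply: ltnW|exists n].
Qed.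

Lemma wclosed_preimage (E : set (@chi R A)) (V : A -> A) : wclosed (@MA R A) E ->
  (forall m, MA m -> MA (m \o V)) ->
  wclosed (@MA R A) [set t | MA t /\ E (t \o V)].
Proof.
move=> cE hV; apply: wclosedP => [p []//|c hc nc].
have [|fs [e [e0 H]]] := wclosed_nbhd cE (hV _ hc); first by move=> h; apply: nc.
exists (map V fs), e; split=> // p hp pc [_].
by apply: H; [exact: hV|move=> f fs'; apply: pc; apply: map_f].
Qed.

(** If a closed boundary missed [m], a function equal to 1 at [m] and to 0 on that boundary would
    contradict the maximum principle there. *)
Lemma shilov_regular : @regular R A -> @shilov R A = @MA R A.
Proof.
move=> hreg; apply/seteqP; split=> [m []//|m hm]; split=> // B [BM hB] cB.
apply: contrapT => nB; have [f [f1 f0]] := hreg B cB m hm nB.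
have [b [Bb /(_ m hm)]] := hB f.
by rewrite f1 f0// cabs1 cabs0 ler10.
Qed.

Lemma supp_sub (E : set (@chi R A)) f : @regular R A -> wclosed (@MA R A) E ->
  (forall t, MA t -> t f <> 0 -> E t) -> supp f `<=` E.
Proof.
move=> hreg cE h t; rewrite /supp (shilov_regular hreg) => -[ht hc].
apply: contrapT => nE; have [fs [e [e0 H]]] := wclosed_nbhd cE ht nE.
have [p [[hp pf] [_ pt]]] := hc fs e e0.
by apply: (H p hp pt); apply: h.
Qed.

Lemma sub_supp f t : @regular R A -> MA t -> t f <> 0 -> supp f t.
Proof.
move=> hreg ht tf; rewrite /supp (shilov_regular hreg); split=> // fs e e0.
by exists t; split=> //; split=> // g _; rewrite subrr cabs0.
Qed.

(* Baire category theorem in MA; ultralimits replace compactness. *)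
Lemma open_not_meager (B : A -> R) (N : nat -> set (@chi R A)) (S : set (@chi R A)) :
  (forall t f, MA t -> cabs (t f) <= B f) ->
  (forall n, nowhere_dense (@MA R A) (N n)) -> wopen (@MA R A) S -> S !=set0 ->
  exists t, S t /\ forall n, ~ N n t.
Proof.
move=> hB hN oS [t0 St0].
pose nb (s : @chi R A * (seq A * R)) : set (@chi R A) :=
  [set p | MA p /\ forall f, f \in s.2.1 -> cabs (p f - s.1 f) < s.2.2].
have step (q : nat * (@chi R A * (seq A * R))) : exists s : @chi R A * (seq A * R),
    MA q.2.1 -> 0 < q.2.2.2 -> [/\ MA s.1, 0 < s.2.2, nb q.2 s.1 &
    forall p, MA p -> (forall f, f \in s.2.1 -> cabs (p f - s.1 f) <= s.2.2) ->
      nb q.2 p /\ ~ N q.1 p].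
  case: q => n [c [fs e]] /=.
  have [hc|?] := pselect (MA c); last by exists (c, (fs, e)).
  have [e0|?] := ltP 0 e; last by exists (c, (fs, e)).
  pose W := nb (c, (fs, e)).
  have oW : wopen (@MA R A) W by apply: wopen_nbhd.
  have [c' [Wc' nc']] : exists c', W c' /\ ~ wclosure (@MA R A) (N n) c'.
    apply: contrapT => H.
    have W0 : W = set0.
      apply: (hN n) => // p Wp; apply: contrapT => np; apply: H; by exists p.
    have : W c by split=> // f _; rewrite subrr cabs0.
    by rewrite W0.
  have hc' : MA c' by case: Wc'.
  have [gs [d [d0 Hd]]] : exists (gs : seq A) (d : R), 0 < d /\
      forall p, MA p -> (forall f, f \in gs -> cabs (p f - c' f) < d) -> ~ N n p.
    apply: contrapT => H; apply: nc'; split=> // gs d d0; apply: contrapT => K.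
    apply: H; exists gs, d; split=> // p hp pc np; apply: K; by exists p.
  have [hs [b [b0 Hb]]] := (proj2 oW) c' Wc'.
  (* The radius is halved so that the closed condition [<=], which survives ultralimits, still
     implies the open one. *)
  exists (c', (gs ++ hs, Num.min d b / 2)) => _ _ /=.
  have m0 : 0 < Num.min d b by rewrite lt_min d0.
  split=> //; first by rewrite divr_gt0.
  move=> p hp pc.
  have pc' f : f \in gs ++ hs -> cabs (p f - c' f) < Num.min d b.
    by move=> fm; apply: (le_lt_trans (pc f fm)); lra.
  split.
    apply: Hb => // f fh.
    by have := pc' f; rewrite mem_cat fh orbT lt_min => /(_ isT)/andP[].
  by apply: Hd => // f fh; have := pc' f; rewrite mem_cat fh lt_min => /(_ isT)/andP[].
have [g hg] := choice step.
have [fs0 [e0 [e0p H0]]] := (proj2 oS) t0 St0.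
pose s := fix s k := if k is k'.+1 then g (k', s k') else (t0, (fs0, e0)).
have sp k : MA (s k).1 /\ 0 < (s k).2.2.
  elim: k => [|k [h1 h2]] /=; first by split=> //; apply: (proj1 oS).
  by have [] := hg (k, s k) h1 h2.
have hs k := hg (k, s k) (proj1 (sp k)) (proj2 (sp k)).
have nest k (m : nat) : nb (s k) (s (k + m)%N).1.
  have base j : nb (s j) (s j).1.
    by have [h1 h2] := sp j; split=> // f _; rewrite subrr cabs0.
  elim: m k => [|m IH] k; first by rewrite addn0.
  have [_ _ _ H] := hs k; have [hp hh] := IH k.+1; rewrite addnS -addSn.
  by have [] := H (s (k.+1 + m)%N).1 hp (fun f fm => ltW (hh f fm)).
have [G [GU Goo]] := nat_free_ultrafilter.
have GF : Filter G := @filter_filter _ _ (@ultra_proper _ _ GU).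
have [m [hm mlim]] := char_ulim GU (fun n => proj1 (sp n)) (fun n f => hB _ f (proj1 (sp n))).
have inb k : nb (s k) m /\ ~ N k m.
  have [_ _ _ H] := hs k; apply: (H m hm) => f fm.
  apply: (ucvg_cabs_le GU (mlim f)).
  apply: filterS (Goo k.+1) => n /= kn.
  have [_ hh] := nest k.+1 (n - k.+1)%N; rewrite subnKC// in hh.
  by apply: ltW; apply: hh.
exists m; split=> [|n]; last by case: (inb n).
by apply: H0 => // f fm; have [[_ h] _] := inb 0%N; apply: h.
Qed.

End Characters.

(** * The sup norm of Gelfand transforms *)

Section SupNorm.
Variables (R : realType) (A : comUnitAlgType R[i]) (nA : A -> R).
Hypothesis hnA : is_banach_alg_norm nA.
Hypothesis hss : @semisimple R A.

(** Otherwise scaling gives [m g = 1] with [nA g < 1]; the Neumann series solves [x - g x = 1], and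
    applying [m] yields [0 = 1]. *)
Lemma char_le (m : @chi R A) (f : A) : MA m -> cabs (m f) <= nA f.
Proof.
move=> hm; rewrite leNgt; apply/negP => fm.
have m0 : m f != 0 by rewrite -cabs_gt0; apply: le_lt_trans fm; apply: nA_ge0.
pose g := (m f)^-1 *: f.
have g1 : nA g < 1.
  by rewrite (nAZ hnA) cabsV mulrC ltr_pdivrMr ?cabs_gt0// mul1r.
have lg : linop (fun x => g * x) by move=> a x y; rewrite mulrDr -scalerAr.
have [x [hx _]] := neumann hnA lg (nA_ge0 hnA g) g1 (nAM hnA g) 1.
have mg : m g = 1 by rewrite (charZ hm) mulVf.
have : m (x - g * x) = 0 by rewrite (charB hm) (charM hm) mg mul1r subrr.
by rewrite hx (char1 hm) => /eqP; rewrite oner_eq0.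
Qed.

Lemma MA_nonempty : exists m, @MA R A m.
Proof.
apply: contrapT => H; have : (1 : A) = 0.
  by apply: hss => m hm; case: H; exists m.
by move/eqP; rewrite oner_eq0.
Qed.

Definition snorm (f : A) : R := sup [set cabs (t f) | t in @MA R A].

Lemma snorm_has_sup f : has_sup [set cabs (t f) | t in @MA R A].
Proof.
split; first by have [m hm] := MA_nonempty; exists (cabs (m f)), m.
by exists (nA f) => _ [t ht <-]; apply: char_le.
Qed.

Lemma char_le_snorm t f : MA t -> cabs (t f) <= snorm f.
Proof. by move=> ht; apply: (ub_le_sup (proj2 (snorm_has_sup f))); exists t. Qed.

Lemma snorm_le f B : (forall t, MA t -> cabs (t f) <= B) -> snorm f <= B.
Proof.
move=> h; apply: sup_le_ub; first exact: (proj1 (snorm_has_sup f)).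
by move=> _ [t ht <-]; apply: h.
Qed.

Lemma snorm_ge0 f : 0 <= snorm f.
Proof.
by have [m hm] := MA_nonempty; apply: le_trans (char_le_snorm f hm); apply: cabs_ge0.
Qed.

Lemma snorm_le_nA f : snorm f <= nA f.
Proof. by apply: snorm_le => t ht; apply: char_le. Qed.

Lemma snormD f g : snorm (f + g) <= snorm f + snorm g.
Proof.
apply: snorm_le => t ht; rewrite (charD ht); apply: (le_trans (cabsD _ _)).
by rewrite lerD ?char_le_snorm.
Qed.

Lemma snormM f g : snorm (f * g) <= snorm f * snorm g.
Proof.
apply: snorm_le => t ht; rewrite (charM ht) cabsM.
by apply: ler_pM; rewrite ?cabs_ge0 ?char_le_snorm.
Qed.

Lemma snormZ (a : R[i]) f : snorm (a *: f) = cabs a * snorm f.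
Proof.
have le (b : R[i]) g : snorm (b *: g) <= cabs b * snorm g.
  apply: snorm_le => t ht; rewrite (charZ ht) cabsM ler_wpM2l ?cabs_ge0//.
  exact: char_le_snorm.
apply/eqP; rewrite eq_le le /=.
have [->|a0] := eqVneq a 0; first by rewrite cabs0 mul0r snorm_ge0.
have := le a^-1 (a *: f); rewrite scalerA mulVf// scale1r cabsV.
by rewrite -ler_pdivrMl ?invr_gt0 ?cabs_gt0// invrK.
Qed.

Lemma snorm0 : snorm 0 = 0.
Proof. by rewrite -(scale0r (0 : A)) snormZ cabs0 mul0r. Qed.

Lemma snorm_eq0 f : snorm f = 0 -> f = 0.
Proof.
move=> f0; apply: hss => m hm; apply/eqP; rewrite -cabs_eq0 eq_le cabs_ge0 andbT.
by rewrite -f0 char_le_snorm.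
Qed.

(** The fraction 3/4 has to beat the 1/2 of [uniform_window]. *)
Lemma snorm_near f : exists t, MA t /\ 3 / 4 * snorm f <= cabs (t f).
Proof.
have [f0|fn0] := eqVneq (snorm f) 0.
  by have [m hm] := MA_nonempty; exists m; rewrite f0 mulr0 cabs_ge0.
have fp : 0 < snorm f by rewrite lt_def fn0 snorm_ge0.
have e0 : 0 < snorm f / 4 by rewrite divr_gt0.
have [_ [t ht <-] h] := sup_adherent e0 (snorm_has_sup f).
by exists t; split=> //; move: h; rewrite -/(snorm f); lra.
Qed.

Lemma snormN f : snorm (- f) = snorm f.
Proof. by rewrite -scaleN1r snormZ cabsN cabs1 mul1r. Qed.

Lemma snorm_subD f g : snorm (f - g) <= snorm f + snorm g.
Proof. by rewrite -(snormN g) snormD. Qed.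

Lemma snorm1 : snorm 1 = 1.
Proof.
apply/eqP; rewrite eq_le; apply/andP; split.
  by apply: snorm_le => t ht; rewrite (char1 ht) cabs1.
by have [m hm] := MA_nonempty; rewrite -(cabs1 R) -(char1 hm) char_le_snorm.
Qed.

(** At each point one of the two values is 0. This gives the sup norm the property assumed of [nA],
    so one approximate eigenvector argument serves both norms. *)
Lemma snorm_disjoint f g : @regular R A -> supp f `&` supp g = set0 ->
  snorm (f + g) = snorm (f - g).
Proof.
move=> hreg fg0; rewrite /snorm; congr sup; apply: eq_imagel => t ht.
rewrite (charD ht) (charB ht).
have [->|tf] := eqVneq (t f) 0; first by rewrite add0r sub0r cabsN.
have [->|tg] := eqVneq (t g) 0; first by rewrite addr0 subr0.
have : (supp f `&` supp g) t by split; apply: sub_supp => //; apply/eqP.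
by rewrite fg0.
Qed.

End SupNorm.

(** * Weighted automorphisms, their inverses and cocycles *)

Section WeightedAutomorphism.
Variables (R : realType) (A : comUnitAlgType R[i]).
Implicit Types (U V : A -> A) (w : A) (t : @chi R A).

Definition wT w U (f : A) : A := w * U f.

Lemma aut_linop U : is_automorphism U -> linop U.
Proof. by case. Qed.

Lemma autM U : is_automorphism U -> {morph U : x y / x * y}.
Proof. by case. Qed.

Lemma aut1 U : is_automorphism U -> U 1 = 1.
Proof. by case. Qed.

Lemma aut_inverse U V : is_automorphism U -> cancel U V -> cancel V U -> is_automorphism V.
Proof.
move=> [lU mU U1 bU] UV VU; split.
- by move=> a x y; rewrite -{1}(VU x) -{1}(VU y) -lU UV.
- by move=> x y; rewrite -{1}(VU x) -{1}(VU y) -mU UV.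
- by rewrite -U1 UV.
- by exists U.
Qed.

Lemma aut_iter U n : is_automorphism U -> is_automorphism (iter n U).
Proof.
move=> hU; elim: n => [|n [IH1 IH2 IH3 IH4]]; first by split=> //; exists id.
split.
- exact: (linop_iter n.+1 (aut_linop hU)).
- by move=> x y; rewrite !iterS IH2 (autM hU).
- by rewrite iterS IH3 (aut1 hU).
- by apply: bij_comp IH4; case: hU.
Qed.

Lemma char_aut U t : is_automorphism U -> MA t -> MA (t \o U).
Proof. by move=> [lU mU U1 _] ht; apply: char_comp. Qed.

Lemma wT_linop w U : is_automorphism U -> linop (wT w U).
Proof. by move=> hU a x y; rewrite /wT (aut_linop hU) mulrDr -scalerAr. Qed.

(** [T^n 1] is the cocycle [w U(w) ... U^(n-1)(w)]; this splits [T^n] into a weight and a power of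
    [U], estimated separately. *)
Lemma wT_iter w U n g : is_automorphism U ->
  iter n (wT w U) g = iter n (wT w U) 1 * iter n U g.
Proof.
move=> hU; elim: n => [|n IH]; first by rewrite mul1r.
by rewrite !iterS IH /wT (autM hU) mulrA.
Qed.

Lemma wT_iterS w U n : is_automorphism U ->
  iter n.+1 (wT w U) 1 = iter n (wT w U) 1 * iter n U w.
Proof.
move=> hU; rewrite iterSr; have -> : wT w U 1 = w by rewrite /wT (aut1 hU) mulr1.
exact: wT_iter.
Qed.

Lemma wT_prod w U n : is_automorphism U ->
  \prod_(i < n) iter i U w = iter n (wT w U) 1.
Proof.
move=> hU; elim: n => [|n IH]; first by rewrite big_ord0.
by rewrite big_ord_recr IH wT_iterS.
Qed.

(** The inverse has the same shape as [w U], so each forward estimate has a backward version. *)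
Lemma wTK w U V : is_automorphism U -> cancel U V -> cancel V U -> w \is a GRing.unit ->
  cancel (wT w U) (wT (V w^-1) V).
Proof.
move=> hU UV VU uw f; have hV := aut_inverse hU UV VU.
by rewrite /wT -(autM hV) mulKr// UV.
Qed.

Lemma wTVK w U V : is_automorphism U -> cancel U V -> cancel V U -> w \is a GRing.unit ->
  cancel (wT (V w^-1) V) (wT w U).
Proof. by move=> hU UV VU uw f; rewrite /wT (autM hU) !VU mulVKr. Qed.

Lemma cancel_iter (S T : A -> A) n : cancel S T -> cancel (iter n S) (iter n T).
Proof. by move=> ST; elim: n => [//|n IH] x; rewrite iterSr iterS ST IH. Qed.

Lemma unit_aut U w : is_automorphism U -> w \is a GRing.unit -> U w \is a GRing.unit.
Proof.
move=> hU uw; apply/unitrPr; exists (U w^-1).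
by rewrite -(autM hU) divrr// (aut1 hU).
Qed.

Lemma supp_mulr f g : supp (f * g) `<=` @supp R A g.
Proof.
move=> t [ht h]; split=> // fs e e0.
have [p [[sp pfg] [sp' hp]]] := h fs e e0; exists p; split=> //; split=> //.
move=> pg; apply: pfg; have [mp _] := sp.
by rewrite (charM mp) pg mulr0.
Qed.

(** Turns a lower bound for backward weights at the [n]-th image of [t] into an upper bound for the
    forward weight at [t]. *)
Lemma wT_cocycle_inv w U V n t : is_automorphism U -> cancel U V -> cancel V U ->
  w \is a GRing.unit -> MA t ->
  t (iter n (wT w U) 1) * t (iter n U (iter n (wT (V w^-1) V) 1)) = 1.
Proof.
move=> hU UV VU uw ht; rewrite -(charM ht) -(wT_iter _ _ _ hU).
by rewrite (cancel_iter n (wTVK hU UV VU uw)) (char1 ht).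
Qed.

End WeightedAutomorphism.

(** * Growth of weighted iterates from the product estimate *)

Section Growth.
Variables (R : realType) (A : comUnitAlgType R[i]) (nA : A -> R).
Hypothesis hnA : is_banach_alg_norm nA.
Hypothesis hss : @semisimple R A.
Hypothesis hreg : @regular R A.

Definition product_estimate (C : R) := forall V : set (@chi R A), wopen (@shilov R A) V ->
     forall (p : nat), (0 < p)%N -> forall fs : 'I_p -> A,
       supp (\prod_(i < p) fs i) `<=` V ->
       nA (\prod_(i < p) fs i) <=
         C * \sum_(j < p) nA (fs j) *
           sup [set cabs (\prod_(k < p | k != j) t (fs k)) | t in wclosure (@shilov R A) V].

Variable C : R.
Hypothesis C0 : 0 < C.
Hypothesis hC : product_estimate C.

(** Spectral radius at most 1, in quantitative form. *)
Definition subexp (U : A -> A) := forall s : R, 1 < s ->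
  exists K, 0 <= K /\ forall n x, nA (iter n U x) <= K * s ^+ n * nA x.

(** [0 <= B] covers the empty set, whose [sup] is 0. *)
Lemma sup_image_le (S : set (@chi R A)) (F : @chi R A -> R) B : 0 <= B ->
  (forall t, S t -> F t <= B) -> sup [set F t | t in S] <= B.
Proof.
move=> B0 h; have [->|/set0P[t St]] := eqVneq S set0.
  by rewrite image_set0 sup0.
apply: sup_le_ub; first by exists (F t), t.
by move=> _ [s Ss <-]; apply: h.
Qed.

Lemma geometric_sum_le (s : R) n : 1 < s -> \sum_(i < n) s ^+ i <= s ^+ n / (s - 1).
Proof.
move=> s1; rewrite ler_pdivlMr; last by rewrite subr_gt0.
by rewrite mulrC -subrX1 gerBl.
Qed.

(** Product estimate for the [n] factors [U^i w] and [g]. When [g] pays its norm, the rest is the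
    whole weight, at most [B] near the support of [g]. When [U^i w] pays, the rest is the weight
    times [g] divided by [U^i w], still of order [B nA g]. *)
Lemma weight_growth (U : A -> A) (w : A) : is_automorphism U -> w \is a GRing.unit ->
  subexp U -> forall s, 1 < s -> exists K, 0 <= K /\ forall n g B, 0 <= B ->
    supp g `<=` [set t | MA t /\ cabs (t (iter n (wT w U) 1)) < B] ->
    nA (iter n (wT w U) 1 * g) <= K * s ^+ n * (B * nA g).
Proof.
move=> hU uw gU s s1; have [K [K0 hK]] := gU s s1.
(* [nA w^-1] pays for the division by [U^i w], and [1 / (s - 1)] comes from summing the norms of the
   [U^i w] geometrically. *)
pose D := K * nA w * nA w^-1 / (s - 1).
have nAx x := nA_ge0 hnA x.
have D0 : 0 <= D by rewrite divr_ge0 ?mulr_ge0 ?subr_ge0 ?(ltW s1).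
exists (C * (D + 1)); split; first by apply: mulr_ge0; [exact: ltW|exact: addr_ge0].
move=> n g B B0 gV; set W := iter n (wT w U) 1.
set V := [set t | _] in gV.
pose fs (i : 'I_n.+1) := if (i < n)%N then iter i U w else g.
have fsl (i : 'I_n) : fs (widen_ord (leqnSn n) i) = iter i U w by rewrite /fs /= ltn_ord.
have fsm : fs ord_max = g by rewrite /fs /= ltnn.
have prodE : \prod_(i < n.+1) fs i = W * g.
  by rewrite /W -(wT_prod w n hU) big_ord_recr fsm /=; congr (_ * _); apply: eq_bigr => i _; rewrite fsl.
have sM := shilov_regular hreg.
have oV : wopen (@shilov R A) V by rewrite sM; apply: wopen_lt.
have := hC oV (ltn0Sn n) (fs := fs); rewrite prodE => /(_ _)/le_trans; apply.
  by apply: subset_trans gV; apply: supp_mulr.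
rewrite -!mulrA ler_wpM2l ?(ltW C0)// big_ord_recr /= fsm.
rewrite sM.
have clV t : wclosure (@MA R A) V t -> MA t /\ cabs (t W) <= B by apply: wclosure_lt.
have sup_last : sup [set cabs (\prod_(k < n.+1 | k != ord_max) t (fs k)) |
    t in wclosure (@MA R A) V] <= B.
  apply: sup_image_le => // t /clV[ht tB]; rewrite -(char_prod ht).
  rewrite big_mkcond big_ord_recr /= eqxx mulr1.
  rewrite (_ : \prod_(i < n) _ = W)// /W -(wT_prod w n hU); apply: eq_bigr => i _.
  by rewrite fsl -val_eqE /= neq_ltn ltn_ord.
have sup_other (i : 'I_n) : sup [set cabs (\prod_(k < n.+1 | k != widen_ord (leqnSn n) i)
    t (fs k)) | t in wclosure (@MA R A) V] <= B * nA g * nA w^-1.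
  apply: sup_image_le; first by rewrite !mulr_ge0.
  move=> t /clV[ht tB]; set j := widen_ord _ i.
  have hi := char_aut (aut_iter i hU) ht.
  have e1 : t (fs j) * \prod_(k < n.+1 | k != j) t (fs k) = t W * t g.
    by rewrite -(charM ht) -prodE (char_prod ht) [RHS](bigD1 j).
  have e2 : t (iter i U w^-1) * t (fs j) = 1.
    by rewrite fsl mulrC; apply: (char_unit hi).
  have -> : \prod_(k < n.+1 | k != j) t (fs k) = t W * t g * t (iter i U w^-1).
    by rewrite -e1 mulrC mulrA e2 mul1r.
  rewrite !cabsM; apply: ler_pM; rewrite ?mulr_ge0 ?cabs_ge0//; last exact: (char_le hnA _ hi).
  by apply: ler_pM; rewrite ?cabs_ge0//; apply: char_le.
have sn1 : 1 <= s ^+ n by rewrite exprn_ege1// ltW.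
have h1 : \sum_(i < n) nA (fs (widen_ord (leqnSn n) i)) *
    sup [set cabs (\prod_(k < n.+1 | k != widen_ord (leqnSn n) i) t (fs k)) |
         t in wclosure (@MA R A) V] <= D * (s ^+ n * (B * nA g)).
  apply: (@le_trans _ _ (\sum_(i < n) s ^+ i * (K * nA w * (B * nA g * nA w^-1)))).
    apply: ler_sum => i _; rewrite fsl.
    apply: (@le_trans _ _ (nA (iter i U w) * (B * nA g * nA w^-1))).
      by rewrite ler_wpM2l.
    rewrite mulrA ler_wpM2r ?mulr_ge0//; apply: (le_trans (hK i w)).
    by rewrite mulrAC mulrC.
  rewrite -mulr_suml.
  have -> : D * (s ^+ n * (B * nA g)) =
      s ^+ n / (s - 1) * (K * nA w * (B * nA g * nA w^-1)) by rewrite /D; ring.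
  by rewrite ler_wpM2r ?geometric_sum_le// !mulr_ge0.
have h2 : nA g * sup [set cabs (\prod_(k < n.+1 | k != ord_max) t (fs k)) |
    t in wclosure (@MA R A) V] <= s ^+ n * (B * nA g).
  apply: (@le_trans _ _ (nA g * B)); first by rewrite ler_wpM2l.
  by rewrite mulrC ler_peMl// mulr_ge0.
apply: (le_trans (lerD h1 h2)); rewrite mulrDl mul1r; lra.
Qed.

(** [E] carries [u]. Backward weights at least 1/4 on [E] mean forward weights at most 4 where
    [T^n u] lives, so a bump moved along such an orbit hardly grows. The norm [nu] will be both [nA]
    and [snorm]. *)
Definition orbit_growth (nu : A -> R) (T T' : A -> A) := forall s : R, 1 < s ->
  exists K, 0 <= K /\ forall n u (E : set (@chi R A)), wclosed (@MA R A) E ->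
    (forall t, MA t -> t u <> 0 -> E t) ->
    (forall t, E t -> 1 / 4 <= cabs (t (iter n T' 1))) ->
    nu (iter n T u) <= K * s ^+ n * nu u.

Section Pair.
Variables (U V : A -> A) (w : A).
Hypothesis hU : is_automorphism U.
Hypothesis UV : cancel U V.
Hypothesis VU : cancel V U.
Hypothesis uw : w \is a GRing.unit.
Let T := wT w U.
Let T' := wT (V w^-1) V.

Lemma weight_le4 n t : MA t -> 1 / 4 <= cabs (t (iter n U (iter n T' 1))) ->
  cabs (t (iter n T 1)) <= 4.
Proof.
move=> ht h; have := congr1 (@cabs R) (wT_cocycle_inv n hU UV VU uw ht).
rewrite cabsM cabs1 -/T -/T' => h1; have := cabs_ge0 (t (iter n T 1)); nra.
Qed.

Lemma nA_orbit_growth : subexp U -> orbit_growth nA T T'.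
Proof.
(* One factor [r^n] is lost on the weight and one on [U^n u]. *)
move=> gU s s1; set r := Num.sqrt s.
have r1 : 1 < r by rewrite -sqrtr1 ltr_sqrt//; lra.
have rs : r * r = s by rewrite -expr2 sqr_sqrtr//; lra.
have [K [K0 hK]] := gU r r1; have [K' [K'0 hK']] := weight_growth hU uw gU r1.
exists (K' * 5 * K); split; first by rewrite !mulr_ge0.
move=> n u E cE uE hE; rewrite /T (wT_iter _ _ _ hU).
(* [weight_growth] asks for a strict bound on the support; 5 exceeds the 4 of [weight_le4]. *)
have B5 : 0 <= 5 :> R by [].
apply: (le_trans (hK' n (iter n U u) 5 B5 _)).
  apply: (subset_trans (supp_sub (E := [set t | MA t /\ E (t \o iter n U)]) hreg _ _)).
  - by apply: wclosed_preimage => // m hm; apply: char_aut => //; apply: aut_iter.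
  - by move=> t ht tu; split=> //; apply: uE => //; apply: char_aut => //; apply: aut_iter.
  - move=> t [ht /hE Et]; split=> //.
    by have := weight_le4 ht Et; rewrite -/T; lra.
apply: (@le_trans _ _ (K' * r ^+ n * (5 * (K * r ^+ n * nA u)))).
  apply: ler_wpM2l; first by rewrite mulr_ge0// exprn_ge0// sqrtr_ge0.
  by apply: ler_wpM2l => //; apply: hK.
by rewrite -rs exprMn le_eqVlt; apply/orP; left; apply/eqP; ring.
Qed.

Lemma snorm_orbit_growth : orbit_growth (@snorm R A) T T'.
Proof.
move=> s s1; exists 4; split=> // n u E cE uE hE.
have sn1 : 1 <= s ^+ n by rewrite exprn_ege1// ltW.
have u0 := snorm_ge0 hnA hss u.
apply: (@le_trans _ _ (4 * snorm u)); last by nra.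
apply: (snorm_le hnA hss) => t ht; rewrite /T (wT_iter _ _ _ hU) (charM ht) cabsM.
have htU := char_aut (aut_iter n hU) ht.
have [->|tu] := eqVneq (t (iter n U u)) 0; first by rewrite cabs0 mulr0 mulr_ge0.
apply: ler_pM; rewrite ?cabs_ge0//; last exact: (char_le_snorm hnA hss _ htU).
by apply: weight_le4 => //; apply: (hE (t \o iter n U)); apply: uE => //; apply/eqP.
Qed.

End Pair.

End Growth.

(** * Points without decay and approximate eigenvectors *)

Section TypeI.
Variables (R : realType) (A : comUnitAlgType R[i]) (nA : A -> R).
Hypothesis hnA : is_banach_alg_norm nA.
Hypothesis hreg : @regular R A.
Variables (U V : A -> A) (w : A).
Hypothesis hU : is_automorphism U.
Hypothesis UV : cancel U V.
Hypothesis VU : cancel V U.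
Hypothesis uw : w \is a GRing.unit.
Let T := wT w U.
Let T' := wT (V w^-1) V.

Lemma phi_iter k (t : @chi R A) : iter k (phi U) t = t \o iter k U.
Proof.
elim: k => [//|k IH]; apply: funext => f /=.
by rewrite IH /phi /= -iterSr.
Qed.

(** Some [f] separates [t] from its [k]-th image, with gap [D]. A neighbourhood of [t] controlling
    both [f] and [U^k f] within [D / 3] contains no point that returns to it at time [k]. *)
Lemma aperiodic_separation (t : @chi R A) (M : nat) :
  (forall n, (0 < n)%N -> iter n (phi U) t <> t) ->
  exists (fs : seq A) (e : R), 0 < e /\ forall p : @chi R A,
    (forall f, f \in fs -> cabs (p f - t f) <= e) ->
    forall k, (0 < k <= M)%N -> exists f, f \in fs /\ e < cabs (p (iter k U f) - t f).
Proof.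
move=> np; elim: M => [|M [fs [e [e0 h]]]].
  by exists [::], 1; split=> // p _ [|k].
have [f tf] : exists f, t (iter M.+1 U f) <> t f.
  apply: contrapT => H; apply: (np M.+1 isT); rewrite phi_iter; apply: funext => f /=.
  by apply: contrapT => h'; apply: H; exists f.
set D := cabs (t (iter M.+1 U f) - t f).
have D0 : 0 < D by rewrite cabs_gt0 subr_eq0; apply/eqP.
exists (f :: iter M.+1 U f :: fs), (Num.min e (D / 3)); split.
  by rewrite lt_min e0 divr_gt0.
move=> p hp k /andP[k0]; rewrite leq_eqVlt => /orP[/eqP->|kM].
  exists f; split; first by rewrite mem_head.
  have h1 : cabs (p (iter M.+1 U f) - t (iter M.+1 U f)) <= D / 3.
    have := hp (iter M.+1 U f); rewrite !inE eqxx orbT => /(_ isT).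
    by rewrite le_min => /andP[].
  apply: (@le_lt_trans _ _ (D / 3)); first by rewrite ge_min lexx orbT.
  have : D <= cabs (p (iter M.+1 U f) - t (iter M.+1 U f)) + cabs (p (iter M.+1 U f) - t f).
    by rewrite (cabsB (p _) (t (iter _ _ _))) -[X in X <= _]/(cabs _) -(subrKA (p (iter M.+1 U f))) cabsD.
  lra.
have hp' g : g \in fs -> cabs (p g - t g) <= e.
  move=> gs; have := hp g; rewrite !inE gs !orbT => /(_ isT).
  by rewrite le_min => /andP[].
have [|g [gs hg]] := h p hp' k; first by rewrite k0 -ltnS.
exists g; split; first by rewrite !inE gs !orbT.
by apply: le_lt_trans hg; rewrite ge_min lexx.
Qed.

(* No dichotomy at [t]: the bumps [T^k u], [k] in Z, carried by the orbit of [t] stay bounded. *)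
Definition type1 (t : @chi R A) := MA t /\ forall n,
  1 / 2 <= cabs (t (iter n T 1)) /\ 1 / 2 <= cabs (t (iter n T' 1)).

Variable nu : A -> R.
Hypothesis nuD : forall x y, nu (x + y) <= nu x + nu y.
Hypothesis nuZ : forall (a : R[i]) x, nu (a *: x) = cabs a * nu x.
Hypothesis nu_eq0 : forall x, nu x = 0 -> x = 0.
Hypothesis nu_disjoint : forall f g : A, supp f `&` supp g = set0 -> nu (f + g) = nu (f - g).

Lemma nu_ge0 x : 0 <= nu x.
Proof.
have n0 : nu 0 = 0 by rewrite -(scale0r (0 : A)) nuZ cabs0 mul0r.
have := nuD x (- x); rewrite subrr n0 -scaleN1r nuZ cabsN cabs1; lra.
Qed.

(** [2 f = (f + g) + (f - g)] with two summands of equal norm: pieces with disjoint supports cannot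
    cancel. *)
Lemma nu_le_disjoint f g : supp f `&` supp g = set0 -> nu f <= nu (f + g).
Proof.
move=> fg; have e := nu_disjoint fg; have := nuD (f + g) (f - g); rewrite -e.
have -> : f + g + (f - g) = (2 : R[i]) *: f by rewrite scaler_nat mulr2n; ring.
rewrite nuZ; have -> : cabs (2 : R[i]) = 2; last by lra.
by have := @cabs_real R 2; rewrite rmorph_nat; apply.
Qed.

(* [F = sum_k r^|k| T^k u] is an approximate eigenvector, up to the two boundary terms. *)
Lemma telescoped_orbit_sum (r : R[i]) (u : A) N : r != 0 ->
  let G := \sum_(k < N) r ^+ k.+1 *: iter k.+1 T' u in
  let F := \sum_(k < N) r ^+ k.+1 *: iter k.+1 T u in
  u + G + F - T (u + G + F) = (1 - r) *: (u + G) + (1 - r^-1) *: F +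
    (r ^+ N.+1 *: iter N T' u - r ^+ N *: iter N.+1 T u).
Proof.
move=> r0 G F; have lT : linop T := wT_linop w hU.
have TT' : cancel T' T := wTVK hU UV VU uw.
have eG : T G = r *: (u + G) - r ^+ N.+1 *: iter N T' u.
  rewrite /G; elim: N {G F} => [|N IH].
    by rewrite !big_ord0 (linop0 lT) expr1 addr0 subrr.
  rewrite !big_ord_recr /= [LHS](linopD lT) IH (linopZ lT) TT' addrA [in RHS]scalerDr scalerA -exprS.
  ring.
have eF : T F = r^-1 *: F + r ^+ N *: iter N.+1 T u - T u.
  rewrite /F; elim: N {G F eG} => [|N IH].
    by rewrite !big_ord0 (linop0 lT) expr0 scaler0 scale1r add0r subrr.
  rewrite !big_ord_recr /= [LHS](linopD lT) IH (linopZ lT) scalerDr scalerA.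
  have -> : r^-1 * r ^+ N.+1 = r ^+ N by rewrite exprS mulKf.
  ring.
rewrite ![T (_ + _)](linopD lT) eG eF !scalerBl !scale1r; ring.
Qed.

Hypothesis grT : orbit_growth nu T T'.
Hypothesis grT' : orbit_growth nu T' T.
Hypothesis hper : first_category (@shilov R A) (periodic_points U).

(** The relevant weights exceed 1/4 on an open set around [t0]. By Baire it contains a point outside
    the meager set of periodic points, and a bump concentrated near that point has disjoint
    translates. *)
Lemma orbit_bump t0 (N : nat) : type1 t0 -> exists (u : A) (E : set (@chi R A)),
  [/\ u <> 0, wclosed (@MA R A) E, (forall t, MA t -> t u <> 0 -> E t),
      (forall n t, (n <= N.+1)%N -> E t ->
         1 / 4 <= cabs (t (iter n T 1)) /\ 1 / 4 <= cabs (t (iter n T' 1))) &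
      (forall k t, (0 < k <= N + N)%N -> E t -> ~ E (t \o iter k U))].
Proof.
move=> [ht0 ty]; have sM := shilov_regular hreg.
pose ws := [seq iter n T 1 | n <- iota 0 N.+2] ++ [seq iter n T' 1 | n <- iota 0 N.+2].
pose S : set (@chi R A) := [set p | MA p /\ forall f, f \in ws -> 1 / 4 < cabs (p f)].
have oS : wopen (@MA R A) S by apply: wopen_gt.
have St0 : S t0.
  split=> // f; rewrite mem_cat => /orP[/mapP[n _ ->]|/mapP[n _ ->]].
    by have [h _] := ty n; lra.
  by have [_ h] := ty n; lra.
have [_ [Nw [hNw pN]]] := hper.
have [t [[ht St] nN]] : exists t, S t /\ forall n, ~ Nw n t.
  apply: (open_not_meager (B := nA)) => //; first by move=> t f ht; apply: char_le.
    by move=> n; have [_] := hNw n; rewrite sM.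
  by exists t0.
have np n : (0 < n)%N -> iter n (phi U) t <> t.
  move=> n0 h; have [|k _ Nk] := pN t; last exact: (nN k).
  by split; [rewrite sM|exists n].
(* Two times between [-N] and [N] differ by at most [N + N]. *)
have [fs [e [e0 hs]]] := aperiodic_separation (N + N) np.
have [gs [d [d0 hd]]] := (proj2 oS) t (conj ht St).
pose m := Num.min e d / 2.
have m0 : 0 < m by rewrite divr_gt0// lt_min e0.
have me : m < e.
  by apply: (@lt_le_trans _ _ (Num.min e d)); [rewrite /m; move: m0; rewrite /m; lra|rewrite ge_min lexx].
have md : m < d.
  by apply: (@lt_le_trans _ _ (Num.min e d)); [rewrite /m; move: m0; rewrite /m; lra|rewrite ge_min lexx orbT].
(* Same radius, closed and open: regularity gives a bump vanishing off [W], and the closed set [E]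
   then contains its support. *)
pose E : set (@chi R A) := [set p | MA p /\ forall f, f \in fs ++ gs -> cabs (p f - t f) <= m].
pose W : set (@chi R A) := [set p | MA p /\ forall f, f \in fs ++ gs -> cabs (p f - t f) < m].
have cW : wclosed (@MA R A) (@MA R A `\` W).
  split=> [p []//|]; rewrite setDD setIidr; first exact: wopen_nbhd.
  by move=> p [].
have [|u [u1 u0]] := hreg cW ht.
  by move=> [_]; apply; split=> // f _; rewrite subrr cabs0.
exists u, E; split.
- by move=> uz; move: u1; rewrite uz (char0 ht) => /eqP; rewrite eq_sym oner_eq0.
- exact: wclosed_ball.
- move=> p hp pu; have [[_ Wp]|nW] := pselect (W p).
    by split=> // f /Wp /ltW.
  by case: pu; apply: u0.
- move=> n p nN1 [hp Ep].
  have [_ Sp] : S p.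
    by apply: hd => // f fg; apply: le_lt_trans md; apply: Ep; rewrite mem_cat fg orbT.
  by split; apply: ltW; apply: Sp; rewrite mem_cat; apply/orP; [left|right];
    apply/mapP; exists n => //; rewrite mem_iota /= add0n ltnS.
- move=> k p kN [hp Ep] [_ Ekp].
  have [f [ffs]] : exists f, f \in fs /\ e < cabs (p (iter k U f) - t f).
    apply: hs => // f ffs; apply: le_trans (ltW me); apply: Ep.
    by rewrite mem_cat ffs.
  have := Ekp f; rewrite mem_cat ffs => /(_ isT) /=; lra.
Qed.

(** The damped orbit sum [S] has defect at most [4 eps nu S]: [eps] from [1 - r], [2 eps] from
    [1 - 1/r], and [eps] from the boundary terms. *)
Lemma type1_not_bounded_below t0 : type1 t0 ->
  forall k : R, ~ forall f, nu f <= k * nu (f - T f).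
Proof.
move=> ty k0 hk0.
pose k := `|k0| + 1.
have k1 : 1 <= k by rewrite lerDr.
have hk f : nu f <= k * nu (f - T f).
  apply: (le_trans (hk0 f)); rewrite ler_wpM2r ?nu_ge0//.
  by rewrite /k; have := ler_norm k0; lra.
(* Then [4 eps k = 1/2], against the lower bound. *)
pose eps : R := (8 * k)^-1.
have k8 : 0 < 8 * k by lra.
have eps0 : 0 < eps by rewrite invr_gt0.
have epsk : eps * (8 * k) = 1 by rewrite mulVf// gt_eqF.
have eps8 : eps <= 1 / 8 by move: epsk k1 eps0; clearbody eps k; nra.
clearbody eps k.
(* Chosen so that [s rho < 1]: the damping beats the growth of the orbit, and a large [N] makes the
   boundary terms small. *)
pose rho := 1 - eps; pose s := 1 + eps / 2.
have s1 : 1 < s by rewrite /s; move: eps0; lra.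
have [K [K0 hK]] := grT s1; have [K' [K'0 hK']] := grT' s1.
have q0 : 0 <= s * rho by apply: mulr_ge0; rewrite /s /rho; move: eps0 eps8; lra.
have q1 : s * rho < 1 by rewrite /s /rho; move: eps0 eps8; nra.
(* Covers [K' + 2 K], where 2 bounds the extra factor [s] of [T^(N+1) u]. *)
have D0 : 0 < eps / (2 * (K + K') + 1).
  by rewrite divr_gt0//; move: K0 K'0; lra.
have [N /(_ N (leqnn N))] := expr_eventually_small q0 q1 D0.
rewrite exprMn ltr_pdivlMr; last by move: K0 K'0; lra.
move=> hN.
have [u [E [un0 cE uE hE sep]]] := orbit_bump N ty.
have rho0 : 0 < rho by rewrite /rho; move: eps8; lra.
have rho1 : rho < 1 by rewrite /rho; move: eps0; lra.
pose r : R[i] := rho%:C%C.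
have cr : cabs r = rho by rewrite cabs_real// ltW.
have rn0 : r != 0 by rewrite -cabs_gt0 cr.
pose G := \sum_(j < N) r ^+ j.+1 *: iter j.+1 T' u.
pose F := \sum_(j < N) r ^+ j.+1 *: iter j.+1 T u.
have hV := aut_inverse hU UV VU.
pose EU j : set (@chi R A) := [set t | MA t /\ E (t \o iter j.+1 U)].
pose EV j : set (@chi R A) := [set t | MA t /\ E (t \o iter j.+1 V)].
have cEU j : wclosed (@MA R A) (EU j).
  by apply: wclosed_preimage => // m hm; apply: char_aut => //; apply: aut_iter.
have cEV j : wclosed (@MA R A) (EV j).
  by apply: wclosed_preimage => // m hm; apply: char_aut => //; apply: aut_iter.
have suF : supp F `<=` [set t | exists j, (j < N)%N /\ EU j t].
  apply: supp_sub => //; first exact: wclosed_exists.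
  move=> t ht tF; apply: contrapT => H; apply: tF; rewrite (char_sum ht) big1// => j _.
  rewrite (charZ ht) /T (wT_iter _ _ _ hU) (charM ht).
  have -> : t (iter j.+1 U u) = 0; last by rewrite !mulr0.
  apply: contrapT => h; apply: H; exists j; split=> //; split=> //.
  by apply: uE => //; apply: char_aut => //; apply: aut_iter.
have suG : supp G `<=` [set t | exists j, (j < N)%N /\ EV j t].
  apply: supp_sub => //; first exact: wclosed_exists.
  move=> t ht tF; apply: contrapT => H; apply: tF; rewrite (char_sum ht) big1// => j _.
  rewrite (charZ ht) /T' (wT_iter _ _ _ hV) (charM ht).
  have -> : t (iter j.+1 V u) = 0; last by rewrite !mulr0.
  apply: contrapT => h; apply: H; exists j; split=> //; split=> //.
  by apply: uE => //; apply: char_aut => //; apply: aut_iter.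
have suu : supp u `<=` E by apply: supp_sub.
have suuG : supp (u + G) `<=` E `|` [set t | exists j, (j < N)%N /\ EV j t].
  apply: supp_sub => //; first by apply: wclosedU => //; apply: wclosed_exists.
  move=> t ht; rewrite (charD ht) => h.
  have [tu|tu] := eqVneq (t u) 0; last by left; apply: uE => //; apply/eqP.
  by right; apply: suG; apply: sub_supp => //; move: h; rewrite tu add0r.
have suGF : supp (G + F) `<=` [set t | exists j, (j < N)%N /\ EV j t] `|`
    [set t | exists j, (j < N)%N /\ EU j t].
  apply: supp_sub => //; first by apply: wclosedU; apply: wclosed_exists.
  move=> t ht; rewrite (charD ht) => h.
  have [tG|tG] := eqVneq (t G) 0; last by left; apply: suG; apply: sub_supp => //; apply/eqP.
  by right; apply: suF; apply: sub_supp => //; move: h; rewrite tG add0r.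
have VUn n (t : @chi R A) : (t \o iter n V) \o iter n U = t.
  by apply: funext => f /=; rewrite (cancel_iter n UV).
have EEU t j : (j < N)%N -> E t -> EU j t -> False.
  by move=> jN Et [_]; apply: sep => //; rewrite /= (leq_trans jN)// leq_addr.
have EEV t j : (j < N)%N -> E t -> EV j t -> False.
  move=> jN Et [_ h]; apply: (sep j.+1 _ _ h); last by rewrite VUn.
  by rewrite /= (leq_trans jN)// leq_addr.
have EUEV t i j : (i < N)%N -> (j < N)%N -> EV i t -> EU j t -> False.
  move=> iN jN [_ h] [_ h']; apply: (sep (i.+1 + j.+1)%N _ _ h).
    by rewrite addSn /= -addSn leq_add.
  by rewrite (_ : _ \o _ = t \o iter j.+1 U)//; apply: funext => f;
    rewrite /comp iterD (cancel_iter i.+1 UV).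
have d1 : supp u `&` supp (G + F) = set0.
  apply/seteqP; split=> // t [/suu Et /suGF[[j [jN h]]|[j [jN h]]]]; first exact: (EEV t j).
  exact: (EEU t j).
have d2 : supp (u + G) `&` supp F = set0.
  apply/seteqP; split=> // t [/suuG[Et|[i [iN h]]] /suF[j [jN h']]]; first exact: (EEU t j).
  exact: (EUEV t i j).
pose S := u + G + F.
(* Each piece of [S] is split off along disjoint supports, so it is no larger than [S]. *)
have S1 : nu u <= nu S by rewrite /S -addrA nu_le_disjoint.
have S2 : nu (u + G) <= nu S by apply: nu_le_disjoint.
have S3 : nu F <= nu S by rewrite /S addrC nu_le_disjoint// setIC.
have u0 : 0 < nu u by rewrite lt_def nu_ge0 andbT; apply/eqP => /nu_eq0.
have b1 : nu (iter N T' u) <= K' * s ^+ N * nu u.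
  by apply: (hK' N u E) => // t Et; have [] := hE N t (leqnSn N) Et.
have b2 : nu (iter N.+1 T u) <= K * s ^+ N.+1 * nu u.
  by apply: (hK N.+1 u E) => // t Et; have [] := hE N.+1 t (leqnn _) Et.
have c1 : cabs (1 - r) = eps.
  by rewrite -(rmorph1 (real_complex R)) -rmorphB /= cabs_real /rho; [ring|move: eps0; lra].
have rhoV : rho^-1 - 1 <= 2 * eps.
  rewrite lerBlDr -[leLHS]mul1r ler_pdivrMr// /rho; move: eps0 eps8; nra.
have rhoV0 : 0 <= rho^-1 - 1 by rewrite subr_ge0 invf_ge1// ltW.
have c2 : cabs (1 - r^-1) = rho^-1 - 1.
  by rewrite cabsB /r -fmorphV -(rmorph1 (real_complex R)) -rmorphB /= cabs_real.
have := telescoped_orbit_sum u N rn0; rewrite /= -/F -/G -/S => eS.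
have sN : 0 < s ^+ N by rewrite exprn_gt0//; move: s1; lra.
have rN : 0 < rho ^+ N by rewrite exprn_gt0.
have bd : nu (r ^+ N.+1 *: iter N T' u - r ^+ N *: iter N.+1 T u) <= eps * nu u.
  apply: (le_trans (nuD _ _)); rewrite -scaleNr !nuZ cabsN !cabsX cr.
  apply: (@le_trans _ _ (rho ^+ N * (K' * s ^+ N * nu u) + rho ^+ N * (2 * K * s ^+ N * nu u))).
    apply: lerD.
      apply: ler_pM => //; rewrite ?nu_ge0//; first by rewrite exprn_ge0// ltW.
      by rewrite exprS ler_piMl ?(ltW rN)// ltW.
    rewrite ler_wpM2l ?(ltW rN)//; apply: (le_trans b2).
    rewrite ler_wpM2r ?(ltW u0)// exprS mulrA ler_wpM2r ?(ltW sN)// mulrC ler_wpM2r//.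
    by rewrite /s; move: eps8; lra.
  have -> : rho ^+ N * (K' * s ^+ N * nu u) + rho ^+ N * (2 * K * s ^+ N * nu u) =
      s ^+ N * rho ^+ N * (K' + 2 * K) * nu u by ring.
  rewrite ler_wpM2r ?(ltW u0)//; apply: le_trans (ltW hN).
  by rewrite ler_wpM2l ?mulr_ge0 ?(ltW sN) ?(ltW rN)//; lra.
have fin : nu (S - T S) <= 4 * eps * nu S.
  rewrite eS; apply: (le_trans (nuD _ _)); apply: (le_trans (lerD (nuD _ _) bd)).
  rewrite !nuZ c1 c2.
  have h1 : eps * nu (u + G) <= eps * nu S by rewrite ler_wpM2l// ltW.
  have h2 : (rho^-1 - 1) * nu F <= 2 * eps * nu S by apply: ler_pM => //; apply: nu_ge0.
  have h3 : eps * nu u <= eps * nu S by rewrite ler_wpM2l// ltW.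
  by move: h1 h2 h3; lra.
have S0 : 0 < nu S by apply: lt_le_trans S1.
have := hk S; have h := ler_wpM2l (ltW (lt_le_trans ltr01 k1)) fin.
by move: epsk S0 h; nra.
Qed.

End TypeI.

(** * Two-sided sequences that halve within a bounded window *)

Lemma window_argmin (R : realType) (x : int -> R) (a : int) (M : nat) : exists q : int,
  a <= q <= a + M%:Z /\ forall j : int, a <= j <= a + M%:Z -> x q <= x j.
Proof.
elim: M => [|M [q [qb qm]]].
  exists a; split; first by lia.
  by move=> j hj; have -> : j = a by lia.
have [h|h] := leP (x q) (x (a + M.+1%:Z)).
  exists q; split; first by lia.
  move=> j hj; have [->//|jn] := eqVneq j (a + M.+1%:Z).
  by apply: qm; lia.
exists (a + M.+1%:Z); split; first by lia.
move=> j hj; have [->//|jn] := eqVneq j (a + M.+1%:Z).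
by apply: (le_trans (ltW h)); apply: qm; lia.
Qed.

Section Windows.
Variable R : realType.
Variables (x : int -> R) (N : nat) (L : R).
Hypothesis x0 : forall k, 0 < x k.
Hypothesis L1 : 1 <= L.
Hypothesis drop : forall j, exists k : int, - N%:Z <= k <= N%:Z /\ x (j + k) < x j / 2.
Hypothesis step : forall j, x (j + 1) <= L * x j.

Lemma steps j (n : nat) : (n <= N)%N -> x (j + n%:Z) <= L ^+ N * x j.
Proof.
move=> nN; apply: (@le_trans _ _ (L ^+ n * x j)); last first.
  by rewrite ler_wpM2r ?(ltW (x0 _))// ler_weXn2l.
elim: n {nN} => [|n IH]; first by rewrite addr0 mul1r.
have -> : j + n.+1%:Z = j + n%:Z + 1 by lia.
rewrite exprS -mulrA; apply: (le_trans (step _)); rewrite ler_wpM2l//.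
exact: le_trans L1.
Qed.

Variable th : R.
Hypothesis th0 : 0 < th.
Hypothesis th1 : th <= 1.
Hypothesis thN : 1 / 2 <= th ^+ N.

(* Once the minimum over a window sits at its right part, it keeps moving to the right,
   halving the value at each move. *)
Lemma forward_decay (p : nat) : (p <= N)%N ->
  (forall j : int, p%:Z - N%:Z <= j <= p%:Z -> x p%:Z <= x j) ->
  x p%:Z <= x 0 / 2 -> forall n : nat, x n%:Z <= 2 * L ^+ N * th ^+ n * x 0.
Proof.
move=> pN pmin px n.
have Ln : 1 <= L ^+ N by rewrite exprn_ege1.
have thn m : 0 < th ^+ m by rewrite exprn_gt0.
(* Nothing in the [N] places behind [q] is smaller than [x q], so the next halving lies ahead. A
   halving within at most [N] steps is at least as good as the rate [th], because [th^N >= 1/2]. *)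
suff [q [nq _ _ hq]] : exists q : nat, [/\ (n <= q)%N,
    (forall j : int, q%:Z - N%:Z <= j <= q%:Z -> x q%:Z <= x j),
    x q%:Z <= th ^+ q * x 0 &
    forall m : nat, (m <= q)%N -> x m%:Z <= 2 * L ^+ N * th ^+ m * x 0].
  exact: hq.
have xp := x0 0.
have thmono (a b : nat) : (a <= b)%N -> th ^+ b <= th ^+ a.
  by move=> ab; apply: ler_wiXn2l => //; apply: ltW.
elim: n => [|n [q [nq qmin qx hq]]].
  exists p; split=> //.
    have : th ^+ N <= th ^+ p by apply: thmono.
    by move: px thN xp; nra.
  move=> m mp; have h := @steps 0 m (leq_trans mp pN); rewrite add0r in h.
  apply: (le_trans h); rewrite ler_wpM2r ?(ltW xp)// -mulrA mulrCA.
  rewrite ler_peMr ?(le_trans ler01 Ln)//.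
  have : th ^+ N <= th ^+ m by apply: thmono; apply: leq_trans pN.
  by move: thN; lra.
have [nq'|nq'] := ltnP n q; first by exists q.
have [r [rb rmin]] := window_argmin x (q%:Z - N%:Z) (N + N).
have [k [kb kx]] := drop q%:Z.
have rx : x r < x q%:Z / 2 by apply: le_lt_trans kx; apply: rmin; move: kb; clear; lia.
have qr : q%:Z < r.
  rewrite ltNge; apply/negP => rq; have := qmin r; have -> : q%:Z - N%:Z <= r <= q%:Z by move: rb rq; clear; lia.
  by move=> /(_ isT); have := x0 q%:Z; move: rx; lra.
case: r rb rmin rx qr => [r|r] rb rmin rx qr; last by move: qr; clear; lia.
have th2 : th ^+ q <= 2 * th ^+ (q + N).
  by rewrite exprD; have := thn q; move: thN; nra.
exists r; split.
- by move: nq qr; clear; lia.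
- by move=> j jb; apply: rmin; move: jb rb qr; clear; lia.
- apply: (le_trans (ltW rx)).
  have : th ^+ (q + N) <= th ^+ r by apply: thmono; move: rb; clear; lia.
  by move: qx xp th2; nra.
- move=> m mr; have [mq|mq] := leqP m q; first exact: hq.
  have h : x m%:Z <= L ^+ N * x q%:Z.
    have -> : m%:Z = q%:Z + (m - q)%N%:Z by move: mq; clear; lia.
    by apply: steps; move: mr rb; clear; lia.
  apply: (le_trans h).
  have h2 : th ^+ (q + N) <= th ^+ m by apply: thmono; move: mr rb; clear; lia.
  have -> : 2 * L ^+ N * th ^+ m * x 0 = L ^+ N * (2 * th ^+ m * x 0) by ring.
  rewrite ler_wpM2l ?(le_trans ler01 Ln)//; apply: (le_trans qx).
  by rewrite ler_wpM2r ?(ltW xp)//; move: th2 h2; lra.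
Qed.

End Windows.

(** The position of the minimum over the first window decides the direction; the backward case is
    the forward one for the reflected sequence. *)
Lemma two_sided_decay (R : realType) (x : int -> R) (N : nat) (L : R) (th : R) :
  (forall k, 0 < x k) -> 1 <= L ->
  (forall j, exists k : int, - N%:Z <= k <= N%:Z /\ x (j + k) < x j / 2) ->
  (forall j, x (j + 1) <= L * x j) -> (forall j, x (j - 1) <= L * x j) ->
  0 < th -> th <= 1 -> 1 / 2 <= th ^+ N ->
  (forall n : nat, x n%:Z <= 2 * L ^+ N * th ^+ n * x 0) \/
  (forall n : nat, x (- n%:Z) <= 2 * L ^+ N * th ^+ n * x 0).
Proof.
move=> x0 L1 drop up dn th0 th1 thN.
have [p [pb pm]] := window_argmin x (- N%:Z) (N + N).
have [k [kb]] := drop 0; rewrite add0r => kx.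
have px : x p <= x 0 / 2.
  by apply: (le_trans _ (ltW kx)); apply: pm; lia.
case: (leP 0 p) => [pp|pn].
  left; case: p pb pm px pp => // p pb pm px _.
  apply: (forward_decay x0 L1 drop up th0 th1 thN (p := p)) => //; first by lia.
  by move=> j jb; apply: pm; lia.
right; pose y j := x (- j).
have drop' j : exists k : int, - N%:Z <= k <= N%:Z /\ y (j + k) < y j / 2.
  have [i [ib ix]] := drop (- j); exists (- i); split; first by lia.
  by rewrite /y opprD opprK.
have up' j : y (j + 1) <= L * y j by rewrite /y opprD.
have pz : p = - `|p|%N%:Z by lia.
have y0 : y 0 = x 0 by rewrite /y oppr0.
have := @forward_decay R y N L (fun k => x0 (- k)) L1 drop' up' th th0 th1 thN `|p|%N.
rewrite y0; apply; first by lia.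
  by move=> j jb; rewrite /y -pz; apply: pm; lia.
by rewrite /y -pz.
Qed.

(** * Integer iterates of an invertible map *)

Section IntegerIterates.
Variable X : Type.
Implicit Types f g : X -> X.

Definition zit f g (k : int) : X -> X :=
  match k with Posz n => iter n f | Negz n => iter n.+1 g end.

Lemma zit_succ f g k x : cancel g f -> zit f g (k + 1) x = f (zit f g k x).
Proof.
move=> gf; case: k => [n|[|n]].
- by rewrite -PoszD addn1.
- by rewrite /= gf.
- have -> : Negz n.+1 + 1 = Negz n by lia.
  by rewrite /= gf.
Qed.

Lemma zit_pred f g k x : cancel f g -> zit f g (k - 1) x = g (zit f g k x).
Proof.
move=> fg; case: k => [[|n]|n].
- by [].
- have -> : n.+1%:Z - 1 = n%:Z by lia.
  by rewrite /= fg.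
- by have -> : Negz n - 1 = Negz n.+1 by lia.
Qed.

Lemma zitD f g j k x : cancel f g -> cancel g f ->
  zit f g (j + k) x = zit f g j (zit f g k x).
Proof.
move=> fg gf; elim/int_rect: j => [|n IH|n IH].
- by rewrite add0r.
- have -> : n.+1%:Z + k = n%:Z + k + 1 by lia.
  by rewrite zit_succ// IH -zit_succ//; congr (zit _ _ _ _); lia.
- have -> : - n.+1%:Z + k = - n%:Z + k - 1 by lia.
  by rewrite zit_pred// IH -zit_pred//; congr (zit _ _ _ _); lia.
Qed.

End IntegerIterates.

(** * Uniform forward or backward decay *)

Section Dichotomy.
Variables (R : realType) (A : comUnitAlgType R[i]) (nA : A -> R).
Hypothesis hnA : is_banach_alg_norm nA.
Hypothesis hss : @semisimple R A.
Variables (U V : A -> A) (w : A).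
Hypothesis hU : is_automorphism U.
Hypothesis UV : cancel U V.
Hypothesis VU : cancel V U.
Hypothesis uw : w \is a GRing.unit.
Let T := wT w U.
Let T' := wT (V w^-1) V.

Hypothesis no1 : forall t, ~ type1 U V w t.

(** Compactness: points that are bad up to time [N], one for each [N], have an ultralimit that is
    bad at all times, that is, of type 1. *)
Lemma uniform_window : exists N, forall t, MA t -> exists n, (n <= N)%N /\
  (cabs (t (iter n T 1)) < 1 / 2 \/ cabs (t (iter n T' 1)) < 1 / 2).
Proof.
apply: contrapT => H.
have bad N : exists t, MA t /\ forall n, (n <= N)%N ->
    1 / 2 <= cabs (t (iter n T 1)) /\ 1 / 2 <= cabs (t (iter n T' 1)).
  apply: contrapT => H1; apply: H; exists N => t ht; apply: contrapT => H2.
  apply: H1; exists t; split=> // n nN; split; rewrite leNgt; apply/negP => h; apply: H2;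
    exists n; split=> //; by [left|right].
have [t ht] := choice bad.
have [G [GU Goo]] := nat_free_ultrafilter.
have GF : Filter G := @filter_filter _ _ (@ultra_proper _ _ GU).
have [m [hm mlim]] := char_ulim GU (fun n => proj1 (ht n))
  (fun n f => char_le hnA f (proj1 (ht n))).
apply: (no1 (t := m)); split=> // n; split;
  apply: (ucvg_cabs_ge GU (mlim _)); apply: filterS (Goo n) => k /= nk;
  by have [_ /(_ n nk) []] := ht k.
Qed.

Lemma snorm_wT (W : A -> A) (v : A) f : is_automorphism W ->
  snorm (wT v W f) <= (nA v + 1) * snorm f.
Proof.
move=> hW; apply: (le_trans (snormM hnA hss _ _)).
apply: ler_pM; rewrite ?(snorm_ge0 hnA hss)//.
  by apply: (le_trans (snorm_le_nA hnA hss _)); rewrite lerDl.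
by apply: (snorm_le hnA hss) => t ht; apply: (char_le_snorm hnA hss _ (char_aut hW ht)).
Qed.

Lemma snorm_iter_le (S : A -> A) (tau : R) n f : 0 <= tau ->
  (forall f, snorm (S f) <= tau * snorm f) -> snorm (iter n S f) <= tau ^+ n * snorm f.
Proof. by move=> t0 h; apply: iter_bound. Qed.

Lemma snorm_telescope (S : A -> A) (tau : R) (a : R[i]) n v : linop S -> 1 <= tau ->
  (forall f, snorm (S f) <= tau * snorm f) -> cabs a = 1 ->
  snorm (v - a ^+ n *: iter n S v) <= n%:R * tau ^+ n * snorm (v - a *: S v).
Proof.
move=> lS tau1 bS a1; have s0 f := snorm_ge0 hnA hss f.
have tau0 : 0 <= tau by apply: le_trans tau1.
elim: n => [|n IH].
  by rewrite !mul0r expr0 scale1r subrr (snorm0 hnA hss).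
have -> : v - a ^+ n.+1 *: iter n.+1 S v =
    (v - a ^+ n *: iter n S v) + a ^+ n *: iter n S (v - a *: S v).
  rewrite (linopB (linop_iter n lS)) (linopZ (linop_iter n lS)) scalerBr scalerA -exprSr.
  by rewrite -iterSr; ring.
apply: (le_trans (snormD hnA hss _ _)).
rewrite (snormZ hnA hss) cabsX a1 expr1n mul1r -natr1 !mulrDl mul1r.
apply: lerD.
  apply: (le_trans IH); rewrite ler_wpM2r// ler_wpM2l// exprS ler_peMl// exprn_ge0//.
apply: (le_trans (snorm_iter_le _ _ tau0 bS)); rewrite ler_wpM2r// exprS ler_peMl// exprn_ge0//.
Qed.

(** Where [v] nearly attains its norm, some [T^n] or [T'^n] with [n <= N] has weight below 1/2.
    There [v] and [a^n T^n v] differ by at least a quarter of the norm of [v], while telescoping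
    bounds the difference by [v - a T v]. *)
Lemma snorm_bounded_below : exists M, 1 <= M /\ forall a v, cabs a = 1 ->
  snorm v <= M * snorm (v - a *: T v).
Proof.
have [N hN] := uniform_window.
have hV := aut_inverse hU UV VU.
have n0 x := nA_ge0 hnA x; have s0 f := snorm_ge0 hnA hss f.
pose tau := nA w + nA (V w^-1) + 1.
have tau1 : 1 <= tau by rewrite /tau; have := n0 w; have := n0 (V w^-1); lra.
have tau0 : 0 <= tau by apply: le_trans tau1.
have bT f : snorm (T f) <= tau * snorm f.
  apply: (le_trans (snorm_wT _ _ hU)); rewrite ler_wpM2r// /tau.
  by have := n0 (V w^-1); lra.
have bT' f : snorm (T' f) <= tau * snorm f.
  apply: (le_trans (snorm_wT _ _ hV)); rewrite ler_wpM2r// /tau.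
  by have := n0 w; lra.
(* The last [tau] is for the backward case, whose defect is [T' g] up to a unimodular factor. *)
pose D := N%:R * tau ^+ N * tau.
have D0 : 0 <= D by rewrite !mulr_ge0// exprn_ge0.
exists (4 * D + 1); split; first by lra.
move=> a v a1; set g := v - a *: T v.
have [t [ht tv]] := snorm_near hnA hss v.
have Dle n : (n <= N)%N -> n%:R * tau ^+ n <= N%:R * tau ^+ N.
  by move=> nN; apply: ler_pM; rewrite ?exprn_ge0// ?ler_nat// ler_weXn2l.
suff h : 3 / 4 * snorm v <= 1 / 2 * snorm v + D * snorm g.
  by have := s0 g; move: h; lra.
apply: (le_trans tv).
have main S b n (W : A -> A) (c : A) : linop S -> (forall f, snorm (S f) <= tau * snorm f) ->
    cabs b = 1 -> is_automorphism W -> S = wT c W -> (n <= N)%N ->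
    cabs (t (iter n S 1)) < 1 / 2 -> snorm (v - b *: S v) <= tau * snorm g ->
    cabs (t v) <= 1 / 2 * snorm v + D * snorm g.
  move=> lS bS b1 hW SE nN tn hg.
  have e : t v = t (v - b ^+ n *: iter n S v) + b ^+ n * t (iter n S v).
    by rewrite (charB ht) (charZ ht) subrK.
  rewrite e; apply: (le_trans (cabsD _ _)); rewrite addrC; apply: lerD.
    rewrite cabsM cabsX b1 expr1n mul1r SE (wT_iter _ _ _ hW) (charM ht) cabsM.
    apply: ler_pM; rewrite ?cabs_ge0//; first by rewrite -SE ltW.
    exact: (char_le_snorm hnA hss _ (char_aut (aut_iter n hW) ht)).
  apply: (le_trans (char_le_snorm hnA hss _ ht)).
  apply: (le_trans (snorm_telescope n v lS tau1 bS b1)).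
  have -> : D * snorm g = N%:R * tau ^+ N * (tau * snorm g) by rewrite /D; ring.
  apply: ler_pM => //; last exact: Dle.
  by rewrite mulr_ge0// exprn_ge0.
have [n [nN [tn|tn]]] := hN t ht.
  apply: (main T a n U w) => //; first exact: wT_linop.
  by rewrite ler_peMl.
have an0 : a != 0 by rewrite -cabs_gt0 a1.
apply: (main T' a^-1 n V (V w^-1)) => //; first exact: wT_linop.
  by rewrite cabsV a1 invr1.
have -> : v - a^-1 *: T' v = (- a^-1) *: T' g.
  have lT' : linop T' := wT_linop _ hV.
  have TT' : cancel T T' := wTK hU UV VU uw.
  rewrite /g (linopB lT') (linopZ lT') TT'.
  by rewrite scalerBr scalerA mulNr mulVf// !scaleNr scale1r opprK addrC.
by rewrite (snormZ hnA hss) cabsN cabsV a1 invr1 mul1r.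
Qed.

(** By the cocycle identity, [uniform_window] at the [j]-th orbit point is a halving of
    [|(T^k 1)(t)|] near time [j]. The constants come from the window and from bounds on the weights,
    hence do not depend on [t]. *)
Lemma orbit_decay : exists K th, [/\ 0 <= K, 0 < th, th < 1 &
  forall t, MA t -> (forall n, cabs (t (iter n T 1)) <= K * th ^+ n) \/
                    (forall n, cabs (t (iter n T' 1)) <= K * th ^+ n)].
Proof.
have [N hN] := uniform_window.
have hV := aut_inverse hU UV VU.
have n0 x := nA_ge0 hnA x.
have TT' : cancel T T' := wTK hU UV VU uw.
have T'T : cancel T' T := wTVK hU UV VU uw.
pose L := nA w + nA (V w^-1) + 1.
have L1 : 1 <= L by rewrite /L; have := n0 w; have := n0 (V w^-1); lra.
(* Bernoulli gives [(1 - i)^(N+1) >= 1/2]; [N + 1] in place of [N] keeps the quotient meaningful for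
   [N = 0]. *)
have [i [i0 i1 iN]] : exists i : R, [/\ 0 < i, i <= 1 / 2 & N.+1%:R * i = 1 / 2].
  have N0 : 0 < N.+1%:R :> R by rewrite ltr0n.
  have N1 : 1 <= N.+1%:R :> R by rewrite ler1n.
  exists (2 * N.+1%:R)^-1; split; first by rewrite invr_gt0 mulr_gt0.
    by rewrite -[leLHS]mul1r ler_pdivrMr ?mulr_gt0//; move: N1; lra.
  by rewrite invfM mulrCA divff ?gt_eqF// mulr1 div1r.
pose th : R := 1 - i.
have [th0 th1] : 0 < th /\ th < 1 by rewrite /th; move: i0 i1; split; lra.
have bern (h : R) m : 0 <= h -> h <= 1 -> 1 - m%:R * h <= (1 - h) ^+ m.
  move=> h0 h1; elim: m => [|m IH]; first by rewrite mul0r subr0.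
  rewrite exprS -natr1.
  have h3 : (1 - h) * (1 - m%:R * h) <= (1 - h) * (1 - h) ^+ m by rewrite ler_wpM2l//; lra.
  have : 0 <= m%:R * (h * h) by rewrite !mulr_ge0.
  by move: h3; nra.
have thN : 1 / 2 <= th ^+ N.+1.
  apply: le_trans (bern i N.+1 (ltW i0) _); last by move: i1; lra.
  by rewrite iN; lra.
exists (2 * L ^+ N.+1), th; split=> //.
  by rewrite mulr_ge0// exprn_ge0//; lra.
move=> t ht.
pose cz (k : int) : A := zit T T' k 1.
pose Uz := zit U V.
have Uz_aut k : is_automorphism (Uz k).
  by case: k => n; apply: aut_iter.
have Tz k g : zit T T' k g = cz k * Uz k g.
  by case: k => n; rewrite /cz /zit /T /T' wT_iter.
have czD j k : cz (j + k) = cz j * Uz j (cz k) by rewrite /cz zitD// -Tz.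
pose x (p : @chi R A) (k : int) := cabs (p (cz k)).
have xD j k : x t (j + k) = x t j * x (t \o Uz j) k.
  by rewrite /x czD (charM ht) cabsM.
have xT k : x (t \o Uz k) 0 = 1.
  by rewrite /x /cz /= (aut1 (Uz_aut k)) (char1 ht) cabs1.
have xp k : 0 < x t k.
  rewrite lt_def cabs_ge0 andbT; apply/eqP => h.
  have := xD k (- k); rewrite h mul0r subrr => e.
  by have := xT 0; rewrite /x /= in e *; rewrite e => /eqP; rewrite eq_sym oner_eq0.
have htz k : MA (t \o Uz k) := char_aut (Uz_aut k) ht.
have x1 p : MA p -> x p 1 <= L.
  move=> hp; apply: (le_trans (char_le hnA _ hp)).
  by rewrite /cz /= /T /wT (aut1 hU) mulr1 /L; have := n0 (V w^-1); lra.
have xN1 p : MA p -> x p (-1) <= L.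
  move=> hp; apply: (le_trans (char_le hnA _ hp)).
  by rewrite /cz /= /T' /wT (aut1 hV) mulr1 /L; have := n0 w; lra.
have [] := @two_sided_decay R (x t) N.+1 L th xp L1 _ _ _ th0 (ltW th1) thN.
- move=> j; have [n [nN [h|h]]] := hN _ (htz j).
    exists n%:Z; split; first by lia.
    rewrite xD ltr_pdivlMr// -mulrA -[ltRHS]mulr1 ltr_pM2l//.
    by rewrite -ltr_pdivlMr.
  exists (- n%:Z); split; first by lia.
  rewrite xD ltr_pdivlMr// -mulrA -[ltRHS]mulr1 ltr_pM2l//.
  rewrite -ltr_pdivlMr//; move: h; case: n {nN} => [|n]; first by rewrite oppr0.
  by rewrite -NegzE.
- by move=> j; rewrite xD mulrC; apply: ler_wpM2r; [exact: ltW|exact: x1].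
- by move=> j; rewrite xD mulrC; apply: ler_wpM2r; [exact: ltW|exact: xN1].
- move=> h; left => n; have := h n; rewrite /x /cz /=.
  by rewrite (char1 ht) cabs1 mulr1.
- move=> h; right => n; have := h n; rewrite /x /cz /= (char1 ht) cabs1 mulr1.
  by case: n => [|n]; [rewrite oppr0|rewrite -NegzE].
Qed.

End Dichotomy.

(** * Dense range around the circle and for the powers [T^(2^k)] *)

Section DenseRange.
Variables (R : realType) (A : comUnitAlgType R[i]) (nA : A -> R).
Hypothesis hnA : is_banach_alg_norm nA.
Hypothesis hss : @semisimple R A.
Variables (T : A -> A) (M tau : R).
Hypothesis lT : linop T.
Hypothesis M1 : 1 <= M.
Hypothesis tau1 : 1 <= tau.
Hypothesis bT : forall f, snorm (T f) <= tau * snorm f.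
Hypothesis below : forall a v, cabs a = 1 -> snorm v <= M * snorm (v - a *: T v).

Definition dense_range (a : R[i]) := forall g (e : R), 0 < e ->
  exists v, snorm (v - a *: T v - g) <= e.

(* Completeness is not needed: a residual of half the size suffices, and is iterated. *)
Lemma dense_range_step (a b : R[i]) : cabs a = 1 -> cabs (b - a) * (8 * M * tau) <= 1 ->
  dense_range a -> dense_range b.
Proof.
move=> a1 ab da g e e0.
have s0 f := snorm_ge0 hnA hss f.
(* The residual is at most [1/4 + 5/32 < 1/2] of [f]: the precision asked at [a], plus the change
   from [a] to [b]. *)
have half f : exists v, snorm (f - (v - b *: T v)) <= 2^-1 * snorm f.
  have [/(snorm_eq0 hnA hss) ->|fn0] := eqVneq (snorm f) 0.
    by exists 0; rewrite (linop0 lT) scaler0 !subrr (snorm0 hnA hss) mulr0.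
  have fp : 0 < snorm f by rewrite lt_def fn0 s0.
  have [|v hv] := da f (snorm f / 4); first by rewrite divr_gt0.
  exists v.
  have -> : f - (v - b *: T v) = (b - a) *: T v - (v - a *: T v - f).
    by rewrite scalerBl; ring.
  apply: (le_trans (snorm_subD hnA hss _ _)); rewrite (snormZ hnA hss).
  have h1 : snorm v <= M * (5 / 4 * snorm f).
    apply: (le_trans (below v a1)); rewrite ler_wpM2l ?(le_trans ler01 M1)//.
    have := snormD hnA hss (v - a *: T v - f) f; rewrite subrK; lra.
  have h2 : cabs (b - a) * snorm (T v) <= cabs (b - a) * (tau * (M * (5 / 4 * snorm f))).
    rewrite ler_wpM2l ?cabs_ge0//; apply: (le_trans (bT v)).
    by rewrite ler_wpM2l ?(le_trans ler01 tau1).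
  have h3 : cabs (b - a) * (tau * (M * (5 / 4 * snorm f))) =
      cabs (b - a) * (8 * M * tau) * (5 / 32 * snorm f) by field.
  have h4 : cabs (b - a) * (8 * M * tau) * (5 / 32 * snorm f) <= 5 / 32 * snorm f.
    by rewrite ler_piMl// mulr_ge0//; lra.
  by move: h2 hv; rewrite h3; move: h4 fp; lra.
have it n : exists v, snorm (g - (v - b *: T v)) <= 2^-1 ^+ n * snorm g.
  elim: n => [|n [v hv]].
    by exists 0; rewrite (linop0 lT) scaler0 !subr0 mul1r.
  have [u hu] := half (g - (v - b *: T v)); exists (v + u).
  have -> : g - (v + u - b *: T (v + u)) = g - (v - b *: T v) - (u - b *: T u).
    by rewrite (linopD lT) scalerDr; ring.
  apply: (le_trans hu); rewrite exprS -mulrA; apply: ler_wpM2l => //.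
  by rewrite invr_ge0.
have g1 : 0 < snorm g + 1 by have := s0 g; lra.
have [] := @expr_eventually_small R 2^-1 (e / (snorm g + 1)); try lra.
  by rewrite divr_gt0.
move=> n /(_ n (leqnn n)); rewrite ltr_pdivlMr// => hn.
have [v hv] := it n; exists v; rewrite -(snormN hnA hss) opprB.
apply: (le_trans hv); apply: le_trans (ltW hn).
by rewrite ler_wpM2l ?exprn_ge0//; lra.
Qed.

(** Connectedness of the circle in discrete form: [1] is joined to [a] by powers of some [b] so
    close to 1 that [dense_range_step] applies each time. *)
Lemma dense_range_circle : dense_range 1 -> forall a, cabs a = 1 -> dense_range a.
Proof.
move=> d1 a a1.
have P0 : 0 < 8 * M * tau.
  by rewrite !mulr_gt0// ?(lt_le_trans ltr01 M1) ?(lt_le_trans ltr01 tau1).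
have [b [n [<- b1 bn]]] := unit_circle_root_near1 a1 (divr_gt0 ltr01 P0).
have bX k : cabs (b ^+ k) = 1 by rewrite cabsX b1 expr1n.
elim: n => [|n IH]; first by rewrite expr0.
apply: (dense_range_step (bX n) _ IH).
have -> : b ^+ n.+1 - b ^+ n = b ^+ n * (b - 1) by rewrite exprS; ring.
by rewrite cabsM bX mul1r -ler_pdivlMr// ltW.
Qed.

(* The bound [2 M] does not depend on [k]: the solution for [T^(2^k)] is an average of
   solutions for [T]. *)
Lemma dense_range_2exp : dense_range 1 -> forall k a (e : R), cabs a = 1 -> 0 < e ->
  exists v, snorm (v - a *: iter (2 ^ k) T v - 1) <= e /\ snorm v <= 2 * M.
Proof.
move=> d1; have s0 f := snorm_ge0 hnA hss f.
elim=> [|k IH] a e a1 e0.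
  have [|v hv] := dense_range_circle d1 a1 1 (e := Num.min e 1).
    by rewrite lt_min e0 ltr01.
  move: hv; rewrite le_min => /andP[hv hv1]; exists v; split=> //.
  apply: (le_trans (below v a1)); rewrite mulrC ler_wpM2r ?(le_trans ler01 M1)//.
  have := snormD hnA hss (v - a *: T v - 1) 1; rewrite subrK (snorm1 hnA hss); lra.
have [b [ba b1 _]] := unit_circle_sqrt a1; rewrite -ba.
set L := iter (2 ^ k) T; have lL : linop L by apply: linop_iter.
pose tk := tau ^+ (2 ^ k).
have tk0 : 0 <= tk by rewrite exprn_ge0// (le_trans ler01 tau1).
have bL f : snorm (L f) <= tk * snorm f.
  by apply: iter_bound => //; apply: le_trans tau1.
have tk1 : 0 < 1 + tk by lra.
(* [L] enlarges errors by at most [tk], so precision [d] at [b] and [- b] gives [d (1 + tk) = e] at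
   [b^2]. *)
have d0 : 0 < e / (1 + tk) by rewrite divr_gt0.
set d := e / (1 + tk) in d0.
have de : d * (1 + tk) = e by rewrite divfK// gt_eqF.
have [p [hp pM]] := IH b d b1 d0.
have [m [hm mM]] := IH (- b) d (etrans (cabsN _) b1) d0.
rewrite scaleNr opprK -/L in hm; rewrite -/L in hp.
have halfs (f : A) : snorm ((2^-1 : R[i]) *: f) = snorm f / 2.
  rewrite (snormZ hnA hss) cabsV.
  have -> : cabs (2 : R[i]) = 2 by have := @cabs_real R 2; rewrite rmorph_nat; apply.
  by rewrite mulrC.
exists (2^-1 *: (p + m)); split; last first.
  by rewrite halfs; have := snormD hnA hss p m; lra.
rewrite iter_2exp -/L (average_pm b p m lL).
set yp := p - _ in hp *; set ym := m + _ in hm *.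
have -> : 2^-1 *: (yp + ym + b *: L (yp - ym)) - 1 =
    2^-1 *: ((yp - 1) + (ym - 1) + b *: L ((yp - 1) - (ym - 1))).
  rewrite -[X in _ - X]half_add -scalerBr; congr (_ *: _).
  have -> : yp - 1 - (ym - 1) = yp - ym by ring.
  ring.
rewrite halfs.
have h1 := snormD hnA hss (yp - 1 + (ym - 1)) (b *: L (yp - 1 - (ym - 1))).
have h2 := snormD hnA hss (yp - 1) (ym - 1).
have h3 := snorm_subD hnA hss (yp - 1) (ym - 1).
have h4 := bL (yp - 1 - (ym - 1)).
have h5 : tk * snorm (yp - 1 - (ym - 1)) <= tk * (d + d).
  by rewrite ler_wpM2l//; lra.
rewrite (snormZ hnA hss) b1 mul1r in h1.
by move: h1 h2 h4 h5 hp hm de; lra.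
Qed.

End DenseRange.

(** * From approximate to exact idempotents *)

Section Newton.
Variables (R : realType) (A : comUnitAlgType R[i]) (nA : A -> R).
Hypothesis hnA : is_banach_alg_norm nA.
Hypothesis hss : @semisimple R A.
Hypothesis hreg : @regular R A.
Variable C : R.
Hypothesis C0 : 0 < C.
Hypothesis hC : product_estimate nA C.

(** The product estimate for two factors with [V] the whole space. *)
Lemma nA_mul_snorm f g : nA (f * g) <= C * (nA f * snorm g + nA g * snorm f).
Proof.
have sM := shilov_regular hreg.
have oM : wopen (@shilov R A) (@MA R A).
  by rewrite sM; split=> // c hc; exists [::], 1; split.
pose fs (i : 'I_2) := if i == ord0 then f else g.
have pE : \prod_(i < 2) fs i = f * g by rewrite !big_ord_recl big_ord0 mulr1.
have := hC oM (isT : (0 < 2)%N) (fs := fs); rewrite pE => /(_ _)/le_trans; apply.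
  by move=> t [ht _]; rewrite -sM.
rewrite ler_wpM2l ?(ltW C0)// sM !big_ord_recl big_ord0 addr0 /=.
have n0 x := nA_ge0 hnA x; have s0 x := snorm_ge0 hnA hss x.
by apply: lerD; rewrite ler_wpM2l//; apply: sup_image_le => // t [ht _];
   rewrite big_mkcond !big_ord_recl big_ord0 /= ?mul1r ?mulr1;
   exact: (char_le_snorm hnA hss _ ht).
Qed.

Let Q := C * (14 * C + 3 * nA 1 + 4).
Let Q' := 20 * C + 16 * C ^+ 2 + 1.

(** If [d = f - f^2], this is the defect of [3 f^2 - 2 f^3]. The bound is linear in [nA d] with a
    factor [snorm d], so a small sup norm forces decay in [A]. *)
Lemma newton_defect (d : A) : snorm d <= 1 ->
  nA (d * d * (3 *: 1 + 4 *: d)) <= snorm d * Q * nA d.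
Proof.
move=> d1.
have s0 := snorm_ge0 hnA hss d; have n0 := nA_ge0 hnA d; have n1 := nA_ge0 hnA 1.
have cn (k : nat) : cabs (k%:R : R[i]) = k%:R.
  by have := @cabs_real R k%:R; rewrite rmorph_nat; apply.
have h1 : nA (d * d) <= 2 * C * nA d * snorm d.
  by apply: (le_trans (nA_mul_snorm d d)); rewrite le_eqVlt; apply/orP; left; apply/eqP; ring.
have h2 : snorm (3 *: 1 + 4 *: d) <= 7.
  apply: (le_trans (snormD hnA hss _ _)); rewrite !(snormZ hnA hss) !cn (snorm1 hnA hss); lra.
have h3 : nA (3 *: 1 + 4 *: d) <= 3 * nA 1 + 4 * nA d.
  by apply: (le_trans (nAD hnA _ _)); rewrite !(nAZ hnA) !cn.
have h4 : snorm (d * d) <= snorm d * snorm d by apply: (snormM hnA hss).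
have h5 := snorm_le_nA hnA hss d.
have h6 : nA (d * d) * snorm (3 *: 1 + 4 *: d) <= 2 * C * nA d * snorm d * 7.
  by apply: ler_pM => //; [exact: nA_ge0|exact: (snorm_ge0 hnA hss)].
have h7 : nA (3 *: 1 + 4 *: d) * snorm (d * d) <=
    (3 * nA 1 + 4 * nA d) * (snorm d * snorm d).
  by apply: ler_pM => //; [exact: nA_ge0|exact: (snorm_ge0 hnA hss)].
have h8 : (3 * nA 1 + 4 * nA d) * (snorm d * snorm d) <=
    (3 * nA 1 + 4) * (snorm d * nA d).
  have a1 : nA 1 * (snorm d * snorm d) <= nA 1 * (snorm d * nA d).
    by rewrite ler_wpM2l// ler_wpM2l.
  have a2 : nA d * (snorm d * snorm d) <= snorm d * nA d.
    by rewrite mulrC ler_wpM2r// ler_piMl.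
  by move: a1 a2; lra.
apply: (le_trans (nA_mul_snorm _ _)).
have -> : snorm d * Q * nA d =
    C * (2 * C * nA d * snorm d * 7 + (3 * nA 1 + 4) * (snorm d * nA d)).
  by rewrite /Q; ring.
rewrite ler_wpM2l ?(ltW C0)//; apply: lerD => //; exact: le_trans h7 h8.
Qed.

(** A step multiplies the norm in [A] by a fixed factor at most; the decay rate of the defects is
    tuned to beat it. *)
Lemma newton_growth (f : A) : snorm f <= 2 ->
  nA (3 *: (f * f) - 2 *: (f * f * f)) <= Q' * nA f.
Proof.
move=> f2.
have s0 := snorm_ge0 hnA hss f; have n0 := nA_ge0 hnA f.
have cn (k : nat) : cabs (k%:R : R[i]) = k%:R.
  by have := @cabs_real R k%:R; rewrite rmorph_nat; apply.
have h1 : nA (f * f) <= 4 * C * nA f.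
  apply: (le_trans (nA_mul_snorm f f)).
  have -> : C * (nA f * snorm f + nA f * snorm f) = snorm f * (2 * C * nA f) by ring.
  have -> : 4 * C * nA f = 2 * (2 * C * nA f) by ring.
  by rewrite ler_wpM2r// !mulr_ge0// ltW.
have h2 : snorm (f * f) <= 4.
  apply: (le_trans (snormM hnA hss f f)); nra.
have h3 : nA (f * f * f) <= C * (8 * C + 4) * nA f.
  apply: (le_trans (nA_mul_snorm _ f)); rewrite -mulrA ler_wpM2l ?(ltW C0)//.
  have a1 : nA (f * f) * snorm f <= 4 * C * nA f * 2.
    by apply: ler_pM => //; exact: nA_ge0.
  have a2 : nA f * snorm (f * f) <= nA f * 4 by rewrite ler_wpM2l.
  by move: a1 a2; lra.
apply: (le_trans (nA_subD hnA _ _)); rewrite !(nAZ hnA) !cn /Q'.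
by move: h1 h3 n0; lra.
Qed.

Lemma newton_poly_near0 (z : R[i]) (e : R) : cabs z <= e -> e <= 1 / 8 ->
  cabs (3 * (z * z) - 2 * (z * z * z)) <= e / 2.
Proof.
move=> ze e8; have z0 := cabs_ge0 z.
have -> : 3 * (z * z) - 2 * (z * z * z) = z * (z * (3 - 2 * z)) by ring.
have c2 : cabs (2 : R[i]) = 2 by have := @cabs_real R 2; rewrite rmorph_nat; apply.
have c3 : cabs (3 : R[i]) = 3 by have := @cabs_real R 3; rewrite rmorph_nat; apply.
have h : cabs (3 - 2 * z) <= 4.
  by apply: (le_trans (cabs_subD _ _)); rewrite cabsM c2 c3; lra.
have h0 := cabs_ge0 (3 - 2 * z).
have h' : cabs z * cabs (3 - 2 * z) <= 1 / 2 by nra.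
by rewrite !cabsM; nra.
Qed.

(* Newton's iteration [f -> 3 f^2 - 2 f^3]; the product estimate turns smallness of
   [f - f^2] in the sup norm into convergence in the norm of [A]. *)
Lemma exact_idempotent (P : @chi R A -> Prop) :
  (forall eta : R, 0 < eta -> exists f : A, forall t, MA t ->
     (P t -> cabs (t f - 1) <= eta) /\ (~ P t -> cabs (t f) <= eta)) ->
  exists e : A, forall t, MA t -> (P t -> t e = 1) /\ (~ P t -> t e = 0).
Proof.
move=> approx.
have n1 := nA_ge0 hnA 1.
have Q0 : 0 < Q by rewrite mulr_gt0//; move: C0; lra.
have Q'1 : 1 <= Q' by rewrite /Q'; move: C0 (sqr_ge0 C); lra.
(* The increments [d_k (2 f_k - 1)] are then of order [rho^k Q'^k = 2^-k]. *)
pose rho := (2 * Q')^-1.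
have rho0 : 0 < rho by rewrite invr_gt0; lra.
have rhoQ : rho * Q' = 2^-1.
  by rewrite /rho invfM -mulrA mulVf ?mulr1// gt_eqF//; lra.
(* As [snorm (d k) <= 2 eta], the second bound makes the defects decay at rate [rho]; 1/8 lets the
   sup-norm error halve at each step. *)
pose eta := Num.min (1 / 8) (rho / (2 * Q)).
have eta8 : eta <= 1 / 8 by rewrite /eta ge_min lexx.
have etaQ : 2 * eta * Q <= rho.
  have : eta <= rho / (2 * Q) by rewrite /eta ge_min lexx orbT.
  by rewrite ler_pdivlMr; [lra|rewrite mulr_gt0].
have eta0 : 0 < eta.
  rewrite /eta lt_min; apply/andP; split; first by lra.
  by rewrite divr_gt0// mulr_gt0.
have [f0 hf0] := approx eta eta0.
pose nw (f : A) : A := 3 *: (f * f) - 2 *: (f * f * f).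
pose f k := iter k nw f0; pose d k := f k - f k * f k.
have fS k : f k.+1 = nw (f k) by [].
have dS k : d k.+1 = d k * d k * (3 *: 1 + 4 *: d k).
  by rewrite /d fS /nw !scaler_nat; ring.
have fdiff k : f k.+1 - f k = d k * (2 *: f k - 1).
  by rewrite /d fS /nw !scaler_nat; ring.
have tn t : MA t -> forall x, t (nw x) = 3 * (t x * t x) - 2 * (t x * t x * t x).
  by move=> ht x; rewrite /nw (charB ht) !(charZ ht) !(charM ht).
have inv k t : MA t -> (P t -> cabs (t (f k) - 1) <= eta * 2^-1 ^+ k) /\
    (~ P t -> cabs (t (f k)) <= eta * 2^-1 ^+ k).
  move=> ht; elim: k => [|k [IH1 IH2]]; first by rewrite mulr1; apply: hf0.
  have e8 : eta * 2^-1 ^+ k <= 1 / 8.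
    apply: le_trans eta8; rewrite ler_piMr ?(ltW eta0)// exprn_ile1//; lra.
  have hh : eta * 2^-1 ^+ k.+1 = eta * 2^-1 ^+ k / 2 by rewrite exprSr mulrA.
  rewrite hh fS (tn t ht); split=> [/IH1|/IH2] h; last exact: newton_poly_near0.
  (* [3 z^2 - 2 z^3] commutes with [z -> 1 - z], so the estimate near 1 is the one near 0. *)
  have -> : 3 * (t (f k) * t (f k)) - 2 * (t (f k) * t (f k) * t (f k)) - 1 =
    - (3 * ((1 - t (f k)) * (1 - t (f k))) -
       2 * ((1 - t (f k)) * (1 - t (f k)) * (1 - t (f k)))) by ring.
  by rewrite cabsN; apply: newton_poly_near0 => //; rewrite cabsB.
have inv' k t : MA t -> cabs (t (f k) - 1) <= eta \/ cabs (t (f k)) <= eta.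
  move=> ht; have [h1 h2] := inv k t ht.
  have e : eta * 2^-1 ^+ k <= eta.
    rewrite ler_piMr ?(ltW eta0)// exprn_ile1//; lra.
  by have [/h1 h|/h2 h] := pselect (P t); [left|right]; apply: le_trans h e.
have sf k : snorm (f k) <= 2.
  apply: (snorm_le hnA hss) => t ht; have [h|h] := inv' k t ht; last by lra.
  have := cabsD (t (f k) - 1) 1; rewrite subrK cabs1; lra.
have sd k : snorm (d k) <= 2 * eta.
  apply: (snorm_le hnA hss) => t ht; rewrite /d (charB ht) (charM ht).
  set z := t (f k).
  have -> : z - z * z = z * (1 - z) by ring.
  rewrite cabsM; have := cabs_ge0 z; have := cabs_ge0 (1 - z).
  have [h|h] := inv' k t ht; rewrite -/z in h.
    rewrite cabsB; have := cabsD (z - 1) 1; rewrite subrK cabs1.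
    by move: h eta8; nra.
  have := cabs_subD 1 z; rewrite cabs1.
  by move: h eta8; nra.
have dn k : nA (d k) <= rho ^+ k * nA (d 0%N).
  elim: k => [|k IH]; first by rewrite mul1r.
  rewrite dS; apply: (le_trans (newton_defect _)).
    by apply: (le_trans (sd k)); lra.
  have h : snorm (d k) * Q <= rho.
    by apply: le_trans etaQ; rewrite ler_wpM2r ?(ltW Q0).
  rewrite exprS -[rho * _ * _]mulrA; apply: ler_pM => //; last exact: (nA_ge0 hnA).
  by rewrite mulr_ge0 ?(snorm_ge0 hnA hss) ?(ltW Q0).
have fn k : nA (f k) <= Q' ^+ k * nA f0.
  elim: k => [|k IH]; first by rewrite mul1r.
  rewrite fS; apply: (le_trans (newton_growth (sf k))).
  by rewrite exprS -mulrA ler_wpM2l//; lra.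
pose B := nA (d 0%N) * (2 * nA f0 + nA 1).
have ak k : nA (f k.+1 - f k) <= B * 2^-1 ^+ k.
  rewrite fdiff; apply: (le_trans (nAM hnA _ _)).
  have h1 : nA (2 *: f k - 1) <= Q' ^+ k * (2 * nA f0 + nA 1).
    apply: (le_trans (nA_subD hnA _ _)); rewrite (nAZ hnA).
    have -> : cabs (2 : R[i]) = 2 by have := @cabs_real R 2; rewrite rmorph_nat; apply.
    have : nA 1 <= Q' ^+ k * nA 1 by rewrite ler_peMl// exprn_ege1.
    by have := fn k; lra.
  apply: (@le_trans _ _ ((rho ^+ k * nA (d 0%N)) * (Q' ^+ k * (2 * nA f0 + nA 1)))).
    by apply: ler_pM; rewrite ?(nA_ge0 hnA).
  by rewrite -rhoQ exprMn /B le_eqVlt; apply/orP; left; apply/eqP; ring.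
have [l hl] : exists l, forall n, nA (l - \sum_(k < n) (f k.+1 - f k)) <=
    B * 2^-1 ^+ n / (1 - 2^-1).
  by apply: (@series_cvg _ _ _ hnA (fun k => f k.+1 - f k)) => //; lra.
have sumf n : \sum_(k < n) (f k.+1 - f k) = f n - f0.
  elim: n => [|n IH]; first by rewrite big_ord0 subrr.
  by rewrite big_ord_recr IH /=; ring.
have B0 : 0 <= B by rewrite mulr_ge0 ?(nA_ge0 hnA)// addr_ge0 ?mulr_ge0 ?(nA_ge0 hnA).
have lim n : nA (f0 + l - f n) <= 2 * B * 2^-1 ^+ n.
  have := hl n; rewrite sumf.
  have -> : f0 + l - f n = l - (f n - f0) by ring.
  have -> : 1 - 2^-1 = 2^-1 :> R by lra.
  by rewrite invrK; set q := 2^-1 ^+ n; lra.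
exists (f0 + l) => t ht.
have fin (c : R[i]) : (forall n, cabs (t (f n) - c) <= eta * 2^-1 ^+ n) -> t (f0 + l) = c.
  move=> h; apply/eqP; rewrite -subr_eq0 -cabs_eq0 eq_le cabs_ge0 andbT.
  apply/ler_addgt0Pr => e e0; rewrite add0r.
  have D0 : 0 < 2 * B + eta by lra.
  have [] := @expr_eventually_small R 2^-1 (e / (2 * B + eta)); try lra.
    by rewrite divr_gt0.
  move=> n /(_ n (leqnn n)); rewrite ltr_pdivlMr// => hn.
  have h1 : cabs (t (f0 + l) - t (f n)) <= 2 * B * 2^-1 ^+ n.
    by rewrite -(charB ht); apply: le_trans (lim n); apply: char_le.
  have h2 := h n.
  have := cabsD (t (f0 + l) - t (f n)) (t (f n) - c); rewrite addrA subrK.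
  by move: h1 h2 hn; set q := 2^-1 ^+ n; lra.
split=> [Pt|nPt]; apply: fin => n; first by have [h _] := inv n t ht; apply: h.
by rewrite subr0; have [_ h] := inv n t ht; apply: h.
Qed.

End Newton.

(** * The spectral idempotent and surjectivity of [1 - T] *)

Section Invertibility.
Variables (R : realType) (A : comUnitAlgType R[i]) (nA : A -> R).
Hypothesis hnA : is_banach_alg_norm nA.
Hypothesis hss : @semisimple R A.
Hypothesis hreg : @regular R A.
Variable C : R.
Hypothesis C0 : 0 < C.
Hypothesis hC : product_estimate nA C.
Variables (U V : A -> A) (w : A).
Hypothesis hU : is_automorphism U.
Hypothesis UV : cancel U V.
Hypothesis VU : cancel V U.
Hypothesis uw : w \is a GRing.unit.
Hypothesis gU : subexp nA U.
Hypothesis gV : subexp nA V.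
Let T := wT w U.
Let T' := wT (V w^-1) V.
Hypothesis no1 : forall t, ~ type1 U V w t.
Hypothesis dense : dense_range T 1.

Let hV : is_automorphism V := aut_inverse hU UV VU.
Let lT : linop T := wT_linop w hU.
Let lT' : linop T' := wT_linop (V w^-1) hV.
Let TT' : cancel T T' := wTK hU UV VU uw.
Let T'T : cancel T' T := wTVK hU UV VU uw.

Let fwd (B th : R) (t : @chi R A) := forall n, cabs (t (iter n T 1)) <= B * th ^+ n.
Let bwd (B th : R) (t : @chi R A) := forall n, cabs (t (iter n T' 1)) <= B * th ^+ n.

(* [v = (1 - T^n)^-1 1] is close to 1 where [T^n 1] is small, and to 0 where [T^-n 1] is. *)
Lemma approx_idempotent (B th eta : R) : 0 <= B -> 0 < th -> th < 1 -> 0 < eta ->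
  exists f : A, forall t, MA t ->
    (fwd B th t -> cabs (t f - 1) <= eta) /\ (bwd B th t -> cabs (t f) <= eta).
Proof.
move=> B0 th0 th1 eta0.
have [M [M1 below]] := snorm_bounded_below hnA hss hU UV VU uw no1.
have tau1 : 1 <= nA w + 1 by rewrite lerDr nA_ge0.
have bT f : snorm (T f) <= (nA w + 1) * snorm f by apply: snorm_wT.
pose D := B * (2 * M + 2).
have D0 : 0 <= D by rewrite mulr_ge0//; lra.
have [] := @expr_eventually_small R th (eta / (2 * (D + 1))) (ltW th0) th1.
  by rewrite divr_gt0//; lra.
move=> k /(_ (2 ^ k)%N (ltnW (ltn_expl _ (ltnSn 1)))); set n := (2 ^ k)%N => hn.
rewrite ltr_pdivlMr in hn; last by lra.
pose e := Num.min (eta / 2) 1.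
have e0 : 0 < e by rewrite lt_min ltr01 divr_gt0.
have [v [hv vM]] := dense_range_2exp hnA hss lT M1 tau1 bT below dense k (cabs1 R) e0.
rewrite scale1r -/n in hv.
have [he1 he2] : e <= eta / 2 /\ e <= 1 by rewrite /e !ge_min !lexx orbT.
have thn : 0 <= th ^+ n by rewrite exprn_ge0// ltW.
have Bth : B * th ^+ n * (2 * M + 2) <= eta / 2.
  have -> : B * th ^+ n * (2 * M + 2) = th ^+ n * D by rewrite /D; ring.
  by move: hn thn; lra.
have vs s : MA s -> cabs (s v) <= 2 * M.
  by move=> hs; apply: le_trans vM; apply: (char_le_snorm hnA hss _ hs).
have hs s : MA s -> cabs (s v - s (iter n T 1) * s (iter n U v) - 1) <= e.
  move=> hs; apply: le_trans hv; rewrite -(charM hs) -(wT_iter _ _ _ hU) -(char1 hs).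
  by rewrite -!(charB hs); apply: (char_le_snorm hnA hss _ hs).
exists v => t ht; split=> ft.
  have h1 := hs t ht; have h2 := vs _ (char_aut (aut_iter n hU) ht); rewrite /= in h2.
  have h3 : cabs (t (iter n T 1) * t (iter n U v)) <= B * th ^+ n * (2 * M + 2).
    rewrite cabsM; apply: ler_pM; [exact: cabs_ge0|exact: cabs_ge0|exact: (ft n)|].
    by apply: (le_trans h2); lra.
  have := cabsD (t v - t (iter n T 1) * t (iter n U v) - 1) (t (iter n T 1) * t (iter n U v)).
  have -> : t v - t (iter n T 1) * t (iter n U v) - 1 + t (iter n T 1) * t (iter n U v) =
    t v - 1 by ring.
  by lra.
(* Backward case: the equation is read at [t \o iter n V], where [t v] carries the large coefficient
   [b = 1 / a], and is solved for [t v]. *)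
have hVn := char_aut (aut_iter n hV) ht.
have h1 := hs _ hVn; have h2 := vs _ hVn; rewrite /= in h1 h2.
rewrite (cancel_iter n UV) in h1.
have e1 : t (iter n T' 1) * t (iter n V (iter n T 1)) = 1.
  by rewrite -(charM ht) -(wT_iter _ _ _ hV) (cancel_iter n TT') (char1 ht).
set a := t (iter n T' 1) in e1; set b := t (iter n V (iter n T 1)) in e1 h1.
set s := t (iter n V v) in h1 h2.
have -> : t v = a * (s - 1 - (s - b * t v - 1)) by rewrite -[LHS]mul1r -e1; ring.
rewrite cabsM.
have h4 : cabs (s - 1 - (s - b * t v - 1)) <= 2 * M + 2.
  apply: (le_trans (cabs_subD _ _)); have := cabs_subD s 1; rewrite cabs1.
  by move: h1 h2 he2; lra.
apply: (@le_trans _ _ (B * th ^+ n * (2 * M + 2))); last by lra.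
by apply: ler_pM; [exact: cabs_ge0|exact: cabs_ge0|exact: (ft n)|].
Qed.

Lemma no_two_sided_decay (B th : R) t : 0 <= B -> 0 < th -> th < 1 -> MA t ->
  fwd B th t -> bwd B th t -> False.
Proof.
move=> B0 th0 th1 ht ft bt.
have e0 : 0 < 1 / 4 :> R by lra.
have [f /(_ t ht)[/(_ ft) h1 /(_ bt) h2]] := approx_idempotent B0 th0 th1 e0.
have := cabs_subD (t f) (t f - 1).
have -> : t f - (t f - 1) = 1 by ring.
rewrite cabs1; lra.
Qed.

(** [U e = e] because one step along the orbit changes the weights by a bounded factor: a point and
    its image in different classes would give decay in both directions. *)
Lemma spectral_idempotent : exists e K th, [/\ 0 <= K, 0 < th, th < 1, U e = e &
  forall t, MA t -> (t e = 1 /\ fwd K th t) \/ (t e = 0 /\ bwd K th t)].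
Proof.
have [K [th [K0 th0 th1 dec]]] := orbit_decay hnA hU UV VU uw no1.
have [|e he] := @exact_idempotent _ _ _ hnA hss hreg _ C0 hC (fwd K th).
  move=> eta eta0; have [f hf] := approx_idempotent K0 th0 th1 eta0.
  exists f => t ht; have [h1 h2] := hf t ht; split=> // nf.
  by apply: h2; have [] := dec t ht.
exists e, K, th; split=> //; last first.
  move=> t ht; have [h1 h2] := he t ht; have [ft|nf] := pselect (fwd K th t).
    by left; split=> //; apply: h1.
  by right; split; [apply: h2|have [] := dec t ht].
have n0 x := nA_ge0 hnA x.
(* Shifting by one step costs a factor [|w|] and possibly one power of [th]; the 1 covers
   [n = 0]. *)
pose B := 1 + K * (nA w + 1) / th.
have thV : 1 <= th^-1 by rewrite invf_ge1// ltW.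
have KB0 : 0 <= K * (nA w + 1) by rewrite mulr_ge0// addr_ge0.
have KB1 : K * (nA w + 1) <= K * (nA w + 1) / th by rewrite ler_peMr.
have B0 : 0 <= B by rewrite /B; lra.
have KB : K <= B.
  have : K <= K * (nA w + 1) by rewrite ler_peMr// lerDr.
  by rewrite /B; lra.
have thn m : 0 <= th ^+ m by rewrite exprn_ge0// ltW.
apply/eqP; rewrite -subr_eq0; apply/eqP; apply: hss => t ht; rewrite (charB ht).
have htU := char_aut hU ht; apply/eqP; rewrite subr_eq0; apply/eqP.
have [h1 h2] := he t ht; have [h1' h2'] := he _ htU; rewrite /= in h1' h2'.
have [ft|nf] := pselect (fwd K th t); have [ft'|nf'] := pselect (fwd K th (t \o U)).
- by rewrite h1// h1'.
- have bt' : bwd K th (t \o U) by have [] := dec _ htU.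
  exfalso; apply: (@no_two_sided_decay B th t) => // n.
    by apply: (le_trans (ft n)); rewrite ler_wpM2r.
  have := bt' n.+1; rewrite /= /T' {1}/wT (autM hU) !VU -/T' (charM ht) cabsM => h.
  have tw := congr1 (@cabs R) (char_unit ht uw); rewrite cabsM cabs1 in tw.
  have h3 : cabs (t (iter n T' 1)) <= cabs (t w) * (K * th ^+ n.+1).
    have -> : cabs (t (iter n T' 1)) = cabs (t w) * (cabs (t w^-1) * cabs (t (iter n T' 1))).
      by rewrite mulrA tw mul1r.
    by rewrite ler_wpM2l ?cabs_ge0.
  apply: (le_trans h3).
  apply: (@le_trans _ _ ((nA w + 1) * (K * th ^+ n))).
    apply: ler_pM; rewrite ?cabs_ge0 ?mulr_ge0//.
      by apply: (le_trans (char_le hnA w ht)); rewrite lerDl.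
    by rewrite ler_wpM2l// exprS ler_piMl// ltW.
  rewrite mulrA ler_wpM2r// /B mulrC; lra.
- have bt : bwd K th t by have [] := dec t ht.
  exfalso; apply: (@no_two_sided_decay B th t) => // n; last first.
    by apply: (le_trans (bt n)); rewrite ler_wpM2r.
  case: n => [|n]; first by rewrite /= (char1 ht) cabs1 mulr1 /B; lra.
  rewrite /= /T {1}/wT -/T (charM ht) cabsM.
  have h := ft' n; rewrite /= in h.
  apply: (@le_trans _ _ ((nA w + 1) * (K * th ^+ n))).
    apply: ler_pM; rewrite ?cabs_ge0//.
    by apply: (le_trans (char_le hnA w ht)); rewrite lerDl.
  have -> : (nA w + 1) * (K * th ^+ n) = K * (nA w + 1) / th * th ^+ n.+1.
    by rewrite exprS; field; rewrite gt_eqF.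
  by rewrite ler_wpM2r// /B lerDr.
- by rewrite h2// h2'.
Qed.

(** Where [e = 1] the weight is at most [K th^n]; [weight_growth] carries this over to the norm of
    [A] up to [s^n], the power of the automorphism costs another [s^n], and [s] is chosen with
    [s^2 th < 1]. *)
Lemma small_corner (X : A -> A) (c e : A) (K th : R) : is_automorphism X ->
  c \is a GRing.unit -> subexp nA X -> 0 <= K -> 0 < th -> th < 1 ->
  (forall t, MA t -> t e = 0 \/
     (t e = 1 /\ forall n, cabs (t (iter n (wT c X) 1)) <= K * th ^+ n)) ->
  exists N, forall n, (N <= n)%N -> forall x, nA (e * iter n (wT c X) x) <= 4^-1 * nA x.
Proof.
move=> hX uc gX K0 th0 th1 he.
have n0 x := nA_ge0 hnA x.
pose s := 1 + (1 - th) / 4.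
have s1 : 1 < s by rewrite /s; lra.
have [K1 [K10 hK1]] := weight_growth hnA hreg C0 hC hX uc gX s1.
have [K2 [K20 hK2]] := gX s s1.
pose q := s * s * th.
have q0 : 0 <= q by rewrite !mulr_ge0//; lra.
have q1 : q < 1 by rewrite /q /s; nra.
pose D := K1 * (K + 1) * nA e * K2.
have D0 : 0 <= D by rewrite !mulr_ge0//; lra.
have [] := @expr_eventually_small R q (1 / (4 * (D + 1))) q0 q1.
  by rewrite divr_gt0//; lra.
move=> N hN; exists N => n /hN; rewrite ltr_pdivlMr; last by lra.
move=> hn x; rewrite (wT_iter _ _ _ hX) mulrCA.
have thn : 0 < th ^+ n by rewrite exprn_gt0.
have B0 : 0 <= (K + 1) * th ^+ n by rewrite mulr_ge0 ?(ltW thn)//; lra.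
have sn : 0 <= s ^+ n by rewrite exprn_ge0//; lra.
apply: (le_trans (hK1 n (e * iter n X x) _ B0 _)).
  (* The closed set [e = 1], written as a ball of radius 0 whose centre is the constant function
     1. *)
  apply: (subset_trans (supp_sub (E := [set t | MA t /\ forall f, f \in [:: e] ->
    cabs (t f - (fun=> 1) f) <= 0]) hreg _ _)).
  - exact: (wclosed_ball (fun=> 1)).
  - move=> t ht; rewrite (charM ht) => h; split=> // f; rewrite inE => /eqP->.
    have [te|[-> _]] := he t ht; last by rewrite subrr cabs0.
    by case: h; rewrite te mul0r.
  - move=> t [ht /(_ e (mem_head _ _)) te]; split=> //.
    have [te0|[_ /(_ n) h]] := he t ht.
      by move: te; rewrite te0 sub0r cabsN cabs1 ler10.
    by apply: (le_lt_trans h); rewrite ltr_pM2r//; lra.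
have h1 : nA (e * iter n X x) <= nA e * (K2 * s ^+ n * nA x).
  by apply: (le_trans (nAM hnA _ _)); rewrite ler_wpM2l.
apply: (@le_trans _ _ (K1 * s ^+ n * ((K + 1) * th ^+ n * (nA e * (K2 * s ^+ n * nA x))))).
  by rewrite ler_wpM2l ?mulr_ge0// ler_wpM2l.
have -> : K1 * s ^+ n * ((K + 1) * th ^+ n * (nA e * (K2 * s ^+ n * nA x))) =
    q ^+ n * D * nA x by rewrite /q /D !exprMn; ring.
rewrite ler_wpM2r//.
have : 0 <= q ^+ n by rewrite exprn_ge0.
by move: hn; lra.
Qed.

(** [P] is a truncated geometric series, in [T] on the range of [e] and in [T^-1] on that of
    [1 - e]. As [e] commutes with [T], [(1 - T) P = 1 - E], and the Neumann series inverts
    [1 - E]. *)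
Lemma one_minus_T_onto : (exists KU, forall x, nA (U x) <= KU * nA x) ->
  (exists KV, forall x, nA (V x) <= KV * nA x) ->
  exists K, forall y, exists v, v - T v = y /\ nA v <= K * nA y.
Proof.
move=> [KU hKU] [KV hKV].
have [e [K [th [K0 th0 th1 Ue he]]]] := spectral_idempotent.
have uw' : V w^-1 \is a GRing.unit by apply: unit_aut => //; rewrite unitrV.
have [N1 h1] := @small_corner U w e K th hU uw gU K0 th0 th1
  (fun t ht => match he t ht with or_introl p => or_intror p
                                | or_intror p => or_introl (proj1 p) end).
have [N2 h2] : exists N, forall n, (N <= n)%N -> forall x,
    nA ((1 - e) * iter n T' x) <= 4^-1 * nA x.
  apply: (@small_corner V (V w^-1) (1 - e) K th) => //.
  move=> t ht; rewrite (charB ht) (char1 ht).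
  have [[-> _]|[-> h]] := he t ht; [left|right]; first by rewrite subrr.
  by rewrite subr0.
pose m := maxn N1 N2.
pose E x := e * iter m T x + (1 - e) * iter m T' x.
have lE : linop E.
  move=> a x y; rewrite /E (linop_iter m lT) (linop_iter m lT') !mulrDr -!scalerAr scalerDr.
  ring.
have bE x : nA (E x) <= 2^-1 * nA x.
  have := h1 m (leq_maxl _ _) x; have := h2 m (leq_maxr _ _) x.
  by have := nAD hnA (e * iter m T x) ((1 - e) * iter m T' x); rewrite -/(E x); lra.
have Te x : T (e * x) = e * T x by rewrite /T /wT (autM hU) Ue mulrCA.
have T1e x : T ((1 - e) * x) = (1 - e) * T x.
  by rewrite !mulrBl !mul1r (linopB lT) Te.
pose S1 x := \sum_(k < m) iter k T x; pose S2 x := \sum_(k < m) iter k.+1 T' x.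
pose P x := e * S1 x - (1 - e) * S2 x.
have tele1 x : S1 x - T (S1 x) = x - iter m T x.
  rewrite /S1; elim: (m) => [|k IH]; first by rewrite big_ord0 (linop0 lT) /= !subrr.
  rewrite big_ord_recr /= (linopD lT) opprD addrACA IH; ring.
have tele2 x : T (S2 x) - S2 x = x - iter m T' x.
  rewrite /S2; elim: (m) => [|k IH]; first by rewrite big_ord0 (linop0 lT) /= !subrr.
  rewrite big_ord_recr /= (linopD lT) opprD addrACA IH T'T; ring.
have PE x : P x - T (P x) = x - E x.
  rewrite /P (linopB lT) Te T1e /E.
  have -> : e * S1 x - (1 - e) * S2 x - (e * T (S1 x) - (1 - e) * T (S2 x)) =
    e * (S1 x - T (S1 x)) + (1 - e) * (T (S2 x) - S2 x) by ring.
  by rewrite tele1 tele2; ring.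
have n0 x := nA_ge0 hnA x.
pose tau := nA w * `|KU| + nA (V w^-1) * `|KV|.
have tau0 : 0 <= tau by rewrite addr_ge0 ?mulr_ge0.
have bT x : nA (T x) <= tau * nA x.
  apply: (le_trans (nAM hnA _ _)); apply: (@le_trans _ _ (nA w * (`|KU| * nA x))).
    by rewrite ler_wpM2l//; apply: (le_trans (hKU x)); rewrite ler_wpM2r// ler_norm.
  by rewrite mulrA ler_wpM2r// /tau lerDl mulr_ge0.
have bT' x : nA (T' x) <= tau * nA x.
  apply: (le_trans (nAM hnA _ _)); apply: (@le_trans _ _ (nA (V w^-1) * (`|KV| * nA x))).
    by rewrite ler_wpM2l//; apply: (le_trans (hKV x)); rewrite ler_wpM2r// ler_norm.
  by rewrite mulrA ler_wpM2r// /tau lerDr mulr_ge0.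
have bsum (S : A -> A) (j : nat) x : (forall x, nA (S x) <= tau * nA x) ->
    nA (\sum_(k < m) iter (k + j) S x) <= (\sum_(k < m) tau ^+ (k + j)) * nA x.
  move=> bS; elim: (m) => [|k IH]; first by rewrite !big_ord0 (nA0 hnA) mul0r.
  rewrite !big_ord_recr /= mulrDl; apply: (le_trans (nAD hnA _ _)).
  by apply: lerD => //; apply: iter_bound.
pose KP := nA e * (\sum_(k < m) tau ^+ (k + 0)) + nA (1 - e) * (\sum_(k < m) tau ^+ (k + 1)).
have KP0 : 0 <= KP.
  by rewrite addr_ge0 ?mulr_ge0// sumr_ge0// => i _; rewrite exprn_ge0.
have bP x : nA (P x) <= KP * nA x.
  apply: (le_trans (nA_subD hnA _ _)); rewrite /KP [leRHS]mulrDl.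
  rewrite -[X in _ <= X + _]mulrA -[X in _ <= _ + X]mulrA.
  apply: lerD.
    apply: (le_trans (nAM hnA _ _)); rewrite ler_wpM2l//.
    have -> : S1 x = \sum_(k < m) iter (k + 0) T x.
      by apply: eq_bigr => k _; rewrite addn0.
    exact: bsum.
  apply: (le_trans (nAM hnA _ _)); rewrite ler_wpM2l//.
  have -> : S2 x = \sum_(k < m) iter (k + 1) T' x.
    by apply: eq_bigr => k _; rewrite addn1.
  exact: bsum.
exists (KP / (1 - 2^-1)) => y.
have h20 : 0 <= 2^-1 :> R by rewrite invr_ge0.
have h21 : 2^-1 < 1 :> R by lra.
have [x [hx xy]] := neumann hnA lE h20 h21 bE y.
exists (P x); split; first by rewrite PE.
by apply: (le_trans (bP x)); rewrite -mulrA ler_wpM2l// mulrC.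
Qed.

End Invertibility.

(** * Resolvents of [T] and of the check operator *)

Section Resolvents.
Variables (R : realType) (A : comUnitAlgType R[i]) (nA : A -> R).
Hypothesis hnA : is_banach_alg_norm nA.
Hypothesis hss : @semisimple R A.
Hypothesis hreg : @regular R A.

(** The lower bound turns any choice of preimages into a bounded two-sided inverse. *)
Lemma op_resolventP (S : A -> A) (l : R[i]) : linop S -> ~ op_spectrum nA S l <->
  (exists K, forall x, nA x <= K * nA (S x - l *: x)) /\ forall y, exists x, S x - l *: x = y.
Proof.
move=> lS; split.
  move=> /contrapT[S0 [[K hK] h1 h2]]; split; last by move=> y; exists (S0 y).
  by exists K => x; rewrite -{1}(h1 x).
move=> [[K hK] sur]; apply; have [S0 hS0] := choice sur.
exists S0; split=> //.
  by exists K => x; have := hK (S0 x); rewrite hS0.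
move=> x; apply/eqP; rewrite -subr_eq0; apply/eqP; apply: (nA_eq0 hnA).
apply/eqP; rewrite eq_le (nA_ge0 hnA) andbT.
have := hK (S0 (S x - l *: x) - x); rewrite (linopB lS) scalerBr.
have -> : S (S0 (S x - l *: x)) - S x - (l *: S0 (S x - l *: x) - l *: x) =
    (S (S0 (S x - l *: x)) - l *: S0 (S x - l *: x)) - (S x - l *: x) by ring.
by rewrite hS0 subrr (nA0 hnA) mulr0.
Qed.

Section CheckOperator.
Variables (U : A -> A) (w : A) (l : R[i]).
Hypothesis hU : is_automorphism U.
Let T := wT w U.
Let sM : @shilov R A = @MA R A := shilov_regular hreg.
Let chk (h : @chi R A -> R[i]) (t : @chi R A) := checkT w U h t - l * h t.

Implicit Types (g h k : @chi R A -> R[i]).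

Lemma supnorm_bounded g : checkA g -> has_sup [set cabs (g t) | t in @MA R A].
Proof.
move=> hg; split.
  by have [m hm] := MA_nonempty hss; exists (cabs (g m)), m.
have [f hf] := hg 1 ltr01; exists (1 + nA f) => _ [t ht <-].
have ht' : shilov t by rewrite sM.
have := cabsD (g t - t f) (t f); rewrite subrK => h; apply: (le_trans h).
by apply: lerD; [exact: hf|exact: char_le].
Qed.

Lemma le_supnorm g t : checkA g -> MA t -> cabs (g t) <= supnorm g.
Proof.
move=> hg ht; rewrite /supnorm sM; apply: (ub_le_sup (proj2 (supnorm_bounded hg))).
by exists t.
Qed.

Lemma supnorm_le (g : @chi R A -> R[i]) B : (forall t, MA t -> cabs (g t) <= B) ->
  supnorm g <= B.
Proof.
move=> h; rewrite /supnorm sM; apply: sup_le_ub; last by move=> _ [t ht <-]; apply: h.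
by have [m hm] := MA_nonempty hss; exists (cabs (g m)), m.
Qed.

Lemma checkA_gelfand (f : A) : checkA (fun t => t f).
Proof. by move=> e e0; exists f => t _; rewrite subrr cabs0 ltW. Qed.

Lemma chk_gelfand f t : MA t -> chk (fun t => t f) t = t (T f - l *: f).
Proof. by move=> ht; rewrite (charB ht) (charM ht) (charZ ht). Qed.

Lemma chkB h k t : chk (fun t => h t - k t) t = chk h t - chk k t.
Proof. by rewrite /chk /checkT; ring. Qed.

Lemma chk_approx (h : @chi R A -> R[i]) (v : A) e t : MA t ->
  (forall t, MA t -> cabs (h t - t v) <= e) ->
  cabs (chk h t - t (T v - l *: v)) <= (nA w + cabs l) * e.
Proof.
move=> ht hv; rewrite -chk_gelfand// -chkB /chk /checkT mulrDl.
apply: (le_trans (cabs_subD _ _)); rewrite !cabsM; apply: lerD.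
  apply: ler_pM; rewrite ?cabs_ge0//; first exact: char_le.
  exact: (hv _ (char_aut hU ht)).
by rewrite ler_wpM2l ?cabs_ge0// hv.
Qed.

Lemma checkA_sub h k : checkA h -> checkA k -> checkA (fun t : @chi R A => h t - k t).
Proof.
move=> hh hk e e0; have e2 : 0 < e / 2 by lra.
have [f hf] := hh _ e2; have [g hg] := hk _ e2; exists (f - g) => t ht.
have mt : MA t by rewrite -sM.
rewrite (charB mt); have -> : h t - k t - (t f - t g) = (h t - t f) - (k t - t g) by ring.
apply: (le_trans (cabs_subD _ _)); have := hf t ht; have := hg t ht; lra.
Qed.

Lemma checkA_chk h : checkA h -> checkA (chk h).
Proof.
move=> hh e e0.
have D0 : 0 < nA w + cabs l + 1 by have := nA_ge0 hnA w; have := cabs_ge0 l; lra.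
have [v hv] := hh _ (divr_gt0 e0 D0); exists (T v - l *: v) => t; rewrite sM => ht.
have hv' s : MA s -> cabs (h s - s v) <= e / (nA w + cabs l + 1).
  by move=> hs; apply: hv; rewrite sM.
apply: (le_trans (chk_approx ht hv')); rewrite mulrCA ler_piMr ?(ltW e0)//.
by rewrite ler_pdivrMr// mul1r lerDl.
Qed.

(** The resolvent sends a Gelfand transform to a uniform limit of transforms; approximating that
    limit inside [A] gives the dense range. *)
Lemma check_resolvent_gelfand : ~ checkT_spectrum w U l ->
  (exists K, forall f, snorm f <= K * snorm (T f - l *: f)) /\
  forall (g : A) (e : R), 0 < e -> exists v, snorm (T v - l *: v - g) <= e.
Proof.
move=> /contrapT[S [SA [K hK] h1 h2]]; split.
  exists K => f.
  have c := checkA_chk (checkA_gelfand f).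
  have -> : snorm f = supnorm (S (chk (fun t => t f))).
    rewrite /snorm /supnorm -sM; congr sup; apply: eq_imagel => t ht.
    by rewrite h2//; apply: checkA_gelfand.
  apply: (le_trans (hK _ c)).
  have -> : supnorm (chk (fun t => t f)) = snorm (T f - l *: f); last by [].
  rewrite /snorm /supnorm -sM; congr sup; apply: eq_imagel => t ht.
  by rewrite chk_gelfand// -sM.
move=> g e e0.
have D0 : 0 < nA w + cabs l + 1 by have := nA_ge0 hnA w; have := cabs_ge0 l; lra.
have cg := checkA_gelfand g.
have [v hv] := SA _ cg _ (divr_gt0 e0 D0).
exists v; apply: (snorm_le hnA hss) => t ht.
have hv' s : MA s -> cabs (S (fun t => t g) s - s v) <= e / (nA w + cabs l + 1).
  by move=> hs; apply: hv; rewrite sM.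
have := chk_approx ht hv'; rewrite [chk _ t]h1 ?sM// => h.
rewrite (charB ht) cabsB; apply: (le_trans h); rewrite mulrCA ler_piMr ?(ltW e0)//.
by rewrite ler_pdivrMr// mul1r lerDl.
Qed.

Variable M : R.
Hypothesis M0 : 0 <= M.
Hypothesis below : forall f, snorm f <= M * snorm (T f - l *: f).

Lemma chk_below h B : checkA h -> (forall t, MA t -> cabs (chk h t) <= B) ->
  forall t, MA t -> cabs (h t) <= M * B.
Proof.
move=> hh hB t ht; apply/ler_addgt0Pr => e e0.
(* An approximation error [d] costs [d] on [h] and [M (nA w + |l|) d] through the lower bound. *)
pose D := 1 + M * (nA w + cabs l).
have wl : 0 <= nA w + cabs l by rewrite addr_ge0 ?(nA_ge0 hnA) ?cabs_ge0.
have D0 : 0 < D by rewrite /D; have := mulr_ge0 M0 wl; lra.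
have [v hv] := hh _ (divr_gt0 e0 D0); set d := e / D in hv.
have dD : d * D = e by rewrite divfK// gt_eqF.
have hv' s : MA s -> cabs (h s - s v) <= d by move=> hs; apply: hv; rewrite sM.
have sv : snorm v <= M * (B + (nA w + cabs l) * d).
  apply: (le_trans (below v)); rewrite ler_wpM2l//; apply: (snorm_le hnA hss) => s hs.
  have h1 := chk_approx hs hv'; have h2 := hB s hs; rewrite cabsB in h1.
  have := cabsD (s (T v - l *: v) - chk h s) (chk h s); rewrite subrK; lra.
have h1 := hv' t ht; have h2 := char_le_snorm hnA hss v ht.
have := cabsD (h t - t v) (t v); rewrite subrK => h3.
have -> : M * B + e = d + M * (B + (nA w + cabs l) * d) by rewrite -dD /D; ring.
by move: h1 h2 h3 sv; lra.
Qed.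

Hypothesis onto : forall f, exists v, T v - l *: v = f.

(** Approximants of [g] are solved in [A]. The lower bound makes the solutions uniformly Cauchy, so
    their pointwise ultralimit is a uniform limit and lies in [checkA]. *)
Lemma chk_onto g : checkA g -> exists h, checkA h /\ forall t, MA t -> chk h t = g t.
Proof.
move=> hg.
have seqf (n : nat) : exists v : A, forall t, MA t ->
    cabs (g t - t (T v - l *: v)) <= 2^-1 ^+ n.
  have [|f hf] := hg (2^-1 ^+ n); first by rewrite exprn_gt0// invr_gt0.
  have [v hv] := onto f; exists v => t ht; rewrite hv; apply: hf; by rewrite sM.
have [v hv] := choice seqf.
have cau (n k : nat) t : (n <= k)%N -> MA t -> cabs (t (v k) - t (v n)) <= M * (2 * 2^-1 ^+ n).
  move=> nk ht; rewrite -(charB ht); apply: (le_trans (char_le_snorm hnA hss _ ht)).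
  apply: (le_trans (below _)); rewrite ler_wpM2l//; apply: (snorm_le hnA hss) => s hs.
  have h1 := hv n s hs; have h2 := hv k s hs.
  have h3 : (2^-1 : R) ^+ k <= 2^-1 ^+ n.
    by apply: ler_wiXn2l; rewrite ?invr_ge0//; lra.
  have lT : linop T := wT_linop w hU.
  have -> : T (v k - v n) - l *: (v k - v n) = (T (v k) - l *: v k) - (T (v n) - l *: v n).
    by rewrite (linopB lT) scalerBr; ring.
  rewrite (charB hs).
  have -> : s (T (v k) - l *: v k) - s (T (v n) - l *: v n) =
    (g s - s (T (v n) - l *: v n)) - (g s - s (T (v k) - l *: v k)) by ring.
  apply: (le_trans (cabs_subD _ _)); lra.
have [G [GU Goo]] := nat_free_ultrafilter.
have GF : Filter G := @filter_filter _ _ (@ultra_proper _ _ GU).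
have lim (t : @chi R A) : exists z, MA t -> ucvg G (fun n => t (v n)) z.
  have [ht|?] := pselect (MA t); last by exists 0.
  have [z hz] : exists z, ucvg G (fun n => t (v n)) z.
    apply: (ucvg_bounded GU (B := M * 2 + nA (v 0%N))) => n.
    have := cau 0%N n t (leq0n n) ht; rewrite expr0 mulr1 => h.
    have := cabsD (t (v n) - t (v 0%N)) (t (v 0%N)); rewrite subrK.
    have := char_le hnA (v 0%N) ht; lra.
  by exists z.
have [h hh] := choice lim.
have near n t : MA t -> cabs (h t - t (v n)) <= M * (2 * 2^-1 ^+ n).
  move=> ht; apply: (ucvg_cabs_le GU (hh t ht)).
  by apply: filterS (Goo n) => k /= nk; apply: cau.
exists h; split.
  move=> e e0; have D0 : 0 < 2 * M + 1 by move: M0; lra.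
  have [] := @expr_eventually_small R 2^-1 (e / (2 * M + 1)); try lra.
    by rewrite divr_gt0.
  move=> n /(_ n (leqnn n)); rewrite ltr_pdivlMr// => hn.
  exists (v n) => t; rewrite sM => ht; apply: (le_trans (near n t ht)).
  have q0 : 0 < (2^-1 : R) ^+ n by rewrite exprn_gt0// invr_gt0.
  by move: hn q0; set q := 2^-1 ^+ n; lra.
move=> t ht.
have u1 : ucvg G (fun n => t w * t (U (v n)) + (- l * t (v n) + 0)) (chk h t).
  have -> : chk h t = t w * h (phi U t) + (- l * h t + 0).
    by rewrite /chk /checkT addr0 mulNr.
  apply: ucvg_lin; first exact: (hh _ (char_aut hU ht)).
  by apply: ucvg_lin; [exact: hh|exact: ucvg_cst].
apply: (ucvg_unique GU u1) => e e0.
have [] := @expr_eventually_small R 2^-1 e; try lra.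
move=> N hN; apply: filterS (Goo N) => n /= Nn.
apply: le_lt_trans (hN n Nn); have := hv n t ht; rewrite cabsB.
by rewrite (charB ht) (charM ht) (charZ ht) addr0 mulNr.
Qed.

Lemma check_resolvent : ~ checkT_spectrum w U l.
Proof.
apply; have ex g : exists h, checkA g -> checkA h /\ forall t, MA t -> chk h t = g t.
  have [hg|?] := pselect (checkA g); last by exists g.
  by have [h hh] := chk_onto hg; exists h.
have [S hS] := choice ex; exists S; split.
- by move=> g /hS[].
- exists M => g hg; have [cS eS] := hS g hg; apply: supnorm_le.
  by apply: (chk_below cS) => t ht; rewrite eS// le_supnorm.
- by move=> g hg t; rewrite sM => ht; have [_ /(_ t ht)] := hS g hg.
- move=> g hg t; rewrite sM => ht.
  have ck := checkA_chk hg; have [cS eS] := hS _ ck.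
  apply/eqP; rewrite -subr_eq0 -cabs_eq0 eq_le cabs_ge0 andbT -(mulr0 M).
  apply: (chk_below (checkA_sub cS hg)) => // s hs.
  by rewrite chkB eS// subrr cabs0.
Qed.

End CheckOperator.
End Resolvents.

(** * Comparison of the two spectra *)

Section MainSetup.
Variables (R : realType) (A : comUnitAlgType R[i]) (nA : A -> R).
Hypothesis hnA : is_banach_alg_norm nA.
Hypothesis hss : @semisimple R A.
Hypothesis hreg : @regular R A.
Variables (U V : A -> A).
Hypothesis hU : is_automorphism U.
Hypothesis UV : cancel U V.
Hypothesis VU : cancel V U.

(** Inverting twice returns the weight [w], so orbit growth for [T'] is that lemma with the roles of
    [U] and [V] exchanged. *)
Lemma aut_inverse_weight w : w \is a GRing.unit -> U (V w^-1)^-1 = w.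
Proof.
move=> uw; have hV := aut_inverse hU UV VU.
have e : V w^-1 * V w = 1 by rewrite -(autM hV) mulVr// (aut1 hV).
by rewrite (mulr1_eq e) VU.
Qed.

(** As 0 is outside the spectrum, [V] is bounded, and then so is [U]. For [|l| > 1] the resolvent of
    [V] at [l] comes from that of [U] at [1/l], a point inside the disc. *)
Lemma automorphism_growth : op_spectrum nA U `<=` @unit_circle R ->
  [/\ exists K, forall x, nA (U x) <= K * nA x, exists K, forall x, nA (V x) <= K * nA x,
      subexp nA U & subexp nA V].
Proof.
move=> hspec; have lU := aut_linop hU; have lV := aut_linop (aut_inverse hU UV VU).
have res l : cabs l != 1 -> (exists K, forall x, nA x <= K * nA (U x - l *: x)) /\
    forall y, exists x, U x - l *: x = y.
  by move=> l1; apply/(op_resolventP hnA l lU) => /hspec h; move/eqP: l1.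
have [KV bV] : exists K, forall x, nA (V x) <= K * nA x.
  have [|[K hK] _] := res 0; first by rewrite cabs0 eq_sym oner_eq0.
  by exists K => x; have := hK (V x); rewrite scale0r subr0 VU.
have [KU bU] := bounded_inverse hnA lU lV UV VU bV.
split; [by exists KU|by exists KV| |].
  by apply: (spectral_growth hnA lU bU) => l l1; apply: res; rewrite gt_eqF.
apply: (spectral_growth hnA lV bV) => l l1.
have l0 : l != 0 by rewrite -cabs_gt0; lra.
have [|[K hK] sur] := res l^-1.
  by rewrite cabsV lt_eqF// invf_lt1//; lra.
have eqn z : z - l *: U z = (- l) *: (U z - l^-1 *: z).
  by rewrite scalerBr scalerA mulNr divff// !scaleNr scale1r opprK addrC.
split=> [|y].
  exists (`|KU| * (`|K| / cabs l)) => x; have := hK (V x); rewrite VU => h.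
  have e : nA (V x - l *: x) = cabs l * nA (x - l^-1 *: V x).
    by have := eqn (V x); rewrite VU => ->; rewrite (nAZ hnA) cabsN.
  have -> : `|KU| * (`|K| / cabs l) * nA (V x - l *: x) =
      `|KU| * (`|K| * nA (x - l^-1 *: V x)).
    by rewrite e; field; rewrite gt_eqF// cabs_gt0.
  rewrite -{1}(VU x); apply: (le_trans (bU _)).
  apply: (@le_trans _ _ (`|KU| * nA (V x))); first by rewrite ler_wpM2r ?(nA_ge0 hnA)// ler_norm.
  rewrite ler_wpM2l//; apply: (le_trans h).
  by rewrite ler_wpM2r ?(nA_ge0 hnA)// ler_norm.
have [z hz] := sur ((- l)^-1 *: y); exists (U z).
by rewrite UV eqn hz scalerA divff ?scale1r// oppr_eq0.
Qed.

Variable C : R.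
Hypothesis C0 : 0 < C.
Hypothesis hC : product_estimate nA C.
Hypothesis hdisj : forall f g : A, supp f `&` supp g = set0 -> nA (f + g) = nA (f - g).
Hypothesis hper : first_category (@shilov R A) (periodic_points U).
Hypothesis gU : subexp nA U.
Hypothesis gV : subexp nA V.
Hypothesis bU : exists K, forall x, nA (U x) <= K * nA x.
Hypothesis bV : exists K, forall x, nA (V x) <= K * nA x.

Lemma no_type1_nA w k : w \is a GRing.unit ->
  (forall f, nA f <= k * nA (f - wT w U f)) -> forall t, ~ type1 U V w t.
Proof.
move=> uw hk t ty; have hV := aut_inverse hU UV VU.
have uw' : V w^-1 \is a GRing.unit by apply: unit_aut => //; rewrite unitrV.
apply: (type1_not_bounded_below hnA hreg hU UV VU uw (nAD hnA) (nAZ hnA) (nA_eq0 hnA)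
  hdisj _ _ hper ty hk); first exact: (nA_orbit_growth hnA hreg C0 hC).
have := nA_orbit_growth hnA hreg C0 hC hV VU UV uw' gV.
by rewrite aut_inverse_weight.
Qed.

Lemma no_type1_snorm w k : w \is a GRing.unit ->
  (forall f, snorm f <= k * snorm (f - wT w U f)) -> forall t, ~ type1 U V w t.
Proof.
move=> uw hk t ty; have hV := aut_inverse hU UV VU.
have uw' : V w^-1 \is a GRing.unit by apply: unit_aut => //; rewrite unitrV.
apply: (type1_not_bounded_below hnA hreg hU UV VU uw (snormD hnA hss) (snormZ hnA hss)
  (snorm_eq0 hnA hss) _ _ _ hper ty hk).
- by move=> f g fg; apply: snorm_disjoint.
- exact: (snorm_orbit_growth hnA hss).
- have := snorm_orbit_growth hnA hss hV VU UV uw'.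
  by rewrite aut_inverse_weight.
Qed.

(** The value 0 is treated apart because the rescaling by [l^-1] excludes it. *)
Lemma zero_notin_spectra w : w \is a GRing.unit ->
  ~ op_spectrum nA (wT w U) 0 /\ ~ checkT_spectrum w U 0.
Proof.
move=> uw; have [KV hKV] := bV; have hV := aut_inverse hU UV VU.
have onto y : exists x, wT w U x - 0 *: x = y.
  by exists (V (w^-1 * y)); rewrite scale0r subr0 /wT VU mulVKr.
have VT x : V (w^-1 * (wT w U x)) = x by rewrite /wT mulKr// UV.
split.
  apply/(op_resolventP hnA 0 (wT_linop w hU)); split=> //.
  exists (`|KV| * nA w^-1) => x; rewrite scale0r subr0 -{1}(VT x).
  apply: (le_trans (hKV _)).
  apply: (@le_trans _ _ (`|KV| * nA (w^-1 * wT w U x))).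
    by rewrite ler_wpM2r ?(nA_ge0 hnA)// ler_norm.
  by rewrite -mulrA ler_wpM2l// (nAM hnA).
apply: (check_resolvent hnA hss hreg hU (nA_ge0 hnA w^-1)) => // f.
rewrite scale0r subr0; apply: (snorm_le hnA hss) => t ht; rewrite -{1}(VT f) -/(wT w U f).
have htV := char_aut hV ht.
rewrite -[t (V _)]/((t \o V) _) (charM htV) cabsM.
apply: ler_pM; rewrite ?cabs_ge0//; first exact: (char_le hnA _ htV).
exact: (char_le_snorm hnA hss _ htV).
Qed.

Lemma spectra_agree w (l : R[i]) : w \is a GRing.unit -> l != 0 ->
  ~ op_spectrum nA (wT w U) l <-> ~ checkT_spectrum w U l.
Proof.
move=> uw l0; pose w' := l^-1 *: w.
have uw' : w' \is a GRing.unit.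
  apply/unitrPr; exists (l *: w^-1).
  by rewrite -scalerAl -scalerAr scalerA mulVf// scale1r divrr.
have cl : 0 < cabs l by rewrite cabs_gt0.
have eqn f : wT w U f - l *: f = (- l) *: (f - wT w' U f).
  by rewrite /wT /w' -scalerAl scalerBr scalerA mulNr divff// !scaleNr scale1r opprK addrC.
have nE f : nA (wT w U f - l *: f) = cabs l * nA (f - wT w' U f).
  by rewrite eqn (nAZ hnA) cabsN.
have sE f : snorm (wT w U f - l *: f) = cabs l * snorm (f - wT w' U f).
  by rewrite eqn (snormZ hnA hss) cabsN.
split.
  move/(op_resolventP hnA l (wT_linop w hU)) => [[K hK] onto].
  have no1 : forall t, ~ type1 U V w' t.
    apply: (no_type1_nA (k := K * cabs l)) => // f.
    by rewrite -mulrA -nE.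
  have [M [M1 below]] := snorm_bounded_below hnA hss hU UV VU uw' no1.
  apply: (check_resolvent hnA hss hreg hU (M := M / cabs l)) => //.
    by rewrite divr_ge0 ?cabs_ge0//; lra.
  move=> f; rewrite sE mulrA divfK ?gt_eqF//.
  by have := below 1 f (cabs1 R); rewrite scale1r.
move/(check_resolvent_gelfand hnA hss hreg hU) => [[K hK] dense].
have no1 : forall t, ~ type1 U V w' t.
  apply: (no_type1_snorm (k := K * cabs l)) => // f.
  by rewrite -mulrA -sE.
have dr : dense_range (wT w' U) 1.
  move=> g e e0; have [v hv] := dense ((- l) *: g) _ (mulr_gt0 cl e0); exists v.
  move: hv; rewrite eqn -scalerBr (snormZ hnA hss) cabsN ler_pM2l//.
  by rewrite scale1r.
have [M [M1 below]] := snorm_bounded_below hnA hss hU UV VU uw' no1.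
have [K' hK'] := one_minus_T_onto hnA hss hreg C0 hC hU UV VU uw' gU gV no1 dr bU bV.
apply/(op_resolventP hnA l (wT_linop w hU)); split.
  exists (K' / cabs l) => x; rewrite nE mulrA divfK ?gt_eqF//.
  have [v [hv vK]] := hK' (x - wT w' U x).
  (* Uniqueness comes from the lower bound in the sup norm, the estimate in [A] from the solution
     [v]. *)
  suff -> : x = v by rewrite hv.
  have := below 1 (x - v) (cabs1 R); rewrite scale1r (linopB (wT_linop w' hU)).
  have -> : x - v - (wT w' U x - wT w' U v) = (x - wT w' U x) - (v - wT w' U v) by ring.
  rewrite hv subrr (snorm0 hnA hss) mulr0 => h.
  apply/eqP; rewrite -subr_eq0; apply/eqP; apply: (snorm_eq0 hnA hss).
  by apply/eqP; rewrite eq_le h (snorm_ge0 hnA hss).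
move=> y; have [v [hv _]] := hK' ((- l)^-1 *: y); exists v.
by rewrite eqn hv scalerA divff ?scale1r// oppr_eq0.
Qed.

End MainSetup.

Theorem theorem7 (R : realType) (A : comUnitAlgType R[i]) (nA : A -> R)
  (hnA : is_banach_alg_norm nA)
  (hss : @semisimple R A) (hreg : @regular R A)
  (hC : exists C : R, 0 < C /\
     forall V : set (@chi R A), wopen (@shilov R A) V ->
     forall (p : nat), (0 < p)%N -> forall fs : 'I_p -> A,
       supp (\prod_(i < p) fs i) `<=` V ->
       nA (\prod_(i < p) fs i) <=
         C * \sum_(j < p) nA (fs j) *
           sup [set cabs (\prod_(k < p | k != j) t (fs k)) | t in wclosure (@shilov R A) V])
  (hdisj : forall f g : A, supp f `&` supp g = set0 -> nA (f + g) = nA (f - g))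
  (U : A -> A) (hU : is_automorphism U)
  (hper : first_category (@shilov R A) (periodic_points U))
  (hspec : op_spectrum nA U = @unit_circle R)
  (w : A) (hw : w \is a GRing.unit) :
  op_spectrum nA (fun f => w * U f) = checkT_spectrum w U.
Proof.
have [C [C0 hC']] := hC.
have [V UV VU] : bijective U by case: hU.
have [|bU bV gU gV] := automorphism_growth hnA hU UV VU; first by rewrite hspec.
rewrite -[fun f => w * U f]/(wT w U); apply/seteqP; split=> l; apply: contraPP.
  have [->|l0] := eqVneq l 0.
    by case: (zero_notin_spectra hnA hss hreg hU UV VU bV hw).
  by case: (spectra_agree hnA hss hreg hU UV VU C0 hC' hdisj hper gU gV bU bV hw l0).
have [->|l0] := eqVneq l 0.
  by case: (zero_notin_spectra hnA hss hreg hU UV VU bV hw).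
by case: (spectra_agree hnA hss hreg hU UV VU C0 hC' hdisj hper gU gV bU bV hw l0).
Qed.
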